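(* Let $\mu^{\mathrm{big}}_{i_0}$ be the measure on $\mathcal H^2\times\Omega_{i_0}^3\times V^2\times\mathcal T^2$ and $\mu^{\mathrm{susy}}_{i_0}$ the probability measure on $\Omega_{i_0}^2\times\mathcal T$ defined in the context. Then the marginal (image measure) of $(s,u,T')$ with respect to $\mu^{\mathrm{big}}_{i_0}$ equals $\mu^{\mathrm{susy}}_{i_0}$: $$\mathcal L_{\mu^{\mathrm{big}}_{i_0}}(s,u,T')=\mu^{\mathrm{susy}}_{i_0}.$$ In particular, $\mu^{\mathrm{big}}_{i_0}$ is a probability measure.
   Context: Let $G=(V,E)$ be a finite connected undirected graph (edges are two-element subsets $\{i,j\}$ of $V$), with weights $W_{ij}=W_{ji}>0$ for $\{i,j\}\in E$. Let $\vec E=\{(i,j):\{i,j\}\in E\}$ be the set of directed edges (each undirected edge gives two directed edges). Fix $i_0\in V$ and let $\Omega_{i_0}=\{u\in\mathbb R^V:u_{i_0}=0\}$. Let $\mathcal T$ be the set of undirected spanning trees of $G$, each viewed as a set of undirected edges. The measure $\mu^{\mathrm{susy}}_{i_0}$ on $\Omega_{i_0}^2\times\mathcal T$ (variables $(s,u,T')$) is $$\mu_{i_0}^{\mathrm{susy}}(ds\,du\,dT')=\exp\Big(\sum_{\{i,j\}\in E}W_{ij}\big(1-\cosh(u_i-u_j)-\tfrac12e^{u_i+u_j}(s_i-s_j)^2\big)\Big)\prod_{\{i,j\}\in T'}W_{ij}e^{u_i+u_j}\prod_{i\in V\setminus\{i_0\}}\frac{e^{-u_i}\,ds_i\,du_i}{2\pi}\,dT',$$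 with $ds_i,du_i$ Lebesgue measure on $\mathbb R$ and $dT'$ counting measure on $\mathcal T$. It is a known fact (from the literature) that $\mu_{i_0}^{\mathrm{susy}}$ is a probability measure. Let $\mathcal H$ be the linear space of all $\kappa=(\kappa_{ij})_{(i,j)\in\vec E}\in\mathbb R^{\vec E}$ with $\sum_{j:\{i,j\}\in E}(\kappa_{ij}-\kappa_{ji})=0$ for all $i\in V$. Take any directed spanning tree $\vec T_0\subset\vec E$ (a spanning tree with each edge given one direction). The restriction map $\iota:\mathcal H\to\mathbb R^{\vec E\setminus\vec T_0}$ is an isomorphism; $d\kappa_{\mathcal H}$ is the image under $\iota^{-1}$ of Lebesgue measure on $\mathbb R^{\vec E\setminus\vec T_0}$ (it does not depend on $\vec T_0$). For $u\in\Omega_{i_0}$ put $\omega'_{ij}=\frac{W_{ij}}2e^{u_i+u_j}$. For $\kappa,\kappa'\in\mathbb R^{\vec E}$, $s,v,u\in\Omega_{i_0}$, $i_1,i_1'\in V$, $T,T'\in\mathcal T$ let $$\rho^{\mathrm{big}}_{i_0}(\kappa,\kappa',s,v,u,i_1,i_1',T,T')=\frac{4^{|V|-1}}{(2\pi)^{2|E|}}\exp\Big(\sum_{\{i,j\}\in E}W_{ij}\big(1-\cosh(u_i-u_j)-\tfrac12e^{u_i+u_j}(s_i-s_j)^2\big)\Big)\prod_{\{i,j\}\in T}\omega'_{ij}\prod_{\{i,j\}\in T'}\omega'_{ij}\prod_{\{i,j\}\in E}\frac1{(\omega'_{ij})^2}$$ $$\cdot\exp\Big(-\sum_{(i,j)\in\vec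 E}\frac{\kappa_{ij}^2+(\kappa'_{ij})^2}{2\omega'_{ij}}\Big)\frac{e^{2v_{i_1}+2u_{i_1'}}}{\sum_{i\in V}e^{2v_i}\sum_{j\in V}e^{2u_j}}\prod_{i\in V\setminus\{i_0\}}e^{-u_i}.$$ The measure $\mu^{\mathrm{big}}_{i_0}$ on $\mathcal H^2\times\Omega_{i_0}^3\times V^2\times\mathcal T^2$ (variables $(\kappa,\kappa',s,v,u,i_1,i_1',T,T')$) is $$\mu^{\mathrm{big}}_{i_0}=\rho^{\mathrm{big}}_{i_0}\,d\kappa_{\mathcal H}\,d\kappa'_{\mathcal H}\prod_{i\in V\setminus\{i_0\}}1_{\{u_i=v_i\}}\,ds_i\,du_i\cdot di_1\,di_1'\,dT\,dT',$$ where $1_{\{u_i=v_i\}}du_i$ is the Lebesgue measure on the diagonal of $\mathbb R^2$ (the image of $du_i$ under $u_i\mapsto(v_i,u_i)=(u_i,u_i)$) and $di_1,di_1',dT,dT'$ are counting measures. *)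

(* Defs.v *)
From HB Require Import structures.
From mathcomp Require Import all_boot all_order all_algebra.
From mathcomp Require Import all_classical all_reals all_analysis.

Set Implicit Arguments.
Unset Strict Implicit.
Unset Printing Implicit Defensive.

Import Order.TTheory GRing.Theory Num.Theory.

Local Open Scope ring_scope.

Section Adjacency.
Variable V : finType.
Implicit Type F : {set {set V}}.

Definition adj_rel F : rel V := fun i j => [set i; j]%SET \in F.

Definition connected_edges F := forall i j, connect (adj_rel F) i j.

(* [ucycle] also accepts loops and back-and-forth walks i, j, i, which are
   cycles of length 1 and 2. *)
Definition acyclic_edges F :=
  forall c : seq V, ucycle (adj_rel F) c -> (size c < 3)%N.

Lemma adj_rel_sym F : symmetric (adj_rel F).
Proof. by move=> i j; rewrite /adj_rel finset.setUC. Qed.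

(* The value f i j at the edge e = {i, j}. The endpoints are picked in an
   arbitrary order, so this is only meant for f symmetric on edges. *)
Definition at_edge (R : nzRingType) (f : V -> V -> R) (e : {set V}) : R :=
  if [pick p : V * V | e == [set p.1; p.2]%SET] is Some p then f p.1 p.2 else 0.

Lemma at_edgeE (R : nzRingType) (f : V -> V -> R) i j :
  f i j = f j i -> at_edge f [set i; j]%SET = f i j.
Proof.
move=> fij; rewrite /at_edge; case: pickP => [[k l] /= /eqP ekl|/(_ (i, j))];
  last by rewrite /= eqxx.
have : i \in [set k; l]%SET by rewrite -ekl !inE eqxx.
have : j \in [set k; l]%SET by rewrite -ekl !inE eqxx orbT.
have : k \in [set i; j]%SET by rewrite ekl !inE eqxx.
have : l \in [set i; j]%SET by rewrite ekl !inE eqxx orbT.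
by rewrite !inE => /orP[]/eqP-> /orP[]/eqP-> /orP[]/eqP ? /orP[]/eqP ?; subst.
Qed.

End Adjacency.

Record rooted_graph := RootedGraph {
  vertex : finType;
  edges : {set {set vertex}};
  root_vertex : vertex;
  edge_card2 : forall e, e \in edges -> #|e| = 2;
  edges_connected : connected_edges edges }.

(* A copy of [vertex G] carrying the discrete sigma-algebra. *)
Definition vertex_space (G : rooted_graph) : Type := vertex G.

HB.instance Definition _ (G : rooted_graph) := Choice.on (vertex_space G).
HB.instance Definition _ (G : rooted_graph) :=
  isPointed.Build (vertex_space G) (root_vertex G).
HB.instance Definition _ (G : rooted_graph) :=
  @isMeasurable.Build default_measure_display (vertex_space G)
    discrete_measurable discrete_measurable0 discrete_measurableC
    discrete_measurableU.

Section SpanningTrees.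
Variable G : rooted_graph.

Definition spanning_tree (T : {set {set vertex G}}) : Prop :=
  [/\ T \subset edges G, connected_edges T & acyclic_edges T].

Lemma spanning_tree_exists : exists T, spanning_tree T.
Proof.
pose P (T : {set {set vertex G}}) :=
  (T \subset edges G) && [forall i, forall j, connect (adj_rel T) i j].
have PE : P (edges G).
  by rewrite /P subxx; apply/forallP => i; apply/forallP => j;
    exact: edges_connected.
case: (arg_minnP (fun T : {set {set vertex G}} => #|T|) PE) => T /andP[TE /forallP cT] Tmin.
exists T; split=> //; first by move=> i j; exact: (forallP (cT i) j).
move=> [|x [|y [|z c]]] // /andP[].
rewrite /= rcons_path => /and3P[xy yz /andP[zc lx]].
rewrite !inE !negb_or => /and3P[/and3P[xy' xz xc] /andP[yz' yc] /andP[zc' cu]].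
exfalso; pose T' := (T :\ [set x; y])%SET.
suff /Tmin : P T' by rewrite leqNgt (cardsD1 [set x; y]%SET T) (_ : _ \in T) ?ltnSn.
have adjT' i j : adj_rel T i j -> ~~ ((i \in [set x; y]%SET) && (j \in [set x; y]%SET))
    -> adj_rel T' i j.
  move=> ij nij; rewrite /adj_rel !inE; apply/andP; split=> //.
  apply: contra nij => /eqP <-; rewrite !inE !eqxx orbT //.
have sT' : connect_sym (adj_rel T') by apply: sym_connect_sym; exact: adj_rel_sym.
have yx : connect (adj_rel T') y x.
  apply: (@connect_trans _ _ z).
    apply: connect1; apply: adjT' => //.
    by rewrite !inE [z == x]eq_sym [z == y]eq_sym (negbTE xz) (negbTE yz') andbF.
  apply: (@connect_trans _ _ (last z c)).
    apply/connectP; exists c => //.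
    have: all [pred w | w \notin [set x; y]%SET] (z :: c).
      apply/allP => w; rewrite !inE => /predU1P[->|wc].
        by rewrite negb_or eq_sym xz eq_sym yz'.
      rewrite negb_or; apply/andP; split.
        by apply: contraNneq xc => <-.
      by apply: contraNneq yc => <-.
    elim: c z zc {yz xz xc yz' yc zc' cu lx} => //= w c IH z /andP[zw wc] /andP[nz nwc].
    rewrite IH // andbT; apply: adjT' => //.
    by rewrite (negbTE nz).
  apply: connect1; apply: adjT' => //.
  have : last z c \in z :: c by exact: mem_last.
  rewrite !inE => lzc; rewrite !negb_and !negb_or; apply/orP; left.
  case/predU1P: lzc => [->|lc]; first by rewrite eq_sym xz eq_sym yz'.
  by apply/andP; split; [apply: contraNneq xc => <-|apply: contraNneq yc => <-].
apply/andP; split; first by apply: fintype.subset_trans TE; exact: finset.subsetDl.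
apply/forallP => i; apply/forallP => j.
apply: (connect_sub _ (forallP (cT i) j)) => {i j} a b ab.
have [eab|nab] := eqVneq [set a; b]%SET [set x; y]%SET; last first.
  by apply: connect1; rewrite /adj_rel !inE nab.
have : a \in [set x; y]%SET by rewrite -eab !inE eqxx.
have : b \in [set x; y]%SET by rewrite -eab !inE eqxx orbT.
by rewrite !inE => /orP[]/eqP-> /orP[]/eqP->; rewrite // sT'.
Qed.

Definition tree : Type := {T : {set {set vertex G}} | `[< spanning_tree T >]}.

HB.instance Definition _ := Finite.on tree.
HB.instance Definition _ := isPointed.Build tree
  (exist (fun T => `[< spanning_tree T >]) (sval (cid spanning_tree_exists))
    (asboolT (svalP (cid spanning_tree_exists)))).
HB.instance Definition _ :=
  @isMeasurable.Build default_measure_display tree discrete_measurable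
    discrete_measurable0 discrete_measurableC discrete_measurableU.

Definition dedge : Type := {p : vertex G * vertex G | [set p.1; p.2]%SET \in edges G}.

HB.instance Definition _ := Finite.on dedge.

Definition src (a : dedge) : vertex G := (sval a).1.
Definition tgt (a : dedge) : vertex G := (sval a).2.
Definition undirected (a : dedge) : {set vertex G} := [set src a; tgt a]%SET.

Lemma rev_dedge_subproof (a : dedge) : [set tgt a; src a]%SET \in edges G.
Proof. by rewrite finset.setUC; exact: svalP a. Qed.

Definition rev_dedge (a : dedge) : dedge :=
  exist _ (tgt a, src a) (rev_dedge_subproof a).

Definition directed_spanning_tree (T0 : {set dedge}) : Prop :=
  spanning_tree (undirected @: T0)%SET /\
  (forall a, a \in T0 -> rev_dedge a \notin T0).

End SpanningTrees.

Local Open Scope classical_set_scope.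

(* For X a subset of R^I with I finite and c its coordinate functions, this is
   the Borel sigma-algebra of X. *)
Section CoordinateSigmaAlgebra.
Variables (R : realType) (I X : Type) (c : I -> X -> R).

Definition coord_measurable : set (set X) :=
  <<s \bigcup_i preimage_set_system setT (c i) (@measurable _ R) >>.

Lemma coord_measurable0 : coord_measurable set0.
Proof. by rewrite /coord_measurable; exact: sigma_algebra0. Qed.

Lemma coord_measurableC A : coord_measurable A -> coord_measurable (~` A).
Proof. by move=> mA; rewrite -setTD; exact: sigma_algebraCD. Qed.

Lemma coord_measurableU (F : (set X)^nat) :
  (forall i, coord_measurable (F i)) -> coord_measurable (\bigcup_i F i).
Proof. by rewrite /coord_measurable; exact: sigma_algebra_bigcup. Qed.

End CoordinateSigmaAlgebra.

Definition Rn (R : realType) (I : finType) : Type := {ffun I -> R}.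

HB.instance Definition _ (R : realType) (I : finType) := Choice.on (Rn R I).
HB.instance Definition _ (R : realType) (I : finType) :=
  isPointed.Build (Rn R I) [ffun=> 0].
HB.instance Definition _ (R : realType) (I : finType) :=
  @isMeasurable.Build default_measure_display (Rn R I)
    (coord_measurable (fun i (x : {ffun I -> R}) => x i))
    (@coord_measurable0 _ _ _ _) (@coord_measurableC _ _ _ _)
    (@coord_measurableU _ _ _ _).

(* [pushforward], [\x] and the integral accept arbitrary set functions; the
   reference measures are built from them without measure instances. *)
Section Lebesgue.
Variable R : realType.

Fixpoint lebesgue_tuple n : set (n.-tuple R) -> \bar R :=
  match n with
  | 0 => \d_ [tuple]
  | n'.+1 => pushforward (lebesgue_measure \x @lebesgue_tuple n')%E
               (fun p : R * n'.-tuple R => [tuple of p.1 :: p.2])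
  end.

Definition lebesgue_Rn (I : finType) : set (Rn R I) -> \bar R :=
  pushforward (@lebesgue_tuple #|I|)
    (fun t => [ffun i => tnth t (enum_rank i)] : Rn R I).

End Lebesgue.

Section StateSpaces.
Variables (R : realType) (G : rooted_graph).

Definition is_pinned (u : {ffun vertex G -> R}) : bool := u (root_vertex G) == 0.

Definition pinned : Type := {u : {ffun vertex G -> R} | is_pinned u}.

Definition fun_of_pinned (u : pinned) : vertex G -> R := sval u.

Lemma pinned0_subproof : is_pinned [ffun=> 0].
Proof. by rewrite /is_pinned ffunE. Qed.

HB.instance Definition _ := Choice.on pinned.
HB.instance Definition _ :=
  isPointed.Build pinned (exist is_pinned _ pinned0_subproof).
HB.instance Definition _ :=
  @isMeasurable.Build default_measure_display pinned
    (coord_measurable (fun i u => fun_of_pinned u i))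
    (@coord_measurable0 _ _ _ _) (@coord_measurableC _ _ _ _)
    (@coord_measurableU _ _ _ _).

Definition nonroot : finType := {i : vertex G | i != root_vertex G}.

Definition pin_fun (x : Rn R nonroot) : {ffun vertex G -> R} :=
  [ffun i => if insub i is Some k then x k else 0].

Lemma pin_subproof (x : Rn R nonroot) : is_pinned (pin_fun x).
Proof. by rewrite /is_pinned ffunE insubF ?eqxx. Qed.

Definition pin (x : Rn R nonroot) : pinned := exist is_pinned _ (pin_subproof x).

Definition lebesgue_pinned : set pinned -> \bar R :=
  pushforward (@lebesgue_Rn R nonroot) pin.

Definition lebesgue_diagonal : set (pinned * pinned) -> \bar R :=
  pushforward lebesgue_pinned (fun u => (u, u)).

Definition divergence_free (k : {ffun dedge G -> R}) : bool :=
  [forall i, \sum_(a | src a == i) (k a - k (rev_dedge a)) == 0].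

Definition flow : Type := {k : {ffun dedge G -> R} | divergence_free k}.

Definition fun_of_flow (k : flow) : dedge G -> R := sval k.

Lemma flow0_subproof : divergence_free [ffun=> 0].
Proof. by apply/forallP => i; rewrite big1 // => a _; rewrite !ffunE subrr. Qed.

HB.instance Definition _ := Choice.on flow.
HB.instance Definition _ := isPointed.Build flow (exist divergence_free _ flow0_subproof).
HB.instance Definition _ :=
  @isMeasurable.Build default_measure_display flow
    (coord_measurable (fun a k => fun_of_flow k a))
    (@coord_measurable0 _ _ _ _) (@coord_measurableC _ _ _ _)
    (@coord_measurableU _ _ _ _).

Section FlowLebesgue.
Variable T0 : {set dedge G}.

Definition off_tree : finType := {a : dedge G | a \notin T0}.

Definition flow_restr (k : flow) : Rn R off_tree :=
  [ffun b => fun_of_flow k (sval b)].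

(* The inverse of [flow_restr], which is bijective when T0 is a directed spanning
   tree. *)
Definition flow_extend (y : Rn R off_tree) : flow :=
  get [set k | flow_restr k = y].

Definition lebesgue_flow : set flow -> \bar R :=
  pushforward (@lebesgue_Rn R off_tree) flow_extend.

End FlowLebesgue.

End StateSpaces.

Arguments lebesgue_pinned : clear implicits.
Arguments lebesgue_diagonal : clear implicits.

Coercion fun_of_pinned : pinned >-> Funclass.
Coercion fun_of_flow : flow >-> Funclass.

Section Measures.
Variables (R : realType) (G : rooted_graph) (W : vertex G -> vertex G -> R).
Local Notation Omega := (pinned R G).
Local Notation H := (flow R G).

Definition cosh (x : R) : R := (expR x + expR (- x)) / 2.

Definition susy_weight (s u : Omega) : R :=
  expR (\sum_(e in edges G) at_edge (fun i j =>
    W i j * (1 - cosh (u i - u j)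
             - 2^-1 * expR (u i + u j) * (s i - s j) ^+ 2)) e).

Definition susy_density (s u : Omega) (T' : tree G) : R :=
  susy_weight s u
  * \prod_(e in sval T') at_edge (fun i j => W i j * expR (u i + u j)) e
  * \prod_(i | i != root_vertex G) (expR (- u i) / (2 * pi)).

Definition susy_space : Type := (Omega * Omega * tree G)%type.

Definition mu_susy : set susy_space -> \bar R := fun A =>
  (\int[lebesgue_pinned R G \x lebesgue_pinned R G \x counting]_(x in A)
    (let: (s, u, T') := x in susy_density s u T')%:E)%E.

Definition omega' (u : Omega) (i j : vertex G) : R :=
  W i j / 2 * expR (u i + u j).

Definition big_density (k k' : H) (s v u : Omega) (i1 i1' : vertex G)
    (T T' : tree G) : R :=
  4 ^+ #|vertex G|.-1 / (2 * pi) ^+ (2 * #|edges G|)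
  * susy_weight s u
  * \prod_(e in sval T) at_edge (omega' u) e
  * \prod_(e in sval T') at_edge (omega' u) e
  * \prod_(e in edges G) ((at_edge (omega' u) e) ^+ 2)^-1
  * expR (- \sum_(a : dedge G)
            (k a ^+ 2 + k' a ^+ 2) / (2 * omega' u (src a) (tgt a)))
  * (expR (2 * v i1 + 2 * u i1')
     / ((\sum_i expR (2 * v i)) * (\sum_j expR (2 * u j))))
  * \prod_(i | i != root_vertex G) expR (- u i).

(* The variables are (k, k', s, (v, u), i1, i1', T, T'), with (v, u) grouped
   because their reference measure lives on the diagonal. *)
Definition big_space : Type :=
  (H * H * Omega * (Omega * Omega) * vertex_space G * vertex_space G
   * tree G * tree G)%type.

Definition mu_big (T0 : {set dedge G}) : set big_space -> \bar R := fun A =>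
  (\int[@lebesgue_flow R G T0 \x @lebesgue_flow R G T0
        \x lebesgue_pinned R G \x lebesgue_diagonal R G
        \x counting \x counting \x counting \x counting]_(x in A)
    (let: (k, k', s, (v, u), i1, i1', T, T') := x in
     big_density k k' s v u i1 i1' T T')%:E)%E.

Definition marginal_suT (x : big_space) : susy_space :=
  let: (k, k', s, (v, u), i1, i1', T, T') := x in (s, u, T').

End Measures.

(* Main.v *)
(* Summing the big density over i_1, i_1' and T and integrating out the two flows leaves
   the susy density. By the matrix-tree theorem the sum over T gives 2^-(|V|-1) det D, with
   D the Laplacian of the conductances 2 omega', reduced at the root. Parametrised by the
   flow off T0, the quadratic form of the Gaussian weight has determinant
   det D / prod omega' (two Schur complements of one block matrix), so the two flow
   integrals contribute a factor 1 / det D which cancels the sum over T.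

   For the mass of the susy measure, the integral over s and the sum over T' leave a density
   in u proportional to exp(...) sqrt(det D) prod exp(-u_i). Put u = ln z, where z solves the
   discrete Schroedinger equation (diag a - W) z = eta, eta being the couplings to the root,
   and a is parametrised by y so that the pivots of diag a - W are exp(y_i). This map
   y -> u preserves Lebesgue measure, being composed of translations and reflections of
   single coordinates. In the variables y the vertices are integrated out one at a time,
   each one contributing sqrt(2 pi), by
     int sqrt(c exp(-x)) exp(-c cosh x) dx = sqrt(2 pi) exp(-c),
   and then merged into the root. *)

From HB Require Import structures.
Require Import Defs.
From mathcomp Require Import all_boot all_order all_algebra all_fingroup.
From mathcomp Require Import all_classical all_reals all_analysis.
From mathcomp Require Import measurable_realfun ring lra.

Set Implicit Arguments.
Unset Strict Implicit.
Unset Printing Implicit Defensive.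

Import Order.TTheory GRing.Theory Num.Theory.
Import numFieldNormedType.Exports.

Local Open Scope ring_scope.

(** * The matrix-tree theorem *)

(** No n-dimensional Jacobian occurs: integrals are peeled off one coordinate at a time, using
    translations and reflections of the line and two one-variable integrals, Gaussian and inverse
    Gaussian. The choice of y serves this. With a_i = exp(-u_i) (sum_j W_ij exp(u_j) + eta_i) one
    has D = diag(exp u) (diag a - W) diag(exp u), so sqrt(det D) prod exp(-u_i) is the square root
    of det(diag a - W), that is prod exp(y_i / 2). Eliminating index 0 last gives u_0 = ln c - y_0
    with c independent of y_0: a reflection whose centre depends on the other coordinates. For fixed
    u_0 the remaining field solves the same problem with vertex 0 merged into the root. Taking
    logarithms needs z > 0; as W may have zero entries, this uses connectedness of the graph, in a
    form stable under merging. As for powers of 2 pi, the s-integral and the u-integral each give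
    the exponent (|V|-1)/2, and each flow integral gives half the dimension 2|E| - (|V|-1) of the
    flow space. *)

Lemma set2_eq (T : finType) (v w a b : T) : [set v; w]%SET = [set a; b]%SET ->
  (v = a /\ w = b) \/ (v = b /\ w = a).
Proof.
move=> e.
have : v \in [set a; b]%SET by rewrite -e !inE eqxx.
have : w \in [set a; b]%SET by rewrite -e !inE eqxx orbT.
have : a \in [set v; w]%SET by rewrite e !inE eqxx.
have : b \in [set v; w]%SET by rewrite e !inE eqxx orbT.
by rewrite !inE => /orP[]/eqP -> /orP[]/eqP -> /orP[]/eqP ? /orP[]/eqP ?; subst; auto.
Qed.

(** * Spanning trees as parent functions pointing towards the root *)

Section RootedForests.
Variable G : rooted_graph.
Local Notation V := (vertex G).
Local Notation r := (root_vertex G).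
Local Notation n := #|nonroot G|.

Definition nrv (i : 'I_n) : V := val (enum_val i).

Lemma nrv_inj : injective nrv.
Proof. by move=> i j /val_inj /enum_val_inj. Qed.

Lemma nrv_neq_root i : nrv i != r.
Proof. exact: valP (enum_val i). Qed.

Lemma nrvP v : v != r -> exists i, v = nrv i.
Proof.
by move=> vr; exists (enum_rank (Sub v vr : nonroot G)); rewrite /nrv enum_rankK SubK.
Qed.

Implicit Type f : {ffun 'I_n -> V}.

(** [f] assigns a parent to each non-root vertex. The default value [r] makes the root a fixed
    point, so a walk that reaches it stays there. *)
Definition climb f (v : V) : V := if [pick i | nrv i == v] is Some i then f i else r.

Lemma climb_nrv f i : climb f (nrv i) = f i.
Proof.
rewrite /climb; case: pickP => [j /eqP/nrv_inj->//|/(_ i)]; by rewrite eqxx.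
Qed.

Definition rooting f := forall v, exists k, iter k (climb f) v == r.

Section Rooting.
Variables (f : {ffun 'I_n -> V}) (rf : rooting f).

Definition depth v : nat := ex_minn (rf v).

Lemma depth_climb v : v != r -> depth v = (depth (climb f v)).+1.
Proof.
move=> vr; apply/eqP; rewrite eqn_leq; apply/andP; split.
  rewrite /depth; case: ex_minnP => m _ min; case: ex_minnP => k hk _.
  by apply: min; rewrite iterSr.
rewrite {2}/depth; case: ex_minnP => -[/=|m] hm _; first by rewrite (negbTE vr) in hm.
by rewrite ltnS /depth; case: ex_minnP => k _; apply; rewrite -iterSr.
Qed.

Definition forest_edges : {set {set V}} := [set [set nrv i; f i]%SET | i : 'I_n]%SET.

Lemma adj_forestP v w : reflect
  ((v != r /\ w = climb f v) \/ (w != r /\ v = climb f w)) (adj_rel forest_edges v w).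
Proof.
apply: (iffP imsetP) => [[i _ e]|].
  have nr := nrv_neq_root i.
  by case: (set2_eq e) => -[-> ->]; [left|right]; rewrite climb_nrv.
case=> -[/nrvP[i ->] ->]; exists i => //; rewrite climb_nrv//; exact: finset.setUC.
Qed.

Lemma climb_neq v : v != r -> climb f v != v.
Proof. by move=> /depth_climb dv; apply: contra_eqN dv => /eqP ->; rewrite neq_ltn ltnSn. Qed.

Lemma forest_connected : connected_edges forest_edges.
Proof.
have sym : connect_sym (adj_rel forest_edges).
  by apply: sym_connect_sym; exact: adj_rel_sym.
suff cr v : connect (adj_rel forest_edges) v r.
  by move=> i j; apply: connect_trans (cr i) _; rewrite sym.
have [m] := ubnP (depth v); elim: m v => // m IH v dv.
have [->//|vr] := eqVneq v r.
apply: (@connect_trans _ _ (climb f v)).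
  by apply: connect1; apply/adj_forestP; left.
by apply: IH; rewrite -ltnS -depth_climb.
Qed.

Lemma adj_forest_down x y :
  adj_rel forest_edges x y -> (depth y <= depth x)%N -> y = climb f x.
Proof.
move=> /adj_forestP[[]//|[yr ->]]; by rewrite (depth_climb yr) ltnn.
Qed.

(** Take a vertex of maximal depth on a cycle: both of its neighbours on the cycle must be its
    parent, so they coincide, which a cycle with at least three distinct vertices forbids. *)
Lemma forest_acyclic : acyclic_edges forest_edges.
Proof.
move=> c uc; rewrite ltnNge; apply/negP => sc.
have c0 : exists x, x \in c by case: c sc {uc} => // x c _; exists x; rewrite mem_head.
have [x xc xmax] : exists2 x, x \in c & forall y, y \in c -> (depth y <= depth x)%N.
  have [x0 x0c] := c0.
  have [x xc xmax] := @arg_maxnP _ x0 (mem c) depth x0c.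
  by exists x.
have [i c' ec] := rot_to xc.
have {}uc : ucycle (adj_rel forest_edges) (x :: c').
  by rewrite -ec /ucycle rot_cycle rot_uniq.
have {}sc : (2 < size (x :: c'))%N by rewrite -ec size_rot.
have {}xmax y : y \in x :: c' -> (depth y <= depth x)%N.
  by rewrite -ec mem_rot; exact: xmax.
case: c' uc sc xmax {ec} => [|y [|z c']] // /andP[] /=.
rewrite rcons_path => /and3P[xy _ /andP[_ lx]] /and3P[_ ynz _] _ xmax.
have lz : last z c' \in z :: c' by exact: mem_last.
have ey : y = climb f x by apply: adj_forest_down => //; apply: xmax; rewrite !inE eqxx orbT.
have el : last z c' = climb f x.
  apply: adj_forest_down; first by rewrite adj_rel_sym.
  by apply: xmax; rewrite 2!inE lz !orbT.
by rewrite ey -el lz in ynz.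
Qed.

Lemma forest_spanning : forest_edges \subset edges G -> spanning_tree forest_edges.
Proof. by split=> //; [exact: forest_connected|exact: forest_acyclic]. Qed.

(** If two vertices had the same parent edge, each would be the parent of the other and the depth
    would exceed itself by two. *)
Lemma forest_edge_inj : injective (fun i => [set nrv i; f i]%SET).
Proof.
move=> i j e; apply/eqP; apply/negPn/negP => nij.
have : nrv i \in [set nrv j; f j]%SET by rewrite -e !inE eqxx.
rewrite !inE => /orP[/eqP/nrv_inj ij|/eqP eij]; first by rewrite ij eqxx in nij.
have : nrv j \in [set nrv i; f i]%SET by rewrite e !inE eqxx.
rewrite !inE => /orP[/eqP/nrv_inj ij|/eqP eji]; first by rewrite ij eqxx in nij.
have := depth_climb (nrv_neq_root i); rewrite climb_nrv -eji.
rewrite (depth_climb (nrv_neq_root j)) climb_nrv -eij => /eqP.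
by rewrite -addn2 -{1}[depth _]addn0 eqn_add2l.
Qed.

Lemma big_forest_edges (R : comPzRingType) (F : {set V} -> R) :
  \prod_(e in forest_edges) F e = \prod_i F [set nrv i; f i]%SET.
Proof. by rewrite big_imset//= => i j _ _; exact: forest_edge_inj. Qed.

End Rooting.

(** Induction on the depth in [g]. The edge from [v] to its [g]-parent is also an edge of [f]; if
    [f] used it in the other direction, the induction hypothesis at the [g]-parent would make it a
    2-cycle of [g]. *)
Lemma forest_edges_inj f g : rooting f -> rooting g ->
  forest_edges f = forest_edges g -> f = g.
Proof.
move=> rf rg efg; suff h v : v != r -> climb f v = climb g v.
  by apply/ffunP => i; rewrite -!climb_nrv h// nrv_neq_root.
have [m] := ubnP (depth rg v); elim: m v => // m IH v dv vr.
have : adj_rel (forest_edges f) v (climb g v).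
  by rewrite efg; apply/adj_forestP; left.
move=> /adj_forestP[[_ ->//]|[gvr vE]].
have := depth_climb rg vr; rewrite (depth_climb rg gvr) -IH//; last first.
  by rewrite -ltnS -depth_climb.
by rewrite -vE => /eqP; rewrite -addn2 -{1}[depth _ _]addn0 eqn_add2l.
Qed.

Section FromTree.
Variables (T : {set {set V}}) (cT : connected_edges T).

Fixpoint near_root k v : bool :=
  if k is k'.+1 then [exists w, adj_rel T v w && near_root k' w] else v == r.

Lemma near_root_ex v : exists k, near_root k v.
Proof.
have /connectP[p] := cT v r; elim: p v => [|w p IH] v /=; first by move=> _ <-; exists 0%N => /=.
move=> /andP[vw pw] e; have [k hk] := IH w pw e.
by exists k.+1 => /=; apply/existsP; exists w; rewrite vw.
Qed.

(** Every vertex points to a neighbour strictly closer to the root, the distance [D] being the least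
    length of a walk in [T]. *)
Lemma tree_climb_ex : exists2 f, rooting f & forall i, [set nrv i; f i]%SET \in T.
Proof.
pose D v := ex_minn (near_root_ex v).
pose nxt v := odflt r [pick w | adj_rel T v w && near_root (D v).-1 w].
have nxtP v : v != r -> adj_rel T v (nxt v) /\ (D (nxt v) < D v)%N.
  move=> vr; rewrite /nxt; case: pickP => /= [w /andP[vw hw]|].
    split=> //; rewrite {1}/D; case: ex_minnP => k _ /(_ _ hw) /leq_ltn_trans; apply.
    rewrite ltn_predL /D; case: ex_minnP => -[|//] /=; by rewrite (negbTE vr).
  move=> none; exfalso; move: none; rewrite /D; case: ex_minnP => -[|k] /=.
    by rewrite (negbTE vr).
  by move=> /existsP[w hw] _ /(_ w); rewrite hw.
pose f := [ffun i => nxt (nrv i)].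
exists f => [v|i]; last by rewrite ffunE; have [] := nxtP _ (nrv_neq_root i).
have [m] := ubnP (D v); elim: m v => // m IH v Dv.
have [->|vr] := eqVneq v r; first by exists 0%N => /=.
have [i vi] := nrvP vr; have [_ lt] := nxtP _ vr.
have [|k hk] := IH (nxt v); first exact: leq_trans lt _.
by exists k.+1; rewrite iterSr {1}vi climb_nrv ffunE -vi.
Qed.

End FromTree.

(** The parent edges already connect all vertices. An edge of [T] outside them, closed up by a
    simple path of parent edges, would be a cycle of length at least three in [T]. *)
Lemma spanning_tree_forest T : spanning_tree T ->
  exists2 f, rooting f & forest_edges f = T.
Proof.
move=> [TE cT aT]; have [f rf fT] := tree_climb_ex cT; exists f => //.
have sub : forest_edges f \subset T by apply/fintype.subsetP => e /imsetP[i _ ->].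
apply/eqP; rewrite finset.eqEsubset sub /=; apply/fintype.subsetP => e eT.
have /eqP/cards2P[x [y [xy exy]]] := edge_card2 (fintype.subsetP TE _ eT).
have /connectP[p pp] := forest_connected rf x y.
case/shortenP: pp => p' pp' up' _ lp'.
have : (size (x :: p') < 3)%N.
  apply: aT; rewrite /ucycle up' andbT /= rcons_path -lp'.
  apply/andP; split; last by rewrite adj_rel_sym /adj_rel -exy.
  by apply: sub_path pp' => a b; exact: (fintype.subsetP sub).
case: p' pp' lp' {up'} => [|z [|//]] /=.
  by move=> _ xy'; rewrite xy' eqxx in xy.
by rewrite andbT exy => xz -> _.
Qed.

(** * Laplacian determinants as sums over rooted parent functions *)

Section MatrixTree.
Variable R : fieldType.

Definition forest_mx f : 'M[R]_n :=
  \matrix_(i, j) ((i == j)%:R - (f i == nrv j)%:R).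

(** Only the identity permutation contributes. If the term of [s] is nonzero and [s] moves [i], then
    climbing from [i] follows the orbit of [s], which stays among non-root vertices and never
    reaches the root. *)
Lemma det_forest_mx f : rooting f -> \det (forest_mx f) = 1.
Proof.
move=> rf; rewrite /determinant (bigD1 (1%g : {perm 'I_n}))//= odd_perm1 expr0 mul1r.
rewrite big1 => [|i _]; last first.
  rewrite perm1 mxE eqxx -(climb_nrv f) (negbTE (climb_neq rf (nrv_neq_root i))).
  by rewrite subr0.
rewrite big1 ?addr0// => s s1.
apply/eqP; rewrite mulf_eq0 signr_eq0 /=; apply/negPn/negP => /prodf_neq0 nz.
have fs i : s i = i \/ f i = nrv (s i).
  have := nz i isT; rewrite mxE.
  case: (i =P s i) => [<-|_]; first by left.
  by case: (f i =P nrv (s i)) => [->|_]; [right|rewrite subrr eqxx].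
have [i si] : exists i, s i != i.
  apply/existsP; rewrite -negb_forall; apply: contra s1 => /forallP si.
  by apply/eqP/permP => i; rewrite perm1; exact/eqP.
have orb k : s (iter k s i) != iter k s i /\ iter k (climb f) (nrv i) = nrv (iter k s i).
  elim: k => [//|k [IH1 IH2]]; split; first by rewrite /= (inj_eq perm_inj).
  by rewrite /= IH2 climb_nrv; case: (fs (iter k s i)) => // e; rewrite e eqxx in IH1.
have [k /eqP hk] := rf (nrv i); have [_] := orb k.
by rewrite hk => e; have := nrv_neq_root (iter k s i); rewrite -e eqxx.
Qed.

(** The indicator of the vertices that never reach the root is unchanged by passing to the parent,
    hence is a nonzero null vector. *)
Lemma det_forest_mx0 f : ~ rooting f -> \det (forest_mx f) = 0.
Proof.
move=> nrf; rewrite -det_tr; apply/eqP/det0P.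
pose lost v := `[< forall k, iter k (climb f) v != r >].
have lostE i : lost (nrv i) = lost (f i).
  apply/asboolP/asboolP => h k; first by rewrite -climb_nrv -iterSr.
  case: k => [|k]; first exact: nrv_neq_root.
  by rewrite iterSr climb_nrv.
have lost_root : lost r = false by apply/asboolP => /(_ 0%N); rewrite eqxx.
have [v lv] : exists v, lost v.
  move/existsNP: nrf => [v hv]; exists v; apply/asboolP => k.
  by apply/negP => e; apply: hv; exists k.
have [i vi] : exists i, v = nrv i.
  by apply: nrvP; apply: contraTneq lv => ->; rewrite lost_root.
exists (\row_j (lost (nrv j))%:R).
  by apply/eqP => /rowP/(_ i); rewrite !mxE -vi lv => /eqP; rewrite oner_eq0.
apply/rowP => j; rewrite !mxE.
under eq_bigr do rewrite !mxE mulrBr.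
rewrite sumrB (bigD1 j)//= eqxx mulr1 big1 ?addr0; last first.
  by move=> k kj; rewrite eq_sym (negbTE kj) mulr0.
rewrite lostE; apply/eqP; rewrite subr_eq0; apply/eqP.
have [->|/nrvP[k ->]] := eqVneq (f j) r.
  by rewrite lost_root big1// => k _; rewrite eq_sym (negbTE (nrv_neq_root k)) mulr0.
rewrite (bigD1 k)//= eqxx mulr1 big1 ?addr0// => l lk.
by rewrite (inj_eq nrv_inj) eq_sym (negbTE lk) mulr0.
Qed.

Variables (w : V -> V -> R).

Definition adj_weight (u v : V) : R := if [set u; v]%SET \in edges G then w u v else 0.

(** Row [i] is written as a weighted sum over [v] of the row that [forest_mx] has when [f i = v],
    the shape needed to expand the determinant by multilinearity. *)
Definition reduced_laplacian : 'M[R]_n := \matrix_(i, j)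
  (\sum_v adj_weight (nrv i) v * ((i == j)%:R - (v == nrv j)%:R)).

(** Multilinearity in the rows gives one term per choice [f] of a vertex for every row, namely the
    product of weights times [\det (forest_mx f)], which is the indicator of [rooting f]. *)
Lemma det_reduced_laplacian_forests :
  \det reduced_laplacian =
  \sum_(f : {ffun 'I_n -> V} | `[< rooting f >]) \prod_i adj_weight (nrv i) (f i).
Proof.
rewrite /determinant.
under eq_bigr => s _.
  under eq_bigr do rewrite mxE.
  rewrite bigA_distr_bigA mulr_sumr /=.
  over.
rewrite exchange_big /= [RHS]big_mkcond; apply: eq_bigr => f _.
under eq_bigr do rewrite big_split mulrCA.
rewrite -mulr_sumr.
transitivity ((\prod_i adj_weight (nrv i) (f i)) * \det (forest_mx f)).
  congr (_ * _); apply: eq_bigr => s _; congr (_ * _).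
  by apply: eq_bigr => i _; rewrite mxE.
by case: asboolP => [/det_forest_mx|/det_forest_mx0] ->; rewrite ?mulr1 ?mulr0.
Qed.

Hypothesis ws : forall u v, [set u; v]%SET \in edges G -> w u v = w v u.

(** Orienting edges towards the root matches spanning trees with the rooted parent functions that
    use only edges of the graph; a function using a non-edge has weight zero. *)
Theorem matrix_tree :
  \det reduced_laplacian = \sum_(T : tree G) \prod_(e in sval T) at_edge w e.
Proof.
rewrite det_reduced_laplacian_forests.
rewrite (bigID (fun f : {ffun 'I_n -> V} => forest_edges f \subset edges G)) /=.
rewrite [X in _ + X]big1 ?addr0; last first.
  move=> f /andP[_ /subsetPn[e /imsetP[i _ ->] ni]].
  by rewrite (bigD1 i)//= /adj_weight (negbTE ni) mul0r.
have par (T : tree G) : {f | rooting f & forest_edges f = sval T}.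
  by apply: cid2; apply: spanning_tree_forest; exact/asboolP/(valP T).
pose h T := s2val (par T).
have rh T : rooting (h T) by exact: s2valP (par T).
have eh T : forest_edges (h T) = sval T by exact: s2valP' (par T).
rewrite (reindex_onto h (fun f => insubd (point : tree G) (forest_edges f))) /=; last first.
  move=> f /andP[/asboolP rf sf]; apply: forest_edges_inj => //; rewrite eh.
  by rewrite [sval _]insubdK//; apply/asboolP; exact: forest_spanning.
apply: eq_big => [T|T _].
  rewrite eh; case: asboolP => [_|//]; have /asboolP sT := valP T.
  rewrite -(eh T) eh; case: (sT) => -> _ _; rewrite andTb.
  by apply/eqP/val_inj; rewrite val_insubd /=; case: asboolP.
rewrite -eh big_forest_edges//; apply: eq_bigr => i _.
have iE : [set nrv i; h T i]%SET \in edges G.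
  have /asboolP[sT _ _] := valP T; apply: (fintype.subsetP sT).
  by rewrite -[val T]/(sval T) -eh; apply/imsetP; exists i.
by rewrite /adj_weight iE at_edgeE//; exact: ws.
Qed.

End MatrixTree.
End RootedForests.

(** * Solutions of the pinned Schrodinger equation *)

Section Elimination.
Variable R : realType.
Implicit Types (W : nat -> nat -> R) (eta y : nat -> R).

Definition shift1 (f : nat -> R) (i : nat) : R := f i.+1.
Definition shift2 W (i j : nat) : R := W i.+1 j.+1.

(* [zsol] solves (diag a - W) z = eta for the diagonal a = [pivot_diag n W y], which is
   chosen so that Gaussian elimination of diag a - W, with index 0 eliminated last, has
   the pivots exp (y i). *)
Fixpoint zsol n W eta y : nat -> R :=
  if n is n'.+1 then
    let c := eta 0%N + \sum_(j < n')
      W 0%N j.+1 * zsol n' (shift2 W) (shift1 eta) (shift1 y) j in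
    let z0 := c * expR (- y 0%N) in
    fun i => if i is i'.+1 then
      zsol n' (shift2 W) (fun k => eta k.+1 + z0 * W 0%N k.+1) (shift1 y) i' else z0
  else fun=> 0.

(** The right-hand side left in equation 0 after the other unknowns are eliminated. It does not
    involve [y 0], so the logarithm of the solution at 0 is a reflection of [y 0]. *)
Definition zhead n W eta y : R := eta 0%N + \sum_(j < n)
  W 0%N j.+1 * zsol n (shift2 W) (shift1 eta) (shift1 y) j.

(** Entry 0 is chosen so that the Schur complement of the trailing block equals exp(y 0): the sum is
    the quadratic form of the inverse trailing block at row 0 of [W], and [W 0 0] offsets the
    diagonal of [- W]. *)
Fixpoint pivot_diag n W y : nat -> R :=
  if n is n'.+1 then
    fun i => if i is i'.+1 then pivot_diag n' (shift2 W) (shift1 y) i' else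
      expR (y 0%N) + W 0%N 0%N +
      \sum_(j < n') W 0%N j.+1 * zsol n' (shift2 W) (shift1 (W 0%N)) (shift1 y) j
  else fun=> 0.

Lemma zsol_linear n W (a b : nat -> R) t y i :
  zsol n W (fun k => a k + t * b k) y i = zsol n W a y i + t * zsol n W b y i.
Proof.
elim: n W a b t y i => [|n IH] W a b t y i /=; first by rewrite mulr0 addr0.
have E (a' : nat -> R) : shift1 (fun k => a' k) = (fun k => a' k.+1) by [].
have H0 : zhead n W (fun k => a k + t * b k) y = zhead n W a y + t * zhead n W b y.
  rewrite /zhead mulrDr addrACA; congr (_ + _); rewrite mulr_sumr -big_split /=.
  apply: eq_bigr => j _.
  rewrite (_ : shift1 _ = fun k => shift1 a k + t * shift1 b k)// IH.
  by ring.
rewrite /zhead in H0; case: i => [|i]; first by rewrite H0 mulrDl mulrA.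
rewrite H0; set ca := a 0%N + _; set cb := b 0%N + _; set e := expR _.
rewrite (_ : (fun k => _) =
  fun k => (fun k => a k.+1 + ca * e * W 0%N k.+1) k +
    t * (fun k => b k.+1 + cb * e * W 0%N k.+1) k); first exact: IH.
by apply/funext => k; ring.
Qed.

Lemma zsol_linear_shift n W (a b : nat -> R) t y i :
  zsol n W (fun k => a k.+1 + t * b k.+1) y i =
  zsol n W (shift1 a) y i + t * zsol n W (shift1 b) y i.
Proof. exact: (zsol_linear n W (shift1 a) (shift1 b)). Qed.

Lemma zsol_eqn n W eta y : (forall i j, W i j = W j i) ->
  forall i, (i < n)%N ->
  pivot_diag n W y i * zsol n W eta y i - \sum_(j < n) W i j * zsol n W eta y j = eta i.
Proof.
elim: n W eta y => // n IH W eta y symW [_|i].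
  rewrite big_ord_recl /= -/(zhead n W eta y).
  set S := \sum_(j < n) _ * zsol _ _ (shift1 (W 0%N)) _ _.
  set z0 := zhead _ _ _ _ * _.
  (* By linearity the trailing solution is the one for [eta] plus [z0] times the one for row 0 of
     [W]; pairing it with row 0 gives these two terms. *)
  rewrite [X in _ - (_ + X)](_ : _ = zhead n W eta y - eta 0%N + z0 * S); last first.
    rewrite /zhead [eta 0%N + _]addrC addrK mulr_sumr -big_split /=.
    by apply: eq_bigr => j _; rewrite (zsol_linear_shift n _ eta (W 0%N)); ring.
  have eK : expR (y 0%N) * expR (- y 0%N) = 1 by rewrite -expRD subrr expR0.
  rewrite /z0; set c := zhead _ _ _ _; set e := expR (y 0%N) in eK *.
  set e' := expR (- y 0%N) in eK *.
  have -> : (e + W 0%N 0%N + S) * (c * e') - (W 0%N 0%N * (c * e') + (c - eta 0%N + c * e' * S))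
     = c * (e * e') - c + eta 0%N by ring.
  by rewrite eK; ring.
rewrite ltnS => ilt; rewrite big_ord_recl /= -/(zhead n W eta y).
set z0 := _ * expR _.
have := IH (shift2 W) (fun k => eta k.+1 + z0 * W 0%N k.+1) (shift1 y) _ i ilt.
move=> /(_ (fun i j => symW _ _)); rewrite (symW i.+1 0%N) /shift2.
rewrite opprD addrCA => ->; ring.
Qed.

(** Symmetry of the Green function of diag a - W: replacing the paired vector by the left side of
    its equation makes both sides the same symmetric bilinear expression in the two solutions. *)
Lemma zsol_sym n W (a b y : nat -> R) : (forall i j, W i j = W j i) ->
  \sum_(i < n) a i * zsol n W b y i = \sum_(i < n) b i * zsol n W a y i.
Proof.
move=> symW.
have E (p q : nat -> R) : \sum_(i < n) p i * zsol n W q y i =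
   \sum_(i < n) pivot_diag n W y i * zsol n W p y i * zsol n W q y i -
   \sum_(i < n) \sum_(j < n) W i j * zsol n W p y j * zsol n W q y i.
  rewrite -sumrB; apply: eq_bigr => i _.
  by rewrite -[p i](@zsol_eqn n W p y symW i)// mulrBl mulr_suml.
rewrite !E; congr (_ - _); first by apply: eq_bigr => i _; ring.
rewrite exchange_big /=; apply: eq_bigr => i _; apply: eq_bigr => j _.
by rewrite symW; ring.
Qed.

Lemma zsol_ge0 n W eta y : (forall i j, 0 <= W i j) -> (forall i, 0 <= eta i) ->
  forall i, 0 <= zsol n W eta y i.
Proof.
elim: n W eta y => // n IH W eta y W0 eta0 i /=; rewrite -/(zhead n W eta y).
have c0 : 0 <= zhead n W eta y.
  apply: addr_ge0 => //; apply: sumr_ge0 => j _; apply: mulr_ge0 => //.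
  by apply: IH => *; [exact: W0|exact: eta0].
case: i => [|i]; first by rewrite mulr_ge0 ?expR_ge0.
apply: IH => [*|k]; first exact: W0.
by rewrite addr_ge0// !mulr_ge0 ?expR_ge0.
Qed.

(* [eta] holds the couplings to the root, which is not one of the indices. *)
Definition pinned_connected n W eta : Prop :=
  forall S : pred nat, (exists2 i, (i < n)%N & S i) ->
  exists i, [/\ (i < n)%N, S i &
    0 < eta i \/ exists j, [/\ (j < n)%N, ~~ S j & 0 < W i j]].

(** Merging index 0 into the root turns its couplings, scaled by [t], into root couplings. A set of
    trailing indices leaves 0 outside, so its outgoing coupling leads to the root, to 0 or to
    another trailing index. *)
Lemma pinned_connected_behead n W eta t : 0 < t ->
  (forall i j, W i j = W j i) -> (forall i j, 0 <= W i j) -> (forall i, 0 <= eta i) ->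
  pinned_connected n.+1 W eta ->
  pinned_connected n (shift2 W) (fun k => eta k.+1 + t * W 0%N k.+1).
Proof.
move=> t0 symW W0 eta0 C S [i0 i0n Si0].
have [|[|i] [ilt // Si H]] := C (fun k => if k is k'.+1 then S k' else false).
  by exists i0.+1.
exists i; split => //; case: H => [H|[[|j] [jn Sj Wij]]].
- by left; rewrite ltr_pwDl// mulr_ge0// ltW.
- by left; rewrite ltr_wpDl// symW mulr_gt0.
- by right; exists j.
Qed.

(** All terms are nonnegative, so if the sum vanished, [eta 0] would be 0 and the trailing solution
    would vanish at every neighbour of 0. Connectedness is applied to 0 together with the zeros of
    that solution: the equation at such a zero excludes any coupling to the root or out of the
    set. *)
Lemma zhead_gt0 n W eta y :
  (forall i j, W i j = W j i) -> (forall i j, 0 <= W i j) -> (forall i, 0 <= eta i) ->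
  pinned_connected n.+1 W eta -> 0 < zhead n W eta y.
Proof.
move=> symW W0 eta0 C.
pose z := zsol n (shift2 W) (shift1 eta) (shift1 y).
have z0 i : 0 <= z i by apply: zsol_ge0 => *; [exact: W0|exact: eta0].
have t0 (j : 'I_n) : true -> 0 <= W 0%N j.+1 * z j by rewrite mulr_ge0.
rewrite lt_neqAle addr_ge0 ?sumr_ge0// andbT eq_sym; apply/negP => /eqP c0.
have /andP[/eqP e0 /eqP s0] : (eta 0%N == 0) && (\sum_(j < n) W 0%N j.+1 * z j == 0).
  by rewrite -paddr_eq0 ?sumr_ge0//; apply/eqP.
have wz (j : nat) : (j < n)%N -> W 0%N j.+1 * z j = 0.
  move=> jn; apply/eqP; move/eqP: s0; rewrite psumr_eq0// => /allP/(_ (Ordinal jn)).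
  by rewrite mem_index_enum => /(_ isT).
have [|[|i] [ilt Si H]] := C (fun k => if k is k'.+1 then z k' == 0 else true).
- by exists 0%N.
- case: H => [|[[|j] [jn // zj Wj]]]; first by rewrite e0 ltxx.
  have /eqP := wz _ jn; rewrite mulf_eq0 (negbTE zj) orbF => /eqP Wj0.
  by rewrite Wj0 ltxx in Wj.
have /eqP zi := Si.
have := @zsol_eqn n (shift2 W) (shift1 eta) (shift1 y) (fun i j => symW _ _) i ilt.
rewrite -/z zi mulr0 sub0r => /esym eq.
have u0 (j : 'I_n) : true -> 0 <= shift2 W i j * z j by rewrite mulr_ge0//; exact: W0.
have /andP[/eqP ei /eqP si] :
    (eta i.+1 == 0) && (\sum_(j < n) shift2 W i j * z j == 0).
  rewrite -paddr_eq0 ?sumr_ge0//; move: eq; rewrite /shift1 => ->.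
  by rewrite addNr.
case: H => [|[[|j] [jn // zj Wj]]]; first by rewrite ei ltxx.
move/eqP: si; rewrite psumr_eq0// => /allP/(_ (Ordinal (jn : (j < n)%N))).
rewrite mem_index_enum => /(_ isT) /=; rewrite mulf_eq0 (negbTE zj) orbF => /eqP Wj0.
by rewrite -/(shift2 W i j) Wj0 ltxx in Wj.
Qed.

Lemma zsol_gt0 n W eta y :
  (forall i j, W i j = W j i) -> (forall i j, 0 <= W i j) -> (forall i, 0 <= eta i) ->
  pinned_connected n W eta -> forall i, (i < n)%N -> 0 < zsol n W eta y i.
Proof.
elim: n W eta y => // n IH W eta y symW W0 eta0 C i /=; rewrite -/(zhead n W eta y).
have z0 : 0 < zhead n W eta y * expR (- y 0%N) by rewrite mulr_gt0 ?expR_gt0// zhead_gt0.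
case: i => [//|i]; rewrite ltnS => ilt; apply: IH ilt => [*|*|k|].
- exact: symW.
- exact: W0.
- by rewrite addr_ge0// mulr_ge0// ltW.
- exact: pinned_connected_behead.
Qed.

Definition schrodinger_mx n W (a : nat -> R) : 'M[R]_n :=
  \matrix_(i, j) ((i == j)%:R * a i - W i j).

(** Multiplying by the unipotent [B] adds to column 0 the combination of the other columns given by
    the trailing solution for row 0. This clears the column below its top entry, which becomes the
    pivot exp(y 0). *)
Lemma det_pivot n W y : (forall i j, W i j = W j i) ->
  \det (schrodinger_mx n W (pivot_diag n W y)) = \prod_(i < n) expR (y i).
Proof.
elim: n W y => [|n IH] W y symW; first by rewrite det_mx00 big_ord0.
rewrite big_ord_recl /=; set H := schrodinger_mx _ _ _.
pose w := shift1 (W 0%N); pose z := zsol n (shift2 W) w (shift1 y).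
pose zc : 'cV[R]_n := \col_i z i.
pose H2 := schrodinger_mx n (shift2 W) (pivot_diag n (shift2 W) (shift1 y)).
pose B : 'M[R]_(1 + n) := block_mx 1%:M 0 zc 1%:M.
have dB : \det B = 1 by rewrite det_lblock !det1 mulr1.
suff HB : (H : 'M[R]_(1 + n)) *m B = block_mx (expR (y 0%N))%:M (\row_j (- w j)) 0 H2.
  have := congr1 determinant HB; rewrite det_mulmx dB mulr1 det_ublock det_scalar expr1.
  by rewrite IH// => i j; exact: symW.
rewrite -(submxK (H : 'M[R]_(1 + n))) mulmx_block !mulmx1 !mulmx0 !add0r.
congr block_mx; apply/matrixP => i j.
- rewrite !ord1 !mxE /=.
  rewrite [X in _ + X = _](_ : _ = - \sum_(j < n) W 0%N j.+1 * z j); last first.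
    rewrite -sumrN; apply: eq_bigr => k _.
    by rewrite !mxE /= -mulNr; congr (_ * _); rewrite mul0r sub0r.
  by rewrite mulr1n mul1r /z /w; ring.
- by rewrite !ord1 !mxE /= mul0r sub0r.
- rewrite !ord1 !mxE /= mul0r sub0r symW.
  have wE := @zsol_eqn n (shift2 W) w (shift1 y) (fun i j => symW _ _) i (ltn_ord i).
  rewrite -[W 0%N _]/(w i) -wE -/z [X in _ + X](_ : _ = pivot_diag n (shift2 W) (shift1 y) i * z i -
     \sum_(j < n) shift2 W i j * z j); first by rewrite addNr.
  under eq_bigr do rewrite !mxE /= mulrBl.
  rewrite sumrB; congr (_ - _).
  rewrite (bigD1 i)//= eqxx mul1r big1 ?addr0// => k ki.
  by rewrite -[rshift 1 i == _]/(i == k) eq_sym (negbTE ki) !mul0r.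
- by rewrite !mxE.
Qed.

End Elimination.

Local Open Scope classical_set_scope.
Local Open Scope ring_scope.

(** * Reference measures *)

Section SigmaFinite.
Local Open Scope ereal_scope.
Context d (T : measurableType d) (R : realType).

(** The reference measures are bare set functions. Sigma-finiteness is therefore recorded as
    equality with a bundled measure, and rewriting along it makes Fubini and linearity of the
    integral applicable. *)
Definition is_sfm (m : set T -> \bar R) : Prop :=
  exists m' : {sigma_finite_measure set T -> \bar R}, m = m'.

Section FromSigmaFinite.
Variables (m : {measure set T -> \bar R}) (sm : sigma_finite setT m).

Let mf : set T -> \bar R := m.
Let mf0 : mf set0 = 0. Proof. exact: measure0. Qed.
Let mf_ge0 A : 0 <= mf A. Proof. exact: measure_ge0. Qed.
Let mf_additive : semi_sigma_additive mf. Proof. exact: measure_semi_sigma_additive. Qed.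

#[local] HB.instance Definition _ := isMeasure.Build _ _ _ mf mf0 mf_ge0 mf_additive.
#[local] HB.instance Definition _ := Measure_isSigmaFinite.Build _ _ _ mf sm.

Lemma is_sfmI : is_sfm m.
Proof. by exists mf. Qed.

End FromSigmaFinite.

Lemma is_sfm_dirac (a : T) : is_sfm (\d_ a : set T -> \bar R).
Proof. by eexists. Qed.

End SigmaFinite.

(** A pushforward can lose sigma-finiteness; the measurable left inverse [g] carries an exhausting
    sequence over to the target, since pulling its preimages back along [f] returns the original
    sets. *)
Lemma is_sfm_pushforward d d' (T : measurableType d) (T' : measurableType d')
    (R : realType) (m : set T -> \bar R) (f : T -> T') (g : T' -> T) :
  is_sfm m -> measurable_fun setT f -> measurable_fun setT g -> cancel f g ->
  is_sfm (pushforward m f).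
Proof.
move=> [m' ->] mf mg fg.
pose pf := measure_function_pushforward__canonical__measure_function_Measure m' mf.
apply: (@is_sfmI _ _ _ pf).
have [F UF Ffin] := sigma_finiteT m'.
exists (fun n => g @^-1` (F n)); first by rewrite -preimage_bigcup -UF preimage_setT.
move=> n; have [mFn Fn] := Ffin n; split.
  by rewrite -[X in measurable X]setTI; exact: mg.
rewrite /= /pushforward (_ : _ @^-1` _ = F n)//.
by apply/seteqP; split=> x /=; rewrite fg.
Qed.

Lemma is_sfm_prod d d' (T : measurableType d) (T' : measurableType d')
    (R : realType) (m : set T -> \bar R) (m' : set T' -> \bar R) :
  is_sfm m -> is_sfm m' -> is_sfm (m \x m')%E.
Proof.
move=> [m1 ->] [m2 ->]; apply: is_sfmI.
have /sigma_finiteP[F [TF ndF Foo]] := sigma_finiteT m1.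
have /sigma_finiteP[G [TG ndG Goo]] := sigma_finiteT m2.
exists (fun n => F n `*` G n) => [|k].
  rewrite -setXTT TF TG predeqE => -[x y]; split; last first.
    by move=> [n _ []/= ? ?]; split; exists n.
  move=> [/= [n _ Fnx] [k _ Gky]]; exists (maxn n k) => //; split.
  - by move: x Fnx; exact/subsetPset/ndF/leq_maxl.
  - by move: y Gky; exact/subsetPset/ndG/leq_maxr.
have [? ?] := Foo k; have [? ?] := Goo k; split; first exact: measurableX.
by rewrite /= product_measure1E// lte_mul_pinfty// ge0_fin_numE.
Qed.

Lemma eq_integralT d (T : measurableType d) (R : realType) (m : set T -> \bar R)
    (f g : T -> \bar R) :
  (forall x, f x = g x) -> (\int[m]_x f x = \int[m]_x g x)%E.
Proof. by move=> /funext ->. Qed.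

Lemma integralZl_sfm d (T : measurableType d) (R : realType) (m : set T -> \bar R)
    (k : R) (f : T -> \bar R) :
  is_sfm m -> measurable_fun setT f -> (forall x, 0 <= f x)%E -> 0 <= k ->
  (\int[m]_x (k%:E * f x) = k%:E * \int[m]_x f x)%E.
Proof. by move=> [m' ->] mf f0 k0; rewrite ge0_integralZl. Qed.

Section Integrals.
Local Open Scope ereal_scope.
Context d d' (T : measurableType d) (T' : measurableType d') (R : realType).

Lemma integral_prod_sfm1 (m : set T -> \bar R) (m' : set T' -> \bar R)
    (f : T * T' -> \bar R) :
  is_sfm m -> is_sfm m' -> measurable_fun setT f -> (forall x, 0 <= f x) ->
  \int[m \x m']_z f z = \int[m]_x \int[m']_y f (x, y).
Proof. by move=> [m1 ->] [m2 ->] mf f0; rewrite fubini_tonelli1. Qed.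

Lemma integral_prod_sfm2 (m : set T -> \bar R) (m' : set T' -> \bar R)
    (f : T * T' -> \bar R) :
  is_sfm m -> is_sfm m' -> measurable_fun setT f -> (forall x, 0 <= f x) ->
  \int[m \x m']_z f z = \int[m']_y \int[m]_x f (x, y).
Proof. by move=> [m1 ->] [m2 ->] mf f0; rewrite fubini_tonelli2. Qed.

Lemma integral_exchange_sfm (m : set T -> \bar R) (m' : set T' -> \bar R)
    (f : T * T' -> \bar R) :
  is_sfm m -> is_sfm m' -> measurable_fun setT f -> (forall x, 0 <= f x) ->
  \int[m]_x \int[m']_y f (x, y) = \int[m']_y \int[m]_x f (x, y).
Proof. by move=> sm sm' mf f0; rewrite -integral_prod_sfm1// integral_prod_sfm2. Qed.

Lemma integral_pushforward_sfm (m : set T -> \bar R) (f : T -> T')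
    (h : T' -> \bar R) :
  is_sfm m -> measurable_fun setT f -> measurable_fun setT h ->
  (forall x, 0 <= h x) ->
  \int[pushforward m f]_y h y = \int[m]_x h (f x).
Proof. by move=> [m' ->] mf mh h0; rewrite ge0_integral_pushforward. Qed.

End Integrals.

Section LebesgueTuple.
Local Open Scope ereal_scope.
Variable R : realType.

Lemma is_sfm_lebesgue : is_sfm (@lebesgue_measure R).
Proof. by eexists. Qed.

Lemma measurable_tuple_cons n :
  measurable_fun setT (fun p : R * n.-tuple R => [tuple of p.1 :: p.2]).
Proof. exact: measurable_cons. Qed.

Lemma is_sfm_lebesgue_tuple n : is_sfm (@lebesgue_tuple R n).
Proof.
elim: n => [|n IH] /=; first exact: is_sfm_dirac.
have sp := is_sfm_prod is_sfm_lebesgue IH.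
pose g (t : n.+1.-tuple R) : measurableTypeR R * n.-tuple R := (thead t, [tuple of behead t]).
apply: (@is_sfm_pushforward _ _ _ _ _ _ _ g sp).
- exact: measurable_tuple_cons.
- apply: measurable_fun_pair; [|exact: measurable_behead].
 exact: (@measurable_tnth _ _ _ ord0).
- by move=> [x t]; rewrite /g theadE /=; congr pair; exact: val_inj.
Qed.

Lemma integral_lebesgue_tuple0 (f : 0.-tuple R -> \bar R) :
  measurable_fun setT f -> \int[@lebesgue_tuple R 0]_t f t = f [tuple].
Proof. by move=> mf; rewrite /= integral_dirac// diracT mul1e. Qed.

Lemma integral_lebesgue_tupleS n (f : n.+1.-tuple R -> \bar R) :
  measurable_fun setT f -> (forall t, 0 <= f t) ->
  \int[@lebesgue_tuple R n.+1]_t f t =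
  \int[lebesgue_measure]_x \int[@lebesgue_tuple R n]_t f [tuple of x :: t].
Proof.
move=> mf f0 /=.
have sm := is_sfm_lebesgue_tuple n.
rewrite (integral_pushforward_sfm (is_sfm_prod is_sfm_lebesgue sm)
  (@measurable_tuple_cons n))// integral_prod_sfm1//.
  exact: is_sfm_lebesgue.
by apply: measurableT_comp => //; exact: measurable_tuple_cons.
Qed.

End LebesgueTuple.

Section CoordMeasurable.
Variables (R : realType) (I : Type).

Lemma coord_measurable_coord d (X : measurableType d) (c : I -> X -> R) :
  @measurable _ X = coord_measurable c -> forall i, measurable_fun setT (c i).
Proof.
move=> eX i _ A mA; rewrite setTI eX; apply: sub_sigma_algebra.
by exists i => //; exists A => //; rewrite setTI.
Qed.

Lemma coord_measurable_funP d d' (X : measurableType d) (T : measurableType d')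
    (c : I -> X -> R) (f : T -> X) : @measurable _ X = coord_measurable c ->
  (forall i, measurable_fun setT (fun t => c i (f t))) -> measurable_fun setT f.
Proof.
move=> eX mf; apply: (measurability _ eX) => _ [A [i _ [B mB <-]] <-].
by rewrite !setTI -comp_preimage -[X in measurable X]setTI; exact: mf.
Qed.

End CoordMeasurable.

Section Coordinates.
Variables (R : realType) (G : rooted_graph).
Context d (T : measurableType d).

Lemma measurable_Rn_coord (I : finType) i :
  measurable_fun setT (fun x : Rn R I => x i).
Proof. exact: (@coord_measurable_coord _ _ _ (Rn R I) (fun i (x : {ffun I -> R}) => x i)). Qed.

Lemma measurable_pinned_coord i : measurable_fun setT (fun x : pinned R G => x i).
Proof. exact: (@coord_measurable_coord _ _ _ (pinned R G) (fun i u => fun_of_pinned u i)). Qed.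

Lemma measurable_flow_coord a : measurable_fun setT (fun x : flow R G => x a).
Proof. exact: (@coord_measurable_coord _ _ _ (flow R G) (fun i u => fun_of_flow u i)). Qed.

Lemma measurable_RnP (I : finType) (f : T -> Rn R I) :
  (forall i, measurable_fun setT (fun t => f t i)) -> measurable_fun setT f.
Proof. exact: (@coord_measurable_funP _ _ _ _ (Rn R I) T (fun i (x : {ffun I -> R}) => x i)). Qed.

Lemma measurable_pinnedP (f : T -> pinned R G) :
  (forall i, measurable_fun setT (fun t => f t i)) -> measurable_fun setT f.
Proof. exact: (@coord_measurable_funP _ _ _ _ (pinned R G) T (fun i u => fun_of_pinned u i)). Qed.

Lemma measurable_flowP (f : T -> flow R G) :
  (forall a, measurable_fun setT (fun t => f t a)) -> measurable_fun setT f.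
Proof. exact: (@coord_measurable_funP _ _ _ _ (flow R G) T (fun i u => fun_of_flow u i)). Qed.

End Coordinates.

Section ReferenceMeasures.
Local Open Scope ereal_scope.
Variables (R : realType).

Definition Rn_of_tuple (I : finType) (t : #|I|.-tuple R) : Rn R I :=
  [ffun i => tnth t (enum_rank i)].

Lemma measurable_Rn_of_tuple (I : finType) : measurable_fun setT (@Rn_of_tuple I).
Proof.
apply: measurable_RnP => i.
apply: (eq_measurable_fun (fun t : #|I|.-tuple R => tnth t (enum_rank i))).
  by move=> t _; rewrite ffunE.
exact: measurable_tnth.
Qed.

Lemma is_sfm_lebesgue_Rn (I : finType) : is_sfm (@lebesgue_Rn R I).
Proof.
pose g (x : Rn R I) : #|I|.-tuple R := [tuple x (enum_val i) | i < #|I|].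
apply: (@is_sfm_pushforward _ _ _ _ _ _ _ g).
- exact: is_sfm_lebesgue_tuple.
- exact: measurable_Rn_of_tuple.
- apply/measurable_fun_tnthP => i.
  apply: (eq_measurable_fun (fun x : Rn R I => x (enum_val i))).
    by move=> x _ /=; rewrite tnth_mktuple.
  exact: measurable_Rn_coord.
- by move=> t; apply: eq_from_tnth => i; rewrite tnth_mktuple ffunE enum_valK.
Qed.

Lemma integral_lebesgue_Rn (I : finType) (f : Rn R I -> \bar R) :
  measurable_fun setT f -> (forall t, 0 <= f t) ->
  \int[@lebesgue_Rn R I]_x f x = \int[@lebesgue_tuple R #|I|]_t f (Rn_of_tuple t).
Proof.
move=> mf f0; apply: integral_pushforward_sfm => //.
  exact: is_sfm_lebesgue_tuple.
exact: measurable_Rn_of_tuple.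
Qed.

Variable G : rooted_graph.

Lemma measurable_pin : measurable_fun setT (@pin R G).
Proof.
apply: measurable_pinnedP => i.
have [k ik|ni] := @insubP _ _ (nonroot G) i.
  move=> ki; apply: (eq_measurable_fun (fun x : Rn R (nonroot G) => x k)).
    by move=> x _; rewrite /fun_of_pinned /= ffunE -ki valK.
  exact: measurable_Rn_coord.
apply: (eq_measurable_fun (cst 0%R : Rn R (nonroot G) -> R)) => //.
by move=> x _; rewrite /fun_of_pinned /= ffunE insubN.
Qed.

Lemma pinE (x : Rn R (nonroot G)) (k : nonroot G) : pin x (val k) = x k.
Proof. by rewrite /fun_of_pinned /= ffunE valK. Qed.

Lemma is_sfm_lebesgue_pinned : is_sfm (lebesgue_pinned R G).
Proof.
apply: (@is_sfm_pushforward _ _ _ _ _ _ _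
  (fun u : pinned R G => [ffun k : nonroot G => u (val k)] : Rn R (nonroot G))).
- exact: is_sfm_lebesgue_Rn.
- exact: measurable_pin.
- apply: measurable_RnP => k.
  apply: (eq_measurable_fun (fun u : pinned R G => u (val k))).
    by move=> u _; rewrite ffunE.
  exact: measurable_pinned_coord.
- by move=> x; apply/ffunP => k; rewrite ffunE pinE.
Qed.

Lemma integral_lebesgue_pinned (f : pinned R G -> \bar R) :
  measurable_fun setT f -> (forall t, 0 <= f t) ->
  \int[lebesgue_pinned R G]_x f x =
  \int[@lebesgue_tuple R #|nonroot G|]_t f (pin (Rn_of_tuple t)).
Proof.
move=> mf f0; rewrite -(integral_lebesgue_Rn (f := fun x => f (pin x)))//; last first.
  by apply: measurableT_comp => //; exact: measurable_pin.
apply: integral_pushforward_sfm => //; first exact: is_sfm_lebesgue_Rn.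
exact: measurable_pin.
Qed.

Lemma measurable_diag : measurable_fun setT (fun u : pinned R G => (u, u)).
Proof. exact: measurable_fun_pair. Qed.

Lemma is_sfm_lebesgue_diagonal : is_sfm (lebesgue_diagonal R G).
Proof.
apply: (@is_sfm_pushforward _ _ _ _ _ _ _ fst) => //.
- exact: is_sfm_lebesgue_pinned.
- exact: measurable_diag.
Qed.

Lemma integral_lebesgue_diagonal (f : pinned R G * pinned R G -> \bar R) :
  measurable_fun setT f -> (forall t, 0 <= f t) ->
  \int[lebesgue_diagonal R G]_x f x = \int[lebesgue_pinned R G]_u f (u, u).
Proof.
move=> mf f0; apply: integral_pushforward_sfm => //.
  exact: is_sfm_lebesgue_pinned.
exact: measurable_diag.
Qed.

End ReferenceMeasures.

(** * Counting measure on a finite discrete space *)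

Section FiniteCounting.
Local Open Scope ereal_scope.
Context d (X : measurableType d) (e : seq X).
Hypotheses (ue : uniq e) (me : forall x, x \in e).
Hypothesis mX : forall A : set X, measurable A.
Variable R : realType.

Lemma finite_set_enum (A : set X) : finite_set A.
Proof. by apply: (sub_finite_set (B := [set` e])) => // x _ /=; exact: me. Qed.

Lemma counting_sum_dirac (A : set X) : counting A = \sum_(x <- e) \d_x A :> \bar R.
Proof.
rewrite /counting asboolT; last exact: finite_set_enum.
rewrite (eq_bigr (fun x => ((x \in A)%:R : R)%:E))//.
rewrite sumEFin -natr_sum; congr (_%:R%:E).
transitivity (\sum_(x <- e | x \in A) 1)%N; last first.
  by rewrite big_mkcond; apply: eq_bigr => x _; case: (x \in A).
rewrite sum1_count -size_filter; apply/perm_size/uniq_perm.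
- exact: finmap.fset_uniq.
- exact: filter_uniq.
by move=> x; rewrite mem_filter me andbT in_fset_set//; exact: finite_set_enum.
Qed.

Lemma is_sfm_counting : is_sfm (counting : set X -> \bar R).
Proof.
apply: is_sfmI; exists (fun=> setT); first by rewrite bigcup_const//; exists 0%N.
move=> _; split=> //; rewrite /= /counting asboolT ?ltry//; exact: finite_set_enum.
Qed.

Lemma integral_counting (f : X -> \bar R) : (forall x, 0 <= f x) ->
  \int[counting]_x f x = \sum_(x <- e) f x.
Proof.
move=> f0.
have mf : measurable_fun setT f by move=> _ B mB; exact: mX.
pose m n : {measure set X -> \bar R} := \d_(nth point e n).
rewrite (eq_measure_integral (msum m (size e))) => [|A mA _]; last first.
  by apply: (etrans (counting_sum_dirac A)); rewrite /msum (big_nth point) big_mkord.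
rewrite ge0_integral_measure_sum// (big_nth point) big_mkord.
by apply: eq_bigr => i _; rewrite integral_dirac// diracT mul1e.
Qed.

Lemma measurable_fun_finite d1 d2 (T : measurableType d1) (Y : measurableType d2)
    (f : T * X -> Y) :
  (forall x, measurable_fun setT (fun t => f (t, x))) -> measurable_fun setT f.
Proof.
move=> mf _ B mB; rewrite setTI.
rewrite (_ : _ @^-1` _ =
    \big[setU/set0]_(x <- e) (((fun t => f (t, x)) @^-1` B) `*` [set x])).
  apply: bigsetU_measurable => x _; apply: measurableX; last exact: mX.
  by rewrite -[X in measurable X]setTI; exact: mf.
rewrite -bigcup_seq; apply/seteqP; split=> [[t x] /= fB|[t x] [y _ [/= fB ->]]//].
by exists x; [exact: me|].
Qed.

End FiniteCounting.

(** * One-dimensional integrals *)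

Section LebesgueLine.
Variable R : realType.
Local Notation mu := (@lebesgue_measure R).

Lemma integral_lebesgue_shift (a : R) (f : R -> \bar R) :
  measurable_fun setT f -> (forall x, 0 <= f x)%E ->
  (\int[mu]_x f (x + a)%R = \int[mu]_x f x)%E.
Proof.
move=> mf f0.
have ms : measurable_fun setT ((fun x => x + a) : R -> measurableTypeR R).
  exact: measurable_funD.
transitivity (\int[pushforward mu ((fun x => x + a)%R : R -> measurableTypeR R)]_y f y)%E.
  by rewrite ge0_integral_pushforward.
apply: eq_measure_integral => A mA _.
pose pf := measure_function_pushforward__canonical__measure_function_Measure mu ms.
(* Lebesgue measure is determined by the lengths of half-open intervals, which translation
   preserves. *)
rewrite -[LHS]/(pf A); apply/esym; apply: lebesgue_measure_unique mA => _ [[b c]] _ <-.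
rewrite /= /pushforward (_ : _ @^-1` _ = `]b - a, c - a]%classic).
  rewrite !lebesgue_measure_itv /= !lte_fin ltrD2r; case: ifP => // _.
  by rewrite -!EFinB; congr (_%:E); ring.
by apply/seteqP; split => x /=; rewrite !in_itv/= ltrBlDr lerBrDr.
Qed.

Lemma integral_lebesgue_reflect (a : R) (f : R -> \bar R) :
  measurable_fun setT f -> (forall x, 0 <= f x)%E ->
  (\int[mu]_x f (a - x)%R = \int[mu]_x f x)%E.
Proof.
move=> mf f0; rewrite -[RHS](integral_lebesgue_shift a)//.
have mg : measurable_fun setT (fun x : R => f (x + a)).
  by apply: measurableT_comp => //; exact: measurable_funD.
have mN : measurable_fun setT (-%R : R -> measurableTypeR R) by exact: oppr_measurable.
transitivity (\int[pushforward mu (-%R : R -> measurableTypeR R)]_y f (y + a)%R)%E.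
  rewrite ge0_integral_pushforward//=.
  by apply: eq_integral => x _; rewrite addrC.
by apply: eq_measure_integral => A mA _; exact: lebesgue_measureN.
Qed.

(** Completing the square: the integrand is a constant times the normal density with mean - b / a
    and variance 1 / a. *)
Lemma integral_gauss_quad (a b : R) : 0 < a ->
  (\int[mu]_x (expR (- (2^-1 * (a * x ^+ 2)) - b * x))%:E =
   (Num.sqrt (2 * pi / a) * expR (2^-1 * (b ^+ 2 / a)))%:E)%E.
Proof.
move=> a0; have s0 : (Num.sqrt a)^-1 != 0 by rewrite invr_neq0// gt_eqF// sqrtr_gt0.
have sq : (Num.sqrt a)^-1 ^+ 2 = a^-1 by rewrite exprVn sqr_sqrtr// ltW.
pose k := Num.sqrt (2 * pi / a) * expR (2^-1 * (b ^+ 2 / a)).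
transitivity (\int[mu]_x (k%:E * (normal_pdf (- b / a) (Num.sqrt a)^-1 x)%:E))%E.
  apply: eq_integral => x _; rewrite -EFinM normal_pdfE// /k /normal_peak /normal_fun sq.
  rewrite (_ : a^-1 * pi *+ 2 = 2 * pi / a); last by ring.
  rewrite mulrACA divff ?mul1r; last first.
    by rewrite gt_eqF// sqrtr_gt0 divr_gt0// mulr_gt0// pi_gt0.
  rewrite -expRD; congr (expR _)%:E; field; by rewrite gt_eqF.
rewrite ge0_integralZl//.
- by rewrite integral_normal_pdf mule1.
- by apply/measurable_EFinP; exact: measurable_normal_pdf.
- by move=> x _; rewrite lee_fin normal_pdf_ge0.
- by rewrite lee_fin mulr_ge0 ?sqrtr_ge0 ?expR_ge0.
Qed.

Definition asinh (x : R) : R := ln (x + Num.sqrt (1 + x ^+ 2)).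

Lemma asinh_arg_gt0 (x : R) : 0 < x + Num.sqrt (1 + x ^+ 2).
Proof.
have h : `|x| < Num.sqrt (1 + x ^+ 2) by rewrite -sqrtr_sqr ltr_sqrt ?ltrDr// ltr_pwDl// sqr_ge0.
by rewrite -ltrBlDl sub0r (le_lt_trans _ h)// -normrN ler_norm.
Qed.

Lemma expR_asinh (x : R) : expR (asinh x) = Num.sqrt (1 + x ^+ 2) + x.
Proof. by rewrite lnK ?posrE ?asinh_arg_gt0// addrC. Qed.

Lemma expR_Nasinh (x : R) : expR (- asinh x) = Num.sqrt (1 + x ^+ 2) - x.
Proof.
rewrite expRN expR_asinh; apply: (@mulfI _ (Num.sqrt (1 + x ^+ 2) + x)).
  by rewrite gt_eqF// addrC asinh_arg_gt0.
rewrite divff; last by rewrite gt_eqF// addrC asinh_arg_gt0.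
rewrite mulrC -subr_sqr sqr_sqrtr ?addrK//.
by rewrite addr_ge0// sqr_ge0.
Qed.

Lemma is_derive_asinh (x : R) :
  is_derive x 1 asinh (Num.sqrt (1 + x ^+ 2))^-1.
Proof.
have p : 0 < 1 + x ^+ 2 by rewrite ltr_pwDl// sqr_ge0.
have s0 : Num.sqrt (1 + x ^+ 2) != 0 by rewrite gt_eqF// sqrtr_gt0.
have d1 : is_derive (1 + x ^+ 2) 1 Num.sqrt (2 * Num.sqrt (1 + x ^+ 2))^-1.
  exact: is_derive1_sqrt.
have d2 := is_derive1_ln (asinh_arg_gt0 x).
have d3 : is_derive x 1 (fun x : R => 1 + x ^+ 2) (x *+ 2).
  by apply: is_derive_eq; rewrite /= add0r mul1r [_%:A]mulr1 mulr2n.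
have d4 := @is_derive1_comp _ Num.sqrt (fun x : R => 1 + x ^+ 2) x _ _ d1 d3.
have d5 : is_derive x 1 (fun x : R => x + Num.sqrt (1 + x ^+ 2))
   (1 + (2 * Num.sqrt (1 + x ^+ 2))^-1 * (x *+ 2)).
  exact: (@is_deriveD _ _ _ id (Num.sqrt \o (fun x : R => 1 + x ^+ 2))).
apply: (is_derive_eq (@is_derive1_comp _ (@ln R) _ x _ _ d2 d5)).
have := asinh_arg_gt0 x; move: s0; set s := Num.sqrt _ => s0 xs.
field; by rewrite s0 gt_eqF.
Qed.

(** The filter is left general so that one statement serves at both infinities. *)
Lemma cvg_asinh_derivative (F : set_system R) : Filter F ->
  `|x| @[x --> F] --> +oo -> (Num.sqrt (1 + x ^+ 2))^-1 @[x --> F] --> (0 : R).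
Proof.
move=> FF Fy; apply/cvgr0Pnorm_lt => e e0.
near=> x.
have x0 : 0 < Num.sqrt (1 + x ^+ 2) by rewrite sqrtr_gt0 ltr_pwDl// sqr_ge0.
rewrite gtr0_norm ?invr_gt0// invf_plt ?posrE//.
apply: (@lt_le_trans _ _ `|x|).
  by near: x; move/cvgryPgt : Fy; exact.
by rewrite -sqrtr_sqr ler_wsqrtr// lerDr.
Unshelve. all: by end_near. Qed.

End LebesgueLine.

(** * The inverse Gaussian integral *)

Section InverseGaussian.
Variable R : realType.
Local Notation mu := (@lebesgue_measure R).

Lemma integral_lebesgue_opp (h : R -> R) : measurable_fun setT h ->
  (forall x, 0 <= h x) -> (\int[mu]_x (h (- x)%R)%:E = \int[mu]_x (h x)%:E)%E.
Proof.
move=> mh h0; rewrite -[RHS](@integral_lebesgue_reflect _ 0 (fun x => (h x)%:E)).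
- by apply: eq_integral => x _; rewrite sub0r.
- exact/measurable_EFinP.
- by move=> x; rewrite lee_fin.
Qed.

(** The left side is the outcome of substituting x = 2 asinh y: prefactors times the Gaussian
    integral with a = 4 c and b = 0. The right side keeps a factor 2 because the integrand was added
    to its reflection. *)
Lemma inverse_gaussian_const (c : R) : 0 < c ->
  2 * Num.sqrt c * 2 * expR (- c) *
    (Num.sqrt (2 * pi / (4 * c)) * expR (2^-1 * (0 ^+ 2 / (4 * c)))) =
  2 * (Num.sqrt (2 * pi) * expR (- c)).
Proof.
move=> c0; rewrite expr0n /= mul0r mulr0 expR0 mulr1.
have sc : Num.sqrt c != 0 by rewrite gt_eqF// sqrtr_gt0.
rewrite (_ : 2 * pi / (4 * c) = 2 * pi * (2 * Num.sqrt c) ^- 2); last first.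
  by rewrite exprMn sqr_sqrtr ?ltW// -natrX.
rewrite sqrtrM; last by rewrite mulr_ge0// pi_ge0.
rewrite -exprVn sqrtr_sqr ger0_norm; last by rewrite invr_ge0 mulr_ge0// sqrtr_ge0.
by field.
Qed.

Lemma sqrt_mul_expRN (c x : R) : 0 <= c ->
  Num.sqrt (c * expR (- x)) = Num.sqrt c * expR (- (x / 2)).
Proof.
move=> c0; rewrite sqrtrM//; congr (_ * _).
rewrite (_ : - x = 2 * (- (x / 2))); last by field.
by rewrite expRM_natl sqrtr_sqr ger0_norm ?expR_ge0.
Qed.

(** The integrand [p] and its reflection [q] have the same integral, and p + q carries the factor 2
    cosh(x / 2), the derivative of 4 sinh(x / 2). Since cosh x = 1 + 2 sinh(x / 2)^2, the rest is
    exp(-c) times a Gaussian in sinh(x / 2). *)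
Lemma integral_inverse_gaussian (c : R) : 0 < c ->
  (\int[mu]_x (Num.sqrt (c * expR (- x)) *
     expR (- (2^-1 * (c * (expR x + expR (- x))))))%:E =
   (Num.sqrt (2 * pi) * expR (- c))%:E)%E.
Proof.
move=> c0.
pose I (h : R -> R) := (\int[mu]_x (h x)%:E)%E.
pose g x := expR (- (2^-1 * (c * (expR x + expR (- x))))).
pose p x := Num.sqrt c * expR (- (x / 2)) * g x.
pose q x := Num.sqrt c * expR (x / 2) * g x.
have mg : measurable_fun setT g.
  apply: measurableT_comp => //; apply: measurableT_comp => //.
  apply: measurable_funM => //; apply: measurable_funM => //.
  by apply: measurable_funD => //; apply: measurableT_comp.
have mp : measurable_fun setT p.
  apply: measurable_funM => //; apply: measurable_funM => //.
  apply: measurableT_comp => //; apply: measurableT_comp => //.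
  exact: measurable_funM.
have mq : measurable_fun setT q.
  apply: measurable_funM => //; apply: measurable_funM => //.
  by apply: measurableT_comp => //; exact: measurable_funM.
have p0 x : 0 <= p x by rewrite !mulr_ge0 ?sqrtr_ge0 ?expR_ge0.
have q0 x : 0 <= q x by rewrite !mulr_ge0 ?sqrtr_ge0 ?expR_ge0.
have pq : I q = I p.
  rewrite /I -(integral_lebesgue_opp mq q0).
  apply: eq_integral => x _; rewrite /q /p /g opprK mulNr.
  by rewrite [expR (- x) + _]addrC.
have sumpq : I (fun x => p x + q x) = (2 * (Num.sqrt (2 * pi) * expR (- c)))%:E.
  (* The library's substitution rule needs a derivative with limits at both infinities,
     so the variable is 2 asinh y instead of substituting sinh (x / 2) for y. *)
  pose F := fun y : R => 2 * asinh y.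
  have hF (x : R) : is_derive x 1 F (2 * (Num.sqrt (1 + x ^+ 2))^-1).
    exact: (@is_deriveZ _ _ _ (@asinh R) 2 x 1 _ (is_derive_asinh x)).
  have F'E : F^`()%classic = fun x => 2 * (Num.sqrt (1 + x ^+ 2))^-1.
    by apply/funext => x; rewrite derive1E; exact: (@derive_val _ _ _ _ _ _ _ (hF x)).
  have p_gt0 (x : R) : 0 < 1 + x ^+ 2 by rewrite (ltr_pwDl ltr01 (sqr_ge0 x)).
  have s_gt0 (x : R) : 0 < Num.sqrt (1 + x ^+ 2) by rewrite sqrtr_gt0 p_gt0.
  have cF' : continuous F^`()%classic.
    rewrite F'E => x; apply: cvgM; first exact: cvg_cst.
    apply: cvgV; first by rewrite gt_eqF.
    apply: (@continuous_comp _ _ _ (fun x : R => 1 + x ^+ 2) Num.sqrt); last exact: sqrt_continuous.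
    by apply: cvgD; [exact: cvg_cst|exact: exprn_continuous].
  have limF' (H : set_system R) : ProperFilter H -> `|x| @[x --> H] --> +oo ->
      cvg (F^`()%classic x @[x --> H]).
    move=> FH Hy; rewrite F'E; apply: (@cvgP _ _ (2 * 0 : R)).
    by apply: cvgM; [exact: cvg_cst|exact: cvg_asinh_derivative].
  have two0 : 2 != 0 :> R by rewrite pnatr_eq0.
  have E1 x : expR (F x / 2) = Num.sqrt (1 + x ^+ 2) + x.
    by rewrite /F mulrC (mulKf two0) expR_asinh.
  have E2 x : expR (- (F x / 2)) = Num.sqrt (1 + x ^+ 2) - x.
    by rewrite /F mulrC (mulKf two0) expR_Nasinh.
  have Fincr : {homo F : x y / x < y}.
    move=> x y xy; rewrite ltr_pM2l//; apply: contraLR xy; rewrite -!leNgt => yx.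
    (* Adding this inequality to the one for the opposite exponents cancels the square roots and
       leaves y <= x. *)
    have : expR (asinh y) <= expR (asinh x) by rewrite ler_expR.
    have : expR (- asinh x) <= expR (- asinh y) by rewrite ler_expR lerN2.
    rewrite !expR_asinh !expR_Nasinh; lra.
  have Fy : F x @[x --> +oo] --> +oo.
    apply/cvgryPge => A; near=> x.
    suff : A / 2 <= asinh x by rewrite /F; lra.
    rewrite -ler_expR expR_asinh; apply: (@le_trans _ _ x); last by rewrite lerDr ltW.
    by near: x; exact: nbhs_pinfty_ge.
  have FNy : F x @[x --> -oo] --> -oo.
    apply/cvgrNyPle => A; near=> x.
    suff : - A / 2 <= - asinh x by rewrite /F; lra.
    rewrite -ler_expR expR_Nasinh; apply: (@le_trans _ _ (- x)); last by rewrite lerDr ltW.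
    by rewrite lerNr; near: x; exact: nbhs_ninfty_le.
  have cexp (h : R -> R) : continuous h -> continuous (fun x : R => expR (h x)).
    by move=> ch x; apply: (@continuous_comp _ _ _ h expR); [exact: ch|exact: continuous_expR].
  have ch2 : continuous (fun x : R => x / 2).
    by move=> x; apply: cvgM; [exact: cvg_id|exact: cvg_cst].
  have cpq : continuous (fun x : R => p x + q x).
    have cg : continuous g.
      apply: (cexp (fun x => - (2^-1 * (c * (expR x + expR (- x)))))) => x.
      apply: cvgN; apply: cvgM; first exact: cvg_cst.
      apply: cvgM; first exact: cvg_cst.
      apply: cvgD; first exact: continuous_expR.
      by apply: (cexp (fun x => - x)) => y; apply: cvgN; exact: cvg_id.
    have cNx2 : continuous (fun x : R => expR (- (x / 2))).
      by apply: (cexp (fun x => - (x / 2))) => y; apply: cvgN; exact: ch2.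
    have cp : continuous p.
      by move=> x; apply: cvgM; [apply: cvgM; [exact: cvg_cst|exact: cNx2]|exact: cg].
    have cq : continuous q.
      by move=> x; apply: cvgM; [apply: cvgM; [exact: cvg_cst|exact: (cexp _ ch2)]|exact: cg].
    by move=> x; apply: cvgD; [exact: cp|exact: cq].
  have nNy : `|x| @[x --> (-oo : set_system R)] --> +oo.
    apply/cvgryPge => A; near=> x.
    apply: (@le_trans _ _ (- x)); last by rewrite -normrN ler_norm.
    rewrite lerNr; near: x; apply: nbhs_ninfty_le; exact: num_real.
  have ny : `|x| @[x --> (+oo : set_system R)] --> +oo.
    apply/cvgryPge => A; near=> x.
    apply: (@le_trans _ _ x); last by rewrite ler_norm.
    near: x; apply: nbhs_pinfty_ge; exact: num_real.
  have cNy : cvg (F^`()%classic x @[x --> -oo]) by exact: limF' nNy.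
  have cy : cvg (F^`()%classic x @[x --> +oo]) by exact: limF' ny.
  have dF x : derivable F x 1 by have [] := hF x.
  have pq0 x : 0 <= p x + q x by rewrite addr_ge0.
  transitivity (\int[mu]_x (((p \+ q) \o F) x * F^`()%classic x)%:E)%E.
    exact: (increasing_ge0_integration_by_substitutionT Fincr cF' cNy cy dF FNy Fy cpq pq0).
  pose h (x : R) := expR (- (2^-1 * (4 * c * x ^+ 2)) - 0 * x).
  transitivity (\int[mu]_x ((2 * Num.sqrt c * 2 * expR (- c))%:E * (h x)%:E))%E.
    apply: eq_integral => x _; rewrite -EFinM; congr (_%:E).
    have sq (y : R) : expR y = expR (y / 2) ^+ 2.
      by rewrite -expRM_natl mulr_natl mulr2n -splitr.
    rewrite F'E /= /p /q /g /h (sq (F x)) (sq (- F x)) mulNr E1 E2.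
    rewrite (_ : expR (- (2^-1 * _)) =
        expR (- c) * expR (- (2^-1 * (4 * c * x ^+ 2)) - 0 * x)).
      by field; rewrite gt_eqF.
    rewrite -expRD; congr expR.
    have e := sqr_sqrtr (ltW (p_gt0 x)).
    by rewrite sqrrD sqrrB e; field.
  have mx : measurable_fun setT (fun x : R => x) by exact: measurable_id.
  have mh : measurable_fun setT h.
    apply: (measurableT_comp (@measurable_expR R)).
    apply: measurable_funB; last by apply: measurable_funM => //; exact: mx.
    apply: measurable_funN; do 2 apply: (measurable_funM (measurable_cst _)).
    exact: (measurable_funX 2 mx).
  have mhE : measurable_fun setT (fun x => (h x)%:E) by apply/measurable_EFinP; exact: mh.
  have h0 x : (0 <= (h x)%:E)%E by exact: expR_ge0.
  have k0 : 0 <= 2 * Num.sqrt c * 2 * expR (- c).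
    by rewrite !mulr_ge0 ?expR_ge0 ?sqrtr_ge0 ?ler0n.
  rewrite (integralZl_sfm (is_sfm_lebesgue R) mhE h0 k0).
  have c4 : 0 < 4 * c by exact: mulr_gt0.
  rewrite (integral_gauss_quad 0 c4) -EFinM; congr (_%:E); exact: inverse_gaussian_const.
have : I (fun x => p x + q x) = (I p + I q)%E.
  have E0 (k : R -> R) : (forall x, 0 <= k x) -> forall x, setT x -> (0 <= (k x)%:E)%E.
    by move=> k0 x _; rewrite lee_fin.
  have mE (k : R -> R) : measurable_fun setT k -> measurable_fun setT (fun x => (k x)%:E).
    by move=> mk; apply/measurable_EFinP; exact: mk.
  exact: (ge0_integralD mu measurableT (E0 p p0) (mE p mp) (E0 q q0) (mE q mq)).
rewrite pq sumpq => e.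
have -> : (\int[mu]_x (Num.sqrt (c * expR (- x)) *
     expR (- (2^-1 * (c * (expR x + expR (- x))))))%:E)%E = I p.
  by apply: eq_integral => x _; rewrite /p /g (sqrt_mul_expRN _ (ltW c0)).
(* The equation can be halved only for a finite value; the finite sum and nonnegativity exclude the
   infinite ones. *)
move: e; have : (0 <= I p)%E by apply: integral_ge0 => x _; rewrite lee_fin.
case: (I p) => [v|//|//] _ [] vE; congr (_%:E); clear -vE; lra.
Unshelve. all: by end_near. Qed.

End InverseGaussian.

(** * Normalisation of the field density *)

Section MeasurableHelpers.
Context d (T : measurableType d) (R : realType).

Lemma measurable_fun_bigsum (I : Type) (s : seq I) (P : pred I) (h : I -> T -> R) :
  (forall i, measurable_fun setT (h i)) ->
  measurable_fun setT (fun x => \sum_(i <- s | P i) h i x).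
Proof.
move=> mh; under eq_fun do rewrite big_mkcond.
by apply: measurable_sum => i; case: (P i).
Qed.

Lemma measurable_fun_bigprod (I : eqType) (s : seq I) (P : pred I) (h : I -> T -> R) :
  (forall i, measurable_fun setT (h i)) ->
  measurable_fun setT (fun x => \prod_(i <- s | P i) h i x).
Proof.
move=> mh; under eq_fun do rewrite big_mkcond.
by apply: measurable_prod => i _; case: (P i).
Qed.

Lemma measurable_fun_expR (h : T -> R) :
  measurable_fun setT h -> measurable_fun setT (fun x => expR (h x)).
Proof. by move=> mh; exact: (measurableT_comp (@measurable_expR R)). Qed.

Lemma measurable_fun_opp (h : T -> R) :
  measurable_fun setT h -> measurable_fun setT (fun x => - h x).
Proof. by move=> mh; exact: measurable_funN. Qed.

Lemma measurable_fun_sqrt (h : T -> R) :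
  measurable_fun setT h -> measurable_fun setT (fun x => Num.sqrt (h x)).
Proof.
move=> mh; apply: (measurableT_comp (f := @Num.sqrt R)) => //.
by apply: continuous_measurable_fun; exact: sqrt_continuous.
Qed.

Lemma measurable_fun_det n (h : 'I_n -> 'I_n -> T -> R) :
  (forall i j, measurable_fun setT (h i j)) ->
  measurable_fun setT (fun x => \det (\matrix_(i, j) h i j x)).
Proof.
move=> mh; apply: measurable_fun_bigsum => s; apply: measurable_funM => //.
apply: measurable_fun_bigprod => i.
by under eq_fun do rewrite mxE; exact: mh.
Qed.

End MeasurableHelpers.

(** * The change of variables from log pivots to the field preserves Lebesgue measure *)

Section MeasurePreserving.
Variable R : realType.
Implicit Types (W : nat -> nat -> R) (eta : nat -> R).

(** Tuples become sequences padded with 0, so that an index shift in the recursions is the tail of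
    the tuple. *)
Definition tfun n (t : n.-tuple R) : nat -> R := nth 0 t.

Lemma measurable_tfun n i : measurable_fun setT (fun t : n.-tuple R => tfun t i).
Proof.
have [ilt|ige] := ltnP i n.
  apply: (eq_measurable_fun (fun t : n.-tuple R => tnth t (Ordinal ilt))).
    by move=> t _; rewrite (tnth_nth 0).
  exact: measurable_tnth.
apply: (eq_measurable_fun (cst 0 : n.-tuple R -> R)) => //.
by move=> t _; rewrite /tfun nth_default ?size_tuple.
Qed.

(** The couplings vary with the point as well, because the recursion feeds the value at index 0 back
    into them. *)
Lemma measurable_zsol d (T : measurableType d) n W (eta y : nat -> T -> R) i :
  (forall k, measurable_fun setT (eta k)) -> (forall k, measurable_fun setT (y k)) ->
  measurable_fun setT (fun t => zsol n W (eta ^~ t) (y ^~ t) i).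
Proof.
elim: n W eta y i => [|n IH] W eta y i meta my //=.
pose z0 t := (eta 0%N t + \sum_(j < n) W 0%N j.+1 *
  zsol n (shift2 W) (shift1 (eta ^~ t)) (shift1 (y ^~ t)) j) * expR (- y 0%N t).
have mz0 : measurable_fun setT z0.
  apply: measurable_funM; last by apply: measurable_fun_expR; exact: measurable_fun_opp.
  apply: measurable_funD => //; apply: measurable_fun_bigsum => j.
  apply: measurable_funM => //.
  by apply: (IH _ (fun k => eta k.+1) (fun k => y k.+1)).
case: i => [//|i].
apply: (IH _ (fun k t => eta k.+1 t + z0 t * W 0%N k.+1) (fun k => y k.+1)) => // k.
by apply: measurable_funD => //; exact: measurable_funM.
Qed.

Lemma measurable_pivot_diag d (T : measurableType d) n W (y : nat -> T -> R) i :
  (forall k, measurable_fun setT (y k)) ->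
  measurable_fun setT (fun t => pivot_diag n W (y ^~ t) i).
Proof.
elim: n W y i => [|n IH] W y i my //=; case: i => [|i].
  apply: measurable_funD.
    by apply: measurable_funD => //; exact: measurable_fun_expR.
  apply: measurable_fun_bigsum => j; apply: measurable_funM => //.
  by apply: (@measurable_zsol _ _ _ _ (fun k _ => shift1 (W 0%N) k) (fun k => y k.+1)).
by apply: (IH _ (fun k => y k.+1)).
Qed.

Definition log_sol n W (eta : nat -> R) (t : n.-tuple R) : n.-tuple R :=
  [tuple ln (zsol n W eta (tfun t) i) | i < n].

Lemma tfun_log_sol n W eta (t : n.-tuple R) i : (i < n)%N ->
  tfun (log_sol W eta t) i = ln (zsol n W eta (tfun t) i).
Proof.
move=> ilt; rewrite /tfun -[i]/(nat_of_ord (Ordinal ilt)) -tnth_nth.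
by rewrite tnth_mktuple.
Qed.

Lemma measurable_log_sol d (T : measurableType d) n W (eta : nat -> T -> R)
    (t : T -> n.-tuple R) :
  (forall k, measurable_fun setT (eta k)) -> measurable_fun setT t ->
  measurable_fun setT (fun x => log_sol W (eta ^~ x) (t x)).
Proof.
move=> meta mt; apply/measurable_fun_tnthP => i.
apply: (eq_measurable_fun (fun x => ln (zsol n W (eta ^~ x) (tfun (t x)) i))).
  by move=> x _; rewrite /= tnth_mktuple.
apply: (measurableT_comp (f := @ln R)) => //.
apply: (@measurable_zsol _ _ n W eta (fun k x => tfun (t x) k)) => // k.
by apply: (measurableT_comp (measurable_tfun k)).
Qed.

Lemma log_sol_cons n W eta x (t : n.-tuple R) :
  0 < zhead n W eta (tfun [tuple of x :: t]) ->
  let u0 := ln (zhead n W eta (tfun [tuple of x :: t])) - x in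
  log_sol W eta [tuple of x :: t] =
  [tuple of u0 :: log_sol (shift2 W) (fun k => eta k.+1 + expR u0 * W 0%N k.+1) t].
Proof.
move=> c0 u0.
have u0E : zhead n W eta (tfun [tuple of x :: t]) * expR (- x) = expR u0.
  by rewrite /u0 expRD lnK.
apply: eq_from_tnth => i; rewrite tnth_mktuple /=.
rewrite -/(zhead n W eta (tfun [tuple of x :: t])) -[tfun _ 0]/x u0E.
case: (unliftP ord0 i) => [j ->|->].
  by rewrite tnthS tnth_mktuple.
by rewrite tnth0 expRK.
Qed.

Local Notation lam n := (@lebesgue_tuple R n).

(* Since index 0 is eliminated last, [log_sol_cons] builds the map from translations and
   reflections of single coordinates. *)
Lemma log_sol_preserving n W eta (f : n.-tuple R -> \bar R) :
  (forall i j, W i j = W j i) -> (forall i j, 0 <= W i j) -> (forall i, 0 <= eta i) ->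
  pinned_connected n W eta ->
  measurable_fun setT f -> (forall u, (0 <= f u)%E) ->
  (\int[lam n]_u f u = \int[lam n]_y f (log_sol W eta y))%E.
Proof.
elim: n W eta f => [|n IH] W eta f symW W0 eta0 C mf f0.
  rewrite !integral_lebesgue_tuple0//.
    by congr f; apply: eq_from_tnth => -[].
  by apply: measurableT_comp => //; exact: (@measurable_log_sol _ _ _ _ (fun k _ => eta k)).
pose eta' x k := eta k.+1 + expR x * W 0%N k.+1.
pose c (t : n.-tuple R) := zhead n W eta (tfun [tuple of 0 :: t]).
have c0 t : 0 < c t by exact: zhead_gt0.
have cE (x : R) (t : n.-tuple R) : zhead n W eta (tfun [tuple of x :: t]) = c t by [].
have mc : measurable_fun setT c.
  apply: measurable_funD => //; apply: measurable_fun_bigsum => j.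
  apply: measurable_funM => //.
  apply: (@measurable_zsol _ _ _ _ (fun k _ => shift1 eta k) (fun k t => tfun t k)) => // k.
  exact: measurable_tfun.
have meta' d (T : measurableType d) (h : T -> R) k :
    measurable_fun setT h -> measurable_fun setT (fun x => eta' (h x) k).
  move=> mh; apply: measurable_funD => //; apply: measurable_funM => //.
  exact: measurable_fun_expR.
pose g (p : R * n.-tuple R) := f [tuple of p.1 :: log_sol (shift2 W) (eta' p.1) p.2].
have mg : measurable_fun setT g.
  apply: measurableT_comp => //; apply: measurable_cons => //.
  by apply: (@measurable_log_sol _ _ _ _ (fun k p => eta' p.1 k)) => // k; exact: meta'.
have slt := is_sfm_lebesgue_tuple R n.
transitivity (\int[lebesgue_measure]_x \int[lam n]_y g (x, y))%E.
  rewrite (integral_lebesgue_tupleS mf f0); apply: eq_integralT => x.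
  have eta'0 k : 0 <= eta' x k by rewrite addr_ge0// mulr_ge0// expR_ge0.
  have C' : pinned_connected n (shift2 W) (eta' x).
    by apply: pinned_connected_behead => //; exact: expR_gt0.
  have mfx : measurable_fun setT (fun u : n.-tuple R => f [tuple of x :: u]).
    by apply: measurableT_comp => //; exact: measurable_cons.
  exact: (IH (shift2 W) (eta' x) (fun u => f [tuple of x :: u])
    (fun i j => symW _ _) (fun i j => W0 _ _) eta'0 C' mfx (fun u => f0 _)).
rewrite (integral_exchange_sfm (is_sfm_lebesgue R) slt mg (fun p => f0 _)).
(* With [x] innermost, [y] and hence [c y] are fixed, so the passage to [ln (c y) - x] is a
   reflection of the line. *)
pose g' (p : R * n.-tuple R) := g (ln (c p.2) - p.1, p.2).
have mg' : measurable_fun setT g'.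
  apply: measurableT_comp => //; apply: measurable_fun_pair => //.
  apply: measurable_funB => //; apply: (measurableT_comp (f := @ln R)) => //.
  exact: measurableT_comp.
transitivity (\int[lam n]_y \int[lebesgue_measure]_x g' (x, y))%E.
  apply: eq_integralT => y; apply/esym.
  have mgy : measurable_fun setT (fun x : R => g (x, y)).
    by apply: measurableT_comp => //; exact: measurable_fun_pair.
  exact: (integral_lebesgue_reflect (ln (c y)) mgy (fun x => f0 _)).
transitivity (\int[lebesgue_measure]_x \int[lam n]_y g' (x, y))%E.
  by apply/esym; exact: (integral_exchange_sfm (is_sfm_lebesgue R) slt mg' (fun p => f0 _)).
rewrite (integral_lebesgue_tupleS _ (fun y => f0 _)); last first.
  by apply: measurableT_comp => //; exact: (@measurable_log_sol _ _ _ _ (fun k _ => eta k)).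
apply: eq_integralT => x; apply: eq_integralT => y.
by rewrite /g' /g /= log_sol_cons ?cE.
Qed.

End MeasurePreserving.

(** * Total mass of the field density *)

Section Normalisation.
Variable R : realType.
Implicit Types (W : nat -> nat -> R) (eta y u : nat -> R).
Local Notation lam n := (@lebesgue_tuple R n).

(** The diagonal a for which exp u solves (diag a - W) exp(u) = eta; along [log_sol] it coincides
    with [pivot_diag]. *)
Definition site_potential n W eta u (i : nat) : R :=
  expR (- u i) * (\sum_(j < n) W i j * expR (u j) + eta i).

(** Makes the exponent of [field_density] vanish at u = 0, matching the constant in 1 - cosh. *)
Definition total_weight n W eta : R :=
  2^-1 * \sum_(i < n) \sum_(j < n) W i j + \sum_(i < n) eta i.

(** The density of u in Schrodinger form. A root coupling [eta i] occurs with exp(-u_i) through the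
    site potential and with exp(u_i) in the separate sum; together they give its cosh term. *)
Definition field_density n W eta u : R :=
  expR (- (2^-1 * (\sum_(i < n) site_potential n W eta u i +
                   \sum_(i < n) eta i * expR (u i))) + total_weight n W eta)
  * Num.sqrt (\det (schrodinger_mx n W (site_potential n W eta u))).

Definition pivot_density n W eta y : R :=
  expR (- (2^-1 * (\sum_(i < n) pivot_diag n W y i +
                   \sum_(i < n) eta i * zsol n W eta y i)) + total_weight n W eta)
  * Num.sqrt (\prod_(i < n) expR (y i)).

(** Positivity of the solution lets the exponential undo the logarithm; dividing [zsol_eqn] by the
    solution then identifies the site potential with [pivot_diag], whose determinant is the product
    of pivots. *)
Lemma field_density_log_sol n W eta (t : n.-tuple R) :
  (forall i j, W i j = W j i) -> (forall i j, 0 <= W i j) -> (forall i, 0 <= eta i) ->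
  pinned_connected n W eta ->
  field_density n W eta (tfun (log_sol W eta t)) = pivot_density n W eta (tfun t).
Proof.
move=> symW W0 eta0 C.
have z0 i : (i < n)%N -> 0 < zsol n W eta (tfun t) i by exact: zsol_gt0.
have eu (i : 'I_n) : expR (tfun (log_sol W eta t) i) = zsol n W eta (tfun t) i.
  by rewrite tfun_log_sol// lnK// posrE z0.
have ea (i : 'I_n) : site_potential n W eta (tfun (log_sol W eta t)) i =
    pivot_diag n W (tfun t) i.
  rewrite /site_potential expRN eu.
  under eq_bigr do rewrite eu.
  rewrite -[X in _ + X](@zsol_eqn R n W eta (tfun t) symW i (ltn_ord i)).
  by rewrite addrCA subrr addr0 mulrC mulfK// gt_eqF// z0.
rewrite /field_density /pivot_density -(@det_pivot R n W)//.
rewrite (eq_bigr (fun i : 'I_n => pivot_diag n W (tfun t) i) (fun i _ => ea i)).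
have eetau (i : 'I_n) : eta i * expR (tfun (log_sol W eta t) i) =
    eta i * zsol n W eta (tfun t) i by rewrite eu.
rewrite (eq_bigr (fun i : 'I_n => eta i * zsol n W eta (tfun t) i) (fun i _ => eetau i)).
rewrite (_ : schrodinger_mx n W (site_potential _ _ _ _) =
   schrodinger_mx n W (pivot_diag n W (tfun t)))//.
by apply/matrixP => i j; rewrite !mxE ea.
Qed.

Lemma pivot_density_ge0 n W eta y : 0 <= pivot_density n W eta y.
Proof. by rewrite mulr_ge0 ?expR_ge0// sqrtr_ge0. Qed.

Lemma field_density_ge0 n W eta u : 0 <= field_density n W eta u.
Proof. by rewrite mulr_ge0 ?expR_ge0// sqrtr_ge0. Qed.

Lemma measurable_pivot_density d (T : measurableType d) n W eta (y : nat -> T -> R) :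
  (forall k, measurable_fun setT (y k)) ->
  measurable_fun setT (fun x => pivot_density n W eta (y ^~ x)).
Proof.
move=> my; apply: measurable_funM; last first.
  apply: measurable_fun_sqrt; apply: measurable_fun_bigprod => i.
  exact: measurable_fun_expR.
apply: measurable_fun_expR; apply: measurable_funD => //.
apply: measurable_fun_opp; apply: measurable_funM => //; apply: measurable_funD.
  by apply: measurable_fun_bigsum => i; exact: measurable_pivot_diag.
apply: measurable_fun_bigsum => i; apply: measurable_funM => //.
exact: (@measurable_zsol _ _ _ _ _ (fun k _ => eta k)).
Qed.

Lemma measurable_field_density n W eta :
  measurable_fun setT (fun t : n.-tuple R => field_density n W eta (tfun t)).
Proof.
have me k : measurable_fun setT (fun t : n.-tuple R => expR (tfun t k)).
  by apply: measurable_fun_expR; exact: measurable_tfun.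
have ms k : measurable_fun setT (fun t : n.-tuple R => site_potential n W eta (tfun t) k).
  apply: measurable_funM.
    by apply: measurable_fun_expR; apply: measurable_fun_opp; exact: measurable_tfun.
  apply: measurable_funD => //; apply: measurable_fun_bigsum => j.
  exact: measurable_funM.
apply: measurable_funM.
  apply: measurable_fun_expR; apply: measurable_funD => //.
  apply: measurable_fun_opp; apply: measurable_funM => //; apply: measurable_funD.
    by apply: measurable_fun_bigsum => i; exact: ms.
  by apply: measurable_fun_bigsum => i; exact: measurable_funM.
apply: measurable_fun_sqrt; apply: measurable_fun_det => i j.
by apply: measurable_funB => //; exact: measurable_funM.
Qed.

(* The exponent is quadratic in exp(y_0 / 2) and its inverse; what remains after
   the integration over y_0 is the same density with the 0-th vertex merged
   into the root. *)
Lemma pivot_density_cons n W eta x (t : n.-tuple R) :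
  (forall i j, W i j = W j i) ->
  let c := zhead n W eta (tfun [tuple of 0 :: t]) in 0 < c ->
  pivot_density n.+1 W eta (tfun [tuple of (ln c - x) :: t]) =
  expR c * pivot_density n (shift2 W) (fun k => eta k.+1 + W 0%N k.+1) (tfun t) *
  (Num.sqrt (c * expR (- x)) * expR (- (2^-1 * (c * (expR x + expR (- x)))))).
Proof.
move=> symW c c0; set y := tfun _.
have symW' i j : shift2 W i j = shift2 W j i by exact: symW.
pose w := shift1 (W 0%N); pose eta' := shift1 eta; pose z e := zsol n (shift2 W) e (tfun t).
have y0 : expR (y 0%N) = c * expR (- x) by rewrite -[y 0%N]/(ln c - x) expRD lnK.
have z0 : zsol n.+1 W eta y 0 = expR x.
  rewrite /= -/(zhead n W eta y) -[zhead _ _ _ _]/c expRN y0 invfM expRN invrK mulrA.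
  by rewrite divff ?mul1r// gt_eqF.
have zS (i : 'I_n) : zsol n.+1 W eta y (lift ord0 i) = z eta' i + expR x * z w i.
  rewrite -z0 /= -/(zhead n W eta y).
  exact: (zsol_linear_shift n (shift2 W) eta (W 0%N)).
have zw (i : 'I_n) : z (fun k => eta k.+1 + W 0%N k.+1) i = z eta' i + z w i.
  rewrite -[X in _ = _ + X]mul1r -(zsol_linear_shift n (shift2 W) eta (W 0%N)).
  by congr zsol; apply/funext => k; rewrite mul1r.
pose S1 := \sum_(i < n) eta' i * z eta' i.
pose S2 := \sum_(i < n) w i * z w i.
pose S3 := \sum_(i < n) w i * z eta' i.
(* Symmetry of the Green function makes the two cross terms equal. This lets [c = eta 0 + S3] appear
   as the coefficient of exp x below, besides being that of exp(-x). *)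
have S3E : \sum_(i < n) eta' i * z w i = S3 by exact: zsol_sym.
have cE : c = eta 0%N + S3 by [].
have A0 : pivot_diag n.+1 W y 0 = c * expR (- x) + W 0%N 0%N + S2 by rewrite -y0.
pose SA := \sum_(i < n) pivot_diag n (shift2 W) (tfun t) i.
have E1 : \sum_(i < n.+1) pivot_diag n.+1 W y i = c * expR (- x) + W 0%N 0%N + S2 + SA.
  by rewrite big_ord_recl A0.
have E2 : \sum_(i < n.+1) eta i * zsol n.+1 W eta y i = c * expR x + S1.
  rewrite big_ord_recl z0; under eq_bigr do rewrite zS mulrDr mulrCA.
  rewrite big_split -mulr_sumr /= -[\sum_(i < n) _ * z w i]/(\sum_(i < n) eta' i * z w i).
  by rewrite S3E -/S1 cE; ring.
have E3 : \sum_(i < n) (eta i.+1 + W 0%N i.+1) * z (fun k => eta k.+1 + W 0%N k.+1) i =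
    S1 + S3 + S3 + S2.
  rewrite -[S1 + S3]/(S1 + S3) -{1}S3E -!big_split /=.
  by apply: eq_bigr => i _; rewrite zw /eta' /w /shift1; ring.
pose SW := \sum_(i < n) \sum_(j < n) shift2 W i j.
pose sw := \sum_(i < n) w i; pose se := \sum_(i < n) eta' i.
have K1 : total_weight n.+1 W eta = 2^-1 * (W 0%N 0%N + sw + sw + SW) + eta 0%N + se.
  rewrite /total_weight [\sum_(i < n.+1) eta _]big_ord_recl addrA.
  congr (_ * _ + _ + _); rewrite big_ord_recl big_ord_recl -!addrA; congr (_ + (_ + _)).
  under eq_bigr do rewrite big_ord_recl.
  rewrite big_split /=; congr (_ + _); apply: eq_bigr => i _; exact: symW.
have K2 : total_weight n (shift2 W) (fun k => eta k.+1 + W 0%N k.+1) = 2^-1 * SW + se + sw.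
  by rewrite /total_weight big_split /= addrA.
rewrite /pivot_density E1 E2 E3 K1 K2 big_ord_recl sqrtrM ?expR_ge0// y0.
rewrite -[\prod_(i < n) expR (y _)]/(\prod_(i < n) expR (tfun t i)).
rewrite -/SA.
set P := Num.sqrt (\prod_(i < n) _); set Q := Num.sqrt (c * _).
have -> a b d : a * (b * P) * (Q * d) = (a * b * d) * (Q * P) by ring.
by rewrite -!expRD; congr (expR _ * _); rewrite cE; field.
Qed.

Lemma integral_pivot_density n W eta :
  (forall i j, W i j = W j i) -> (forall i j, 0 <= W i j) -> (forall i, 0 <= eta i) ->
  pinned_connected n W eta ->
  (\int[lam n]_t (pivot_density n W eta (tfun t))%:E = (Num.sqrt (2 * pi) ^+ n)%:E)%E.
Proof.
have mp m W' eta' : measurable_fun setT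
    (fun t : m.-tuple R => (pivot_density m W' eta' (tfun t))%:E).
  apply/measurable_EFinP; apply: measurable_pivot_density => k; exact: measurable_tfun.
have p0 m W' eta' (t : m.-tuple R) : (0 <= (pivot_density m W' eta' (tfun t))%:E)%E.
  by rewrite lee_fin pivot_density_ge0.
elim: n W eta => [|n IH] W eta symW W0 eta0 C.
  rewrite integral_lebesgue_tuple0//; congr (_%:E).
  rewrite /pivot_density /total_weight !big_ord0 addr0 mulr0 addr0 oppr0 addr0.
  by rewrite expR0 sqrtr1 mulr1.
rewrite (integral_lebesgue_tupleS (mp _ _ _) (p0 _ _ _)).
pose c (t : n.-tuple R) := zhead n W eta (tfun [tuple of 0 :: t]).
have c0 t : 0 < c t by exact: zhead_gt0.
have slt := is_sfm_lebesgue_tuple R n.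
pose g (p : R * n.-tuple R) := (pivot_density n.+1 W eta (tfun [tuple of p.1 :: p.2]))%:E.
have mg : measurable_fun setT g.
  by apply: (measurableT_comp (mp _ _ _)); exact: measurable_cons.
have g0 p : (0 <= g p)%E by exact: p0.
transitivity (\int[lam n]_t \int[lebesgue_measure]_x g (x, t))%E.
  exact: (integral_exchange_sfm (is_sfm_lebesgue R) slt mg g0).
pose h (t : n.-tuple R) := pivot_density n (shift2 W) (fun k => eta k.+1 + W 0%N k.+1) (tfun t).
transitivity (\int[lam n]_t ((Num.sqrt (2 * pi))%:E * (h t)%:E))%E.
  apply: eq_integralT => t.
  have mgt : measurable_fun setT (fun x : R => g (x, t)).
    by apply: measurableT_comp => //; exact: measurable_fun_pair.
  (* Reflecting with [ln c] balances the exponent: exp x and exp(-x) both get the coefficient [c],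
     as the inverse Gaussian integral requires. *)
  rewrite -(integral_lebesgue_reflect (ln (c t)) mgt (fun x => g0 _)).
  pose q x := Num.sqrt (c t * expR (- x)) * expR (- (2^-1 * (c t * (expR x + expR (- x))))).
  have q0 x : 0 <= q x by rewrite mulr_ge0 ?sqrtr_ge0 ?expR_ge0.
  have mq : measurable_fun setT q.
    have mN : measurable_fun setT (fun x : R => - x) by exact: measurable_fun_opp.
    apply: measurable_funM.
      by apply: measurable_fun_sqrt; apply: measurable_funM => //; exact: measurable_fun_expR.
    apply: measurable_fun_expR; apply: measurable_fun_opp; do 2 apply: measurable_funM => //.
    by apply: measurable_funD => //; exact: measurable_fun_expR.
  transitivity (\int[lebesgue_measure]_x ((expR (c t) * h t)%:E * (q x)%:E))%E.
    apply: eq_integralT => x; rewrite -EFinM; congr (_%:E).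
    exact: (pivot_density_cons x symW (c0 t)).
  rewrite ge0_integralZl//; last 3 first.
  - by apply/measurable_EFinP; exact: mq.
  - by move=> x _; rewrite lee_fin.
  - by rewrite lee_fin mulr_ge0 ?expR_ge0// pivot_density_ge0.
  rewrite integral_inverse_gaussian// -!EFinM; congr (_%:E).
  have := expRxMexpNx_1 (c t); set e := expR (c t); set e' := expR (- c t) => ee.
  by rewrite mulrACA mulrC -[RHS]mulr1 -ee; ring.
rewrite exprS EFinM -(IH (shift2 W) (fun k => eta k.+1 + W 0%N k.+1)); first last.
(* Once y_0 is integrated out, vertex 0 merges into the root with weight 1, whereas the change of
   variables merges it with weight exp(u_0). *)
- have := pinned_connected_behead ltr01 symW W0 eta0 C.
  rewrite (_ : (fun k => _) = (fun k => eta k.+1 + W 0%N k.+1))//.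
  by apply/funext => k; rewrite mul1r.
- by move=> k; rewrite addr_ge0.
- by move=> i j; exact: W0.
- by move=> i j; exact: symW.
have [m' mE] := slt; rewrite mE ge0_integralZl//.
- exact: mp.
- by move=> t _; exact: p0.
Qed.

Theorem integral_field_density n W eta :
  (forall i j, W i j = W j i) -> (forall i j, 0 <= W i j) -> (forall i, 0 <= eta i) ->
  pinned_connected n W eta ->
  (\int[lam n]_t (field_density n W eta (tfun t))%:E = (Num.sqrt (2 * pi) ^+ n)%:E)%E.
Proof.
move=> symW W0 eta0 C; rewrite -(integral_pivot_density symW W0 eta0 C).
rewrite (log_sol_preserving symW W0 eta0 C).
- by apply: eq_integralT => t; rewrite field_density_log_sol.
- by apply/measurable_EFinP; exact: measurable_field_density.
- by move=> u; rewrite lee_fin field_density_ge0.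
Qed.

End Normalisation.

(** * Gaussian integrals *)

Section Gaussian.
Variable R : realType.
Implicit Types (A : nat -> nat -> R) (x : nat -> R).
Local Notation lam n := (@lebesgue_tuple R n).

Definition quad_form n A x : R := \sum_(i < n) \sum_(j < n) A i j * x i * x j.

Definition nat_mx n A : 'M[R]_n := \matrix_(i, j) A i j.

Definition pos_def n A := forall x, (exists2 i, (i < n)%N & x i != 0) -> 0 < quad_form n A x.

Definition schur A (i j : nat) : R := A i.+1 j.+1 - A i.+1 0%N * A 0%N j.+1 / A 0%N 0%N.

(** Arranged for [integral_gauss_quad]: half of the linear term is [b * x 0], and the extra b^2 / a
    cancels the exponential that this integral produces. *)
Lemma quad_form_cons n A x : (forall i j, A i j = A j i) -> A 0%N 0%N != 0 ->
  quad_form n.+1 A x = A 0%N 0%N * x 0%N ^+ 2 +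
    2 * (\sum_(j < n) A 0%N j.+1 * x j.+1) * x 0%N +
    (quad_form n (schur A) (shift1 x) + (\sum_(j < n) A 0%N j.+1 * x j.+1) ^+ 2 / A 0%N 0%N).
Proof.
move=> symA a0; set b := \sum_(j < n) _; set a := A 0%N 0%N in a0 *.
have bb : b ^+ 2 / a = \sum_(i < n) \sum_(j < n)
    A i.+1 0%N * A 0%N j.+1 / a * x i.+1 * x j.+1.
  rewrite expr2 mulr_suml mulr_suml; apply: eq_bigr => i _.
  rewrite mulr_sumr mulr_suml; apply: eq_bigr => j _.
  by rewrite (symA i.+1 0%N); ring.
have qq : quad_form n (schur A) (shift1 x) + b ^+ 2 / a =
    \sum_(i < n) \sum_(j < n) A i.+1 j.+1 * x i.+1 * x j.+1.
  rewrite bb -big_split /=; apply: eq_bigr => i _; rewrite -big_split /=.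
  by apply: eq_bigr => j _; rewrite /schur /shift1 -/a; ring.
rewrite qq /quad_form big_ord_recl.
have -> : \sum_(j < n.+1) A 0%N j * x 0%N * x j = a * x 0%N ^+ 2 + b * x 0%N.
  rewrite big_ord_recl -/a; congr (_ + _); first by ring.
  by rewrite /b mulr_suml; apply: eq_bigr => j _ /=; ring.
have -> : \sum_(i < n) \sum_(j < n.+1) A (lift ord0 i) j * x (lift ord0 i) * x j =
   b * x 0%N + \sum_(i < n) \sum_(j < n) A i.+1 j.+1 * x i.+1 * x j.+1.
  under eq_bigr do rewrite big_ord_recl.
  rewrite big_split /=; congr (_ + _).
  by rewrite /b mulr_suml; apply: eq_bigr => i _; rewrite symA.
by ring.
Qed.

(** Multiplication by the unipotent [B] subtracts multiples of column 0 and clears row 0 to the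
    right of its first entry. *)
Lemma det_schur n A : A 0%N 0%N != 0 ->
  \det (nat_mx n.+1 A) = A 0%N 0%N * \det (nat_mx n (schur A)).
Proof.
move=> a0; pose B : 'M[R]_(1 + n) := block_mx 1%:M (\row_j - (A 0%N j.+1 / A 0%N 0%N)) 0 1%:M.
have dB : \det B = 1 by rewrite det_ublock !det1 mulr1.
suff AB : (nat_mx n.+1 A : 'M[R]_(1 + n)) *m B =
    block_mx (A 0%N 0%N)%:M 0 (\col_i A i.+1 0%N) (nat_mx n (schur A)).
  by have := congr1 determinant AB; rewrite det_mulmx dB mulr1 det_lblock det_scalar expr1.
rewrite -(submxK (nat_mx n.+1 A : 'M[R]_(1 + n))) mulmx_block !mulmx1 !mulmx0 !addr0.
congr block_mx; apply/matrixP => i j; rewrite ?ord1 ?mxE //=.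
- by rewrite big_ord1 !mxE /= mulrN mulrCA divff// mulr1 addNr.
- by rewrite big_ord1 !mxE /= /schur mulrN mulrA addrC.
Qed.

Lemma measurable_quad_form n A :
  measurable_fun setT (fun t : n.-tuple R => quad_form n A (tfun t)).
Proof.
apply: measurable_fun_bigsum => i; apply: measurable_fun_bigsum => j.
by apply: measurable_funM; [apply: measurable_funM => //|]; exact: measurable_tfun.
Qed.

Theorem integral_gaussian n A : (forall i j, A i j = A j i) -> pos_def n A ->
  0 < \det (nat_mx n A) /\
  (\int[lam n]_t (expR (- (2^-1 * quad_form n A (tfun t))))%:E =
    (Num.sqrt (2 * pi) ^+ n / Num.sqrt (\det (nat_mx n A)))%:E)%E.
Proof.
have mg m B : measurable_fun setT
    (fun t : m.-tuple R => (expR (- (2^-1 * quad_form m B (tfun t))))%:E).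
  apply/measurable_EFinP; apply: measurable_fun_expR; apply: measurable_fun_opp.
  by apply: measurable_funM => //; exact: measurable_quad_form.
elim: n A => [|n IH] A symA posA.
  rewrite det_mx00; split=> //; rewrite integral_lebesgue_tuple0//.
  by rewrite /quad_form big_ord0 mulr0 oppr0 expR0 sqrtr1 divr1.
have a0 : 0 < A 0%N 0%N.
  have := posA (fun i => (i == 0)%N%:R); rewrite /quad_form => /(_ _)/wrap[].
    by exists 0%N => //=; exact: oner_neq0.
  rewrite big_ord_recl [X in _ + X]big1 => [|i _]; last first.
    by rewrite big1// => j _; rewrite mulr0 mul0r.
  rewrite addr0 big_ord_recl [X in _ + X]big1 => [|i _]; last by rewrite mulr0.
  by rewrite addr0 !mulr1.
have an0 : A 0%N 0%N != 0 by rewrite gt_eqF.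
have symS i j : schur A i j = schur A j i.
  rewrite /schur (symA i.+1 j.+1) (symA i.+1 0%N) (symA j.+1 0%N); ring.
have posS : pos_def n (schur A).
  move=> x [i ilt xi]; pose b := \sum_(j < n) A 0%N j.+1 * x j.
  (* The 0-th coordinate - b / a minimises the full form for given [x], and the minimum is the Schur
     form at [x]. *)
  have := posA (fun k => if k is k'.+1 then x k' else - (b / A 0%N 0%N)).
  move=> /(_ _)/wrap[]; first by exists i.+1.
  rewrite quad_form_cons//= -/b (_ : shift1 _ = x)//.
  set Q := quad_form n _ _; suff -> : forall a c : R, a != 0 ->
    a * (- (c / a)) ^+ 2 + 2 * c * - (c / a) + (Q + c ^+ 2 / a) = Q by [].
  by move=> a c ca0; field.
have [detS intS] := IH _ symS posS.
rewrite det_schur//; split; first exact: mulr_gt0.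
have slt := is_sfm_lebesgue_tuple R n.
rewrite (integral_lebesgue_tupleS (mg _ _)); last by move=> t; rewrite lee_fin expR_ge0.
pose g (p : R * n.-tuple R) :=
  (expR (- (2^-1 * quad_form n.+1 A (tfun [tuple of p.1 :: p.2]))))%:E.
have mgg : measurable_fun setT g.
  by apply: (measurableT_comp (mg _ _)); exact: measurable_cons.
have g0 p : (0 <= g p)%E by rewrite lee_fin expR_ge0.
transitivity (\int[lam n]_t \int[lebesgue_measure]_x g (x, t))%E.
  exact: (integral_exchange_sfm (is_sfm_lebesgue R) slt mgg g0).
pose h (t : n.-tuple R) := expR (- (2^-1 * quad_form n (schur A) (tfun t))).
transitivity (\int[lam n]_t ((Num.sqrt (2 * pi / A 0%N 0%N))%:E * (h t)%:E))%E.
  apply: eq_integralT => t.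
  pose b := \sum_(j < n) A 0%N j.+1 * tfun t j.
  pose q (x : R) := expR (- (2^-1 * (A 0%N 0%N * x ^+ 2)) - b * x).
  have mq : measurable_fun setT q.
    apply: measurable_fun_expR; apply: measurable_funB; last exact: measurable_funM.
    by apply: measurable_fun_opp; do 2 apply: measurable_funM => //; exact: measurable_funX.
  pose k := expR (- (2^-1 * (b ^+ 2 / A 0%N 0%N))).
  transitivity (\int[lebesgue_measure]_x ((h t * k)%:E * (q x)%:E))%E.
    apply: eq_integralT => x; rewrite -EFinM /h /k /q -!expRD; congr (expR _)%:E.
    rewrite /= quad_form_cons//.
    have -> : tfun [tuple of x :: t] 0 = x by [].
    have -> : shift1 (tfun [tuple of x :: t]) = tfun t by [].
    have -> : \sum_(j < n) A 0%N j.+1 * tfun [tuple of x :: t] j.+1 = b by [].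
    by field.
  rewrite ge0_integralZl//; last 3 first.
  - by apply/measurable_EFinP; exact: mq.
  - by move=> x _; rewrite lee_fin expR_ge0.
  - by rewrite lee_fin mulr_ge0 ?expR_ge0.
  rewrite integral_gauss_quad// -!EFinM; congr (_%:E).
  have kE : k * expR (2^-1 * (b ^+ 2 / A 0%N 0%N)) = 1 by rewrite /k -expRD addNr expR0.
  by rewrite mulrACA kE mulr1 mulrC.
have mh : measurable_fun setT (fun t => (h t)%:E) by exact: mg.
have h0 t : (0 <= (h t)%:E)%E by rewrite lee_fin expR_ge0.
rewrite (integralZl_sfm slt mh h0 (sqrtr_ge0 _)) intS -EFinM; congr (_%:E).
rewrite (sqrtrM (A 0%N 0%N)^-1); last by rewrite mulr_ge0// pi_ge0.
rewrite (sqrtrM (\det (nat_mx n (schur A))) (ltW a0)) (sqrtrV (ltW a0)) exprS invfM.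
by ring.
Qed.

End Gaussian.

(** * Weighted graphs *)

Section GraphSums.
Variable G : rooted_graph.
Local Notation V := (vertex G).
Local Notation r := (root_vertex G).
Local Notation n := #|nonroot G|.

Lemma card_nonroot : n = #|V|.-1.
Proof.
rewrite card_sub -(cardC1 r); apply: eq_card => v.
by rewrite !inE.
Qed.

Lemma big_nonroot (T : Type) (idx : T) (op : Monoid.com_law idx) (F : V -> T) :
  \big[op/idx]_(v | v != r) F v = \big[op/idx]_(i < n) F (nrv i).
Proof.
rewrite (reindex_omap (@nrv G) (fun v => [pick i | nrv i == v])) => [|v vr].
  apply: eq_bigl => i; rewrite nrv_neq_root /=.
  by case: pickP => [j /eqP/nrv_inj ->|/(_ i)]; rewrite eqxx.
have [i vi] := nrvP vr.
by case: pickP => [j /eqP <-//|/(_ i)]; rewrite vi eqxx.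
Qed.

Lemma big_vertex (T : Type) (idx : T) (op : Monoid.com_law idx) (F : V -> T) :
  \big[op/idx]_v F v = op (F r) (\big[op/idx]_(i < n) F (nrv i)).
Proof. by rewrite (bigD1 r)//= big_nonroot. Qed.

(** Over each edge lie exactly [a] and [rev_dedge a], distinct because an edge has two endpoints.
    The operation is arbitrary so that sums and products are both covered. *)
Lemma big_dedge (R : nzRingType) (idx : R) (op : Monoid.com_law idx) (F : V -> V -> R) :
  (forall i j, [set i; j]%SET \in edges G -> F i j = F j i) ->
  \big[op/idx]_(a : dedge G) F (src a) (tgt a) =
  \big[op/idx]_(e in edges G) op (at_edge F e) (at_edge F e).
Proof.
move=> symF.
rewrite (partition_big (@undirected G) (mem (edges G)))/=; last by move=> a _; exact: (valP a).
apply: eq_bigr => e eE.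
have /eqP/cards2P[x [y [xy exy]]] := edge_card2 eE.
have xyE : [set x; y]%SET \in edges G by rewrite -exy.
pose a : dedge G := exist (fun p : V * V => [set p.1; p.2]%SET \in edges G) (x, y) xyE.
have ab : a != rev_dedge a by apply: contraNneq xy => /(congr1 val) [] ->.
rewrite (bigD1 a)/=; last by rewrite exy.
rewrite (bigD1 (rev_dedge a))/=; last first.
  by rewrite exy /undirected finset.setUC eqxx eq_sym ab.
rewrite big1 => [|b /andP[/andP[/eqP be ba] bra]]; last first.
  case: (set2_eq (etrans be exy)) => -[sb tb].
    case/negP: ba; apply/eqP/val_inj; move: sb tb; rewrite /src /tgt /=.
    by case: (sval b) => p q /= -> ->.
  case/negP: bra; apply/eqP/val_inj; move: sb tb; rewrite /src /tgt /=.
  by case: (sval b) => p q /= -> ->.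
rewrite Monoid.mulm1 exy (at_edgeE (symF x y xyE)).
have -> : F (src a) (tgt a) = F x y by [].
by have -> : F (src (rev_dedge a)) (tgt (rev_dedge a)) = F x y by rewrite (symF x y xyE).
Qed.

Lemma big_dedge_pair (R : fieldType) (F : V -> V -> R) :
  \sum_(a : dedge G) F (src a) (tgt a) = \sum_x \sum_y adj_weight F x y.
Proof.
rewrite pair_big /= -big_mkcond /=.
rewrite [RHS](reindex_omap (@sval _ (fun p : V * V => [set p.1; p.2]%SET \in edges G)) insub)/=.
  by apply: eq_bigl => a; rewrite (valP a) valK eqxx.
by move=> p pE; rewrite insubT.
Qed.

Lemma sum_edges (R : realFieldType) (F : V -> V -> R) :
  (forall i j, [set i; j]%SET \in edges G -> F i j = F j i) ->
  \sum_(e in edges G) at_edge F e = 2^-1 * \sum_x \sum_y adj_weight F x y.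
Proof.
move=> symF; rewrite -big_dedge_pair (big_dedge _ symF) big_split /=.
by field.
Qed.

Lemma card_dedge : #|{: dedge G}| = (2 * #|edges G|)%N.
Proof.
(* [big_dedge] is about ring-valued functions, so the edges are counted in [int]. *)
have : \sum_(a : dedge G) (1 : int) = \sum_(e in edges G)
    (at_edge (fun _ _ => 1) e + at_edge (fun _ _ => 1) e).
  exact: (@big_dedge int 0 _ (fun _ _ => 1) (fun _ _ _ => erefl)).
rewrite sumr_const big_split /= (eq_bigr (fun=> 1)); last first.
  move=> e eE; have /eqP/cards2P[x [y [_ ->]]] := edge_card2 eE.
  exact: (@at_edgeE _ _ (fun _ _ => 1)).
rewrite sumr_const -mulrnDr addnn -mul2n => /eqP.
by rewrite eqr_nat => /eqP ->.
Qed.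

Section Laplacian.
Variables (R : realFieldType) (w : V -> V -> R).
Hypothesis symw : forall i j, [set i; j]%SET \in edges G -> w i j = w j i.

Lemma adj_sym x y : adj_weight w x y = adj_weight w y x.
Proof. by rewrite /adj_weight finset.setUC; case: ifP => // /symw. Qed.

(** As [s] vanishes at the root, the reduced form equals the sum of w_xy s_x (s_x - s_y) over all
    ordered pairs. Adding the same sum with x and y exchanged produces the squares. *)
Lemma laplacian_quad_form (s : V -> R) : s r = 0 ->
  \sum_(i < n) \sum_(j < n) reduced_laplacian w i j * s (nrv i) * s (nrv j) =
  \sum_(e in edges G) at_edge (fun i j => w i j * (s i - s j) ^+ 2) e.
Proof.
move=> sr; rewrite sum_edges; last first.
  by move=> i j ij; rewrite symw// -sqrrN opprB.
have E x y : adj_weight (fun i j => w i j * (s i - s j) ^+ 2) x y =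
    adj_weight w x y * (s x - s y) ^+ 2.
  by rewrite /adj_weight; case: ifP => //; rewrite mul0r.
under [in RHS]eq_bigr do under eq_bigr do rewrite E.
have -> : \sum_(i < n) \sum_(j < n) reduced_laplacian w i j * s (nrv i) * s (nrv j) =
   \sum_x \sum_y adj_weight w x y * (s x * (s x - s y)).
  rewrite big_vertex /= [X in X + _]big1 ?add0r; last by move=> y _; rewrite sr mul0r mulr0.
  apply: eq_bigr => i _.
  under eq_bigr do rewrite mxE !mulr_suml.
  rewrite exchange_big /=; apply: eq_bigr => v _.
  have sv : s v = \sum_(j < n) (v == nrv j)%:R * s (nrv j).
    have [->|/nrvP[k ->]] := eqVneq v r.
      by rewrite sr big1// => j _; rewrite eq_sym (negbTE (nrv_neq_root j)) mul0r.
    rewrite (bigD1 k)//= eqxx mul1r big1 ?addr0// => j jk.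
    by rewrite (inj_eq (@nrv_inj G)) eq_sym (negbTE jk) mul0r.
  have si : s (nrv i) = \sum_(j < n) (i == j)%:R * s (nrv j).
    rewrite (bigD1 i)//= eqxx mul1r big1 ?addr0// => j ji.
    by rewrite eq_sym (negbTE ji) mul0r.
  have -> : s (nrv i) - s v = \sum_(j < n) ((i == j)%:R - (v == nrv j)%:R) * s (nrv j).
    by rewrite si sv -sumrB; apply: eq_bigr => j _; rewrite mulrBl.
  by rewrite !mulr_sumr; apply: eq_bigr => j _; ring.
set S := \sum_x \sum_y adj_weight w x y * (s x * _).
have S' : S = \sum_x \sum_y adj_weight w x y * (s y * (s y - s x)).
  by rewrite /S exchange_big /=; apply: eq_bigr => x _; apply: eq_bigr => y _; rewrite adj_sym.
have SS : S + S = \sum_x \sum_y adj_weight w x y * (s x - s y) ^+ 2.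
  rewrite {2}S' -big_split; apply: eq_bigr => x _; rewrite -big_split.
  by apply: eq_bigr => y _ /=; ring.
by rewrite -SS; field.
Qed.

(** If the energy vanished, [s] would be constant along edges, hence by connectedness equal to its
    value 0 at the root. *)
Lemma laplacian_pos_def (s : V -> R) : (forall i j, [set i; j]%SET \in edges G -> 0 < w i j) ->
  s r = 0 -> (exists v, s v != 0) ->
  0 < \sum_(e in edges G) at_edge (fun i j => w i j * (s i - s j) ^+ 2) e.
Proof.
move=> w0 sr [v sv].
have symws i j : [set i; j]%SET \in edges G -> w i j * (s i - s j) ^+ 2 = w j i * (s j - s i) ^+ 2.
  by move=> ij; rewrite symw// -sqrrN opprB.
have ge0 e : e \in edges G -> 0 <= at_edge (fun i j => w i j * (s i - s j) ^+ 2) e.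
  move=> eE; have /eqP/cards2P[x [y [_ exy]]] := edge_card2 eE.
  rewrite exy in eE *; rewrite at_edgeE; last exact: symws.
  by rewrite mulr_ge0 ?sqr_ge0// ltW// w0.
rewrite lt_neqAle sumr_ge0// andbT eq_sym; apply: contra sv => sum0.
have seq x y : adj_rel (edges G) x y -> s x = s y.
  move=> xy; move: sum0; rewrite psumr_eq0// => /allP/(_ [set x; y]%SET).
  rewrite mem_index_enum => /(_ isT); rewrite -[_ \in _]/(adj_rel (edges G) x y) xy /=.
  rewrite at_edgeE; last exact: symws.
  rewrite mulf_eq0 gt_eqF ?w0//= sqrf_eq0 subr_eq0 => /eqP//.
have /connectP[p pp lp] := edges_connected v r.
elim: p v pp lp => [|y p IH] v /= => [_ <-|/andP[vy yp] lp]; first by rewrite sr.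
by rewrite (seq _ _ vy); exact: IH.
Qed.

End Laplacian.
End GraphSums.

Section NatFun.
Variables (R : realType) (n : nat).

(** Extension by 0 carries vertex data over to the sequences used in the elimination; symmetry and
    nonnegativity then hold at all indices. *)
Definition natfun (F : 'I_n -> R) (k : nat) : R := if insub k is Some i then F i else 0.

Lemma natfunE F (i : 'I_n) : natfun F i = F i.
Proof. by rewrite /natfun valK. Qed.

Lemma natfun_ge0 F k : (forall i, 0 <= F i) -> 0 <= natfun F k.
Proof. by move=> F0; rewrite /natfun; case: insubP. Qed.

Definition natfun2 (F : 'I_n -> 'I_n -> R) (k l : nat) : R :=
  natfun (fun i => natfun (F i) l) k.

Lemma natfun2E F (i j : 'I_n) : natfun2 F i j = F i j.
Proof. by rewrite /natfun2 !natfunE. Qed.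

Lemma natfun2_ge0 F k l : (forall i j, 0 <= F i j) -> 0 <= natfun2 F k l.
Proof. by move=> F0; do 2 apply: natfun_ge0 => ?. Qed.

Lemma natfun2_sym F : (forall i j, F i j = F j i) ->
  forall k l, natfun2 F k l = natfun2 F l k.
Proof.
move=> symF k l; rewrite /natfun2 /natfun.
by case: (insub k) => [i|]; case: (insub l).
Qed.

Lemma nat_mx_natfun2 (M : 'M[R]_n) : nat_mx n (natfun2 M) = M.
Proof. by apply/matrixP => i j; rewrite mxE natfun2E. Qed.

Lemma integral_gaussian_mx (M : 'M[R]_n) : (forall i j, M i j = M j i) ->
  (forall x : 'I_n -> R, (exists i, x i != 0) ->
    0 < \sum_(i < n) \sum_(j < n) M i j * x i * x j) ->
  0 < \det M /\
  (\int[@lebesgue_tuple R n]_t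
     (expR (- (2^-1 * \sum_(i < n) \sum_(j < n) M i j * tfun t i * tfun t j)))%:E =
    (Num.sqrt (2 * pi) ^+ n / Num.sqrt (\det M))%:E)%E.
Proof.
move=> symM posM.
have qE x : quad_form n (natfun2 M) x = \sum_(i < n) \sum_(j < n) M i j * x i * x j.
  by apply: eq_bigr => i _; apply: eq_bigr => j _; rewrite natfun2E.
have posN : pos_def n (natfun2 M).
  move=> x [i ilt xi]; rewrite qE; apply: (posM (fun i => x i)).
  by exists (Ordinal ilt).
have [d0 dI] := integral_gaussian (natfun2_sym symM) posN.
rewrite nat_mx_natfun2 in d0 dI; split=> //; rewrite -dI.
by apply: eq_integralT => t; rewrite qE.
Qed.

End NatFun.

Section AtEdge.
Variables (V : finType) (R : realType).

Lemma measurable_at_edge d (T : measurableType d) (f : V -> V -> T -> R) (e : {set V}) :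
  (forall i j, measurable_fun setT (f i j)) ->
  measurable_fun setT (fun x => at_edge (fun i j => f i j x) e).
Proof. by move=> mf; rewrite /at_edge; case: pickP => [[i j] _|_] //; exact: mf. Qed.

Lemma at_edgeB (f g : V -> V -> R) e :
  at_edge (fun i j => f i j - g i j) e = at_edge f e - at_edge g e.
Proof. by rewrite /at_edge; case: pickP => // _; rewrite subrr. Qed.

Lemma at_edgeZ k (f : V -> V -> R) e :
  at_edge (fun i j => k * f i j) e = k * at_edge f e.
Proof. by rewrite /at_edge; case: pickP => // _; rewrite mulr0. Qed.

Lemma eq_at_edge (f g : V -> V -> R) e :
  (forall i j, f i j = g i j) -> at_edge f e = at_edge g e.
Proof. by move=> fg; rewrite /at_edge; case: pickP. Qed.

End AtEdge.

(** * The susy density in terms of the Laplacian with conductances W_ij exp(u_i + u_j) *)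

Section Susy.
Variables (R : realType) (G : rooted_graph) (W : vertex G -> vertex G -> R).
Hypothesis hW : forall i j, [set i; j]%SET \in edges G -> W i j = W j i /\ 0 < W i j.
Local Notation V := (vertex G).
Local Notation r := (root_vertex G).
Local Notation n := #|nonroot G|.
Local Notation U t := (pin (Rn_of_tuple t) : pinned R G).

Definition conductance (u : pinned R G) (i j : V) : R := W i j * expR (u i + u j).

Lemma symW i j : [set i; j]%SET \in edges G -> W i j = W j i.
Proof. by move=> /hW[]. Qed.

Lemma conductance_sym u i j : [set i; j]%SET \in edges G ->
  conductance u i j = conductance u j i.
Proof. by move=> /symW ij; rewrite /conductance ij addrC. Qed.

Lemma conductance_gt0 u i j : [set i; j]%SET \in edges G -> 0 < conductance u i j.
Proof. by move=> /hW[_ w0]; rewrite mulr_gt0// expR_gt0. Qed.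

Lemma pin_tuple (t : n.-tuple R) (i : 'I_n) : U t (nrv i) = tfun t i.
Proof. by rewrite /nrv pinE ffunE enum_valK (tnth_nth 0). Qed.

Lemma pinned_root (u : pinned R G) : u r = 0.
Proof. exact/eqP/(valP u). Qed.

Definition dirichlet (u s : pinned R G) : R :=
  \sum_(e in edges G) at_edge (fun i j => conductance u i j * (s i - s j) ^+ 2) e.

Lemma measurable_dirichlet d (T : measurableType d) (u s : T -> pinned R G) :
  measurable_fun setT u -> measurable_fun setT s ->
  measurable_fun setT (fun x => dirichlet (u x) (s x)).
Proof.
move=> mu ms; apply: measurable_fun_bigsum => e; apply: measurable_at_edge => i j.
have mc (v : T -> pinned R G) k : measurable_fun setT v -> measurable_fun setT (fun x => v x k).
  by move=> mv; apply: (measurableT_comp (measurable_pinned_coord k)).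
apply: measurable_funM.
  apply: measurable_funM => //; apply: measurable_fun_expR.
  by apply: measurable_funD; exact: mc.
by apply: measurable_funX; apply: measurable_funB; exact: mc.
Qed.

Lemma reduced_laplacianE (w : V -> V -> R) i j : reduced_laplacian w i j =
  (i == j)%:R * \sum_v adj_weight w (nrv i) v - adj_weight w (nrv i) (nrv j).
Proof.
rewrite mxE; under eq_bigr do rewrite mulrBr mulrC.
rewrite sumrB -mulr_sumr; congr (_ - _).
rewrite (bigD1 (nrv j))//= eqxx mulr1 big1 ?addr0// => v vj.
by rewrite (negbTE vj) mulr0.
Qed.

Lemma integral_dirichlet (u : pinned R G) :
  0 < \det (reduced_laplacian (conductance u)) /\
  (\int[lebesgue_pinned R G]_s (expR (- (2^-1 * dirichlet u s)))%:E =
   (Num.sqrt (2 * pi) ^+ n / Num.sqrt (\det (reduced_laplacian (conductance u))))%:E)%E.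
Proof.
have sL i j : reduced_laplacian (conductance u) i j = reduced_laplacian (conductance u) j i.
  rewrite !reduced_laplacianE (adj_sym (@conductance_sym u) (nrv i)).
  by have [->|] := eqVneq i j; rewrite ?mul0r.
have [|d0 dI] := integral_gaussian_mx sL.
  move=> x [i xi].
  pose t : n.-tuple R := [tuple x i | i < n].
  have tx (k : 'I_n) : tfun t k = x k by rewrite /tfun -tnth_nth tnth_mktuple.
  have := laplacian_pos_def (@conductance_sym u) (@conductance_gt0 u) (pinned_root (U t)).
  move=> /(_ _)/wrap[]; first by exists (nrv i); rewrite pin_tuple tx.
  rewrite -(laplacian_quad_form (@conductance_sym u) (pinned_root (U t))).
  by under eq_bigr do under eq_bigr do rewrite !pin_tuple !tx.
split=> //; rewrite integral_lebesgue_pinned.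
- rewrite -dI; apply: eq_integralT => t; rewrite /dirichlet.
  rewrite -(laplacian_quad_form (@conductance_sym u) (pinned_root (U t))).
  by under eq_bigr do under eq_bigr do rewrite !pin_tuple.
- apply/measurable_EFinP; apply: measurable_fun_expR; apply: measurable_fun_opp.
  by apply: measurable_funM => //; exact: measurable_dirichlet.
- by move=> s; rewrite lee_fin expR_ge0.
Qed.

Definition bond_energy (u : pinned R G) : R :=
  \sum_(e in edges G) at_edge (fun i j => W i j * (1 - cosh (u i - u j))) e.

Lemma susy_weightE (s u : pinned R G) :
  susy_weight W s u = expR (bond_energy u) * expR (- (2^-1 * dirichlet u s)).
Proof.
rewrite /susy_weight -expRD /bond_energy /dirichlet mulr_sumr -sumrB.
congr expR; apply: eq_bigr => e _; rewrite -at_edgeZ -at_edgeB.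
by apply: eq_at_edge => i j; rewrite /conductance; ring.
Qed.

Definition coupling : nat -> nat -> R :=
  natfun2 (fun i j : 'I_n => adj_weight W (nrv i) (nrv j)).

Definition root_coupling : nat -> R := natfun (fun i : 'I_n => adj_weight W (nrv i) r).

Lemma adj_weightW_sym x y : adj_weight W x y = adj_weight W y x.
Proof. exact: adj_sym symW _ _. Qed.

Lemma adj_weightW_ge0 x y : 0 <= adj_weight W x y.
Proof. by rewrite /adj_weight; case: ifP => // /hW[_ /ltW]. Qed.

Lemma edge_irrefl x : [set x; x]%SET \notin edges G.
Proof. by apply/negP => /edge_card2; rewrite finset.setUid cards1. Qed.

(** A set of non-root vertices with no coupling to the outside would be closed under adjacency, so a
    path to the root would put the root into it. *)
Lemma coupling_connected : pinned_connected n coupling root_coupling.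
Proof.
move=> S [i0 i0n Si0].
pose P (x : V) := [exists i : 'I_n, (x == nrv i) && S i].
have Pn (i : 'I_n) : P (nrv i) = S i.
  apply/existsP/idP => [[j /andP[/eqP/nrv_inj ->]]//|Si]; exists i.
  by rewrite eqxx.
have Pr : P r = false.
  by apply/negbTE/existsPn => i; rewrite eq_sym (negbTE (nrv_neq_root i)).
apply: contrapT => H.
have cl x y : adj_rel (edges G) x y -> P x -> P y.
  move=> xy Px; apply: contraT => nPy; exfalso; apply: H.
  have /existsP[i /andP[/eqP xi Si]] := Px.
  exists i; split=> //.
  have wxy : 0 < adj_weight W x y.
    by rewrite /adj_weight; rewrite /adj_rel in xy; rewrite xy; have [] := hW xy.
  have [yr|/nrvP[j yj]] := eqVneq y r.
    by left; rewrite /root_coupling natfunE -xi -yr.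
  right; exists j; split=> //; first by rewrite -Pn -yj.
  by rewrite /coupling natfun2E -xi -yj.
have /connectP[p pp lp] := edges_connected (nrv (Ordinal i0n)) r.
have : P (nrv (Ordinal i0n)) by rewrite Pn.
elim: p (nrv _) pp lp => [|y p IH] x /= => [_ <-|/andP[xy yp] lp Px]; first by rewrite Pr.
exact: IH (cl _ _ xy Px).
Qed.

Section DensityTuple.
Variable t : n.-tuple R.
Local Notation u := (U t).

Lemma site_potential_graph (i : 'I_n) :
  site_potential n coupling root_coupling (tfun t) i =
  \sum_v adj_weight W (nrv i) v * expR (u v - u (nrv i)).
Proof.
rewrite /site_potential big_vertex /= pinned_root sub0r pin_tuple mulrDr [LHS]addrC; congr (_ + _).
  by rewrite /root_coupling natfunE mulrC.
rewrite mulr_sumr; apply: eq_bigr => j _.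
by rewrite /coupling natfun2E pin_tuple expRD; ring.
Qed.

(** The link between trees and the Schrodinger operator: conjugation by exp u turns the site
    potential into the total conductance at a vertex and each [W i j] into the conductance of its
    edge. *)
Lemma laplacian_schrodinger : reduced_laplacian (conductance u) =
  diag_mx (\row_i expR (tfun t i)) *m
  schrodinger_mx n coupling (site_potential n coupling root_coupling (tfun t)) *m
  diag_mx (\row_i expR (tfun t i)).
Proof.
apply/matrixP => i j; rewrite reduced_laplacianE mul_mx_diag mul_diag_mx !mxE.
rewrite site_potential_graph /coupling natfun2E.
have adjE x y : adj_weight (conductance u) x y = adj_weight W x y * expR (u x + u y).
  by rewrite /adj_weight; case: ifP => //; rewrite mul0r.
under eq_bigr do rewrite adjE.
rewrite adjE !pin_tuple.
have [<-|ij] := eqVneq i j; last by rewrite !mul0r !sub0r expRD; ring.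
rewrite !mul1r mulrBr mulrBl; congr (_ - _); last by rewrite expRD; ring.
rewrite mulr_sumr mulr_suml; apply: eq_bigr => v _.
have := expRxMexpNx_1 (tfun t i).
rewrite !expRD; set e := expR (tfun t i); set e' := expR (- _) => ee.
move: ee; set a := adj_weight _ _ _; set b := expR _ => ee.
by rewrite -[LHS]mulr1 -{1}ee; ring.
Qed.

(** The product of exponentials is what cancels the factor prod exp(-u_i) of the density. *)
Lemma sqrt_det_laplacian : Num.sqrt (\det (reduced_laplacian (conductance u))) =
  (\prod_(i < n) expR (tfun t i)) *
  Num.sqrt (\det (schrodinger_mx n coupling
    (site_potential n coupling root_coupling (tfun t)))).
Proof.
rewrite laplacian_schrodinger !det_mulmx det_diag.
under eq_bigr do rewrite mxE.
set P := \prod_(i < n) _; have P0 : 0 <= P by apply: prodr_ge0 => i _; exact: expR_ge0.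
by rewrite mulrAC -expr2 sqrtrM ?sqr_ge0// sqrtr_sqr ger0_norm.
Qed.

(** Since cosh is even, the energy is half the sum over ordered pairs (x, y) of W_xy (1 - exp(u_y -
    u_x)). Grouping the exponentials by x gives the site potential at a non-root x and the sum of
    eta_i exp(u_i) at the root. *)
Lemma bond_energy_graph : bond_energy u =
  - (2^-1 * (\sum_(i < n) site_potential n coupling root_coupling (tfun t) i +
     \sum_(i < n) root_coupling i * expR (tfun t i))) + total_weight n coupling root_coupling.
Proof.
have rr : adj_weight W r r = 0 by rewrite /adj_weight (negbTE (edge_irrefl r)).
have expE x y : expR (u x - u y) = expR (u x) * expR (- u y) by rewrite expRD.
rewrite /bond_energy sum_edges; last first.
  move=> i j ij; rewrite (symW ij) /cosh !opprB.
  by rewrite [expR (u i - u j) + _]addrC.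
have E x y : adj_weight (fun i j => W i j * (1 - cosh (u i - u j))) x y =
    adj_weight W x y - 2^-1 * (adj_weight W x y * expR (u x - u y)) -
    2^-1 * (adj_weight W x y * expR (u y - u x)).
  rewrite /adj_weight; case: ifP => [_|]; last by rewrite !mul0r mulr0 !subr0.
  by rewrite /cosh opprB; field.
under eq_bigr do under eq_bigr do rewrite E.
pose S := \sum_x \sum_y adj_weight W x y.
pose C := \sum_x \sum_y adj_weight W x y * expR (u y - u x).
have C' : \sum_x \sum_y adj_weight W x y * expR (u x - u y) = C.
  rewrite exchange_big /=; apply: eq_bigr => x _; apply: eq_bigr => y _.
  by rewrite adj_weightW_sym.
have -> : \sum_x \sum_y (adj_weight W x y - 2^-1 * (adj_weight W x y * expR (u x - u y)) -
    2^-1 * (adj_weight W x y * expR (u y - u x))) = S - C.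
  transitivity (S - 2^-1 * C - 2^-1 * C); last by field.
  rewrite -{1}C' /S /C !mulr_sumr -!sumrB; apply: eq_bigr => x _.
  by rewrite !mulr_sumr -!sumrB; apply: eq_bigr => y _.
have SE : 2^-1 * S = total_weight n coupling root_coupling.
  rewrite /S big_vertex /= big_vertex /= rr add0r.
  under [X in _ + X]eq_bigr do rewrite big_vertex /=.
  rewrite big_split /= /total_weight.
  have -> : \sum_(i < n) adj_weight W r (nrv i) = \sum_(i < n) root_coupling i.
    by apply: eq_bigr => i _; rewrite /root_coupling natfunE adj_weightW_sym.
  have -> : \sum_(i < n) adj_weight W (nrv i) r = \sum_(i < n) root_coupling i.
    by apply: eq_bigr => i _; rewrite /root_coupling natfunE.
  have -> : \sum_(i < n) \sum_(j < n) adj_weight W (nrv i) (nrv j) =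
      \sum_(i < n) \sum_(j < n) coupling i j.
    by apply: eq_bigr => i _; apply: eq_bigr => j _; rewrite /coupling natfun2E.
  by field.
have CE : C = \sum_(i < n) site_potential n coupling root_coupling (tfun t) i +
    \sum_(i < n) root_coupling i * expR (tfun t i).
  rewrite /C big_vertex /= addrC; congr (_ + _).
    by apply: eq_bigr => i _; rewrite site_potential_graph.
  rewrite big_vertex /= rr mul0r add0r; apply: eq_bigr => i _.
  by rewrite /root_coupling natfunE adj_weightW_sym pinned_root subr0 pin_tuple.
by rewrite -CE -SE; ring.
Qed.

Lemma field_density_graph : field_density n coupling root_coupling (tfun t) =
  expR (bond_energy u) * Num.sqrt (\det (reduced_laplacian (conductance u))) *
  \prod_(i | i != r) expR (- u i).
Proof.
rewrite /field_density -bond_energy_graph sqrt_det_laplacian big_nonroot.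
set Q := Num.sqrt _.
have -> : \prod_(i < n) expR (- u (nrv i)) = \prod_(i < n) expR (- tfun t i).
  by apply: eq_bigr => i _; rewrite pin_tuple.
have PP : (\prod_(i < n) expR (tfun t i)) * \prod_(i < n) expR (- tfun t i) = 1.
  by rewrite -big_split big1// => i _ /=; rewrite -expRD subrr expR0.
move: PP; set P := \prod_(i < n) _; set P' := \prod_(i < n) _ => PP.
have -> a : a * (P * Q) * P' = a * Q * (P * P') by ring.
by rewrite PP mulr1.
Qed.

End DensityTuple.

Lemma measurable_conductance d (T : measurableType d) (u : T -> pinned R G) i j :
  measurable_fun setT u -> measurable_fun setT (fun x => conductance (u x) i j).
Proof.
move=> mu; have mc k : measurable_fun setT (fun x => u x k).
  by apply: (measurableT_comp (measurable_pinned_coord k)).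
by apply: measurable_funM => //; apply: measurable_fun_expR; exact: measurable_funD.
Qed.

Lemma measurable_bond_energy d (T : measurableType d) (u : T -> pinned R G) :
  measurable_fun setT u -> measurable_fun setT (fun x => bond_energy (u x)).
Proof.
move=> mu; have mc k : measurable_fun setT (fun x => u x k).
  by apply: (measurableT_comp (measurable_pinned_coord k)).
apply: measurable_fun_bigsum => e; apply: measurable_at_edge => i j.
apply: measurable_funM => //; apply: measurable_funB => //; apply: measurable_funM => //.
apply: measurable_funD; apply: measurable_fun_expR; last apply: measurable_fun_opp.
  exact: measurable_funB.
exact: measurable_funB.
Qed.

Lemma measurable_det_laplacian d (T : measurableType d) (u : T -> pinned R G) :
  measurable_fun setT u ->
  measurable_fun setT (fun x => \det (reduced_laplacian (conductance (u x)))).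
Proof.
move=> mu; apply: measurable_fun_det => i j; apply: measurable_fun_bigsum => v.
apply: measurable_funM => //; rewrite /adj_weight; case: (_ \in _) => //.
exact: measurable_conductance.
Qed.

Lemma measurable_prod_expRN d (T : measurableType d) (u : T -> pinned R G) :
  measurable_fun setT u ->
  measurable_fun setT (fun x => \prod_(i | i != r) expR (- u x i)).
Proof.
move=> mu; apply: measurable_fun_bigprod => i; apply: measurable_fun_expR.
by apply: measurable_fun_opp; apply: (measurableT_comp (measurable_pinned_coord i)).
Qed.

Theorem integral_susy_u :
  (\int[lebesgue_pinned R G]_u (expR (bond_energy u) *
     Num.sqrt (\det (reduced_laplacian (conductance u))) *
     \prod_(i | i != r) expR (- fun_of_pinned u i))%:E = (Num.sqrt (2 * pi) ^+ n)%:E)%E.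
Proof.
rewrite integral_lebesgue_pinned.
- under eq_integralT do rewrite -field_density_graph.
  apply: integral_field_density.
  + by apply: natfun2_sym => i j; exact: adj_weightW_sym.
  + by move=> i j; apply: natfun2_ge0 => ? ?; exact: adj_weightW_ge0.
  + by move=> i; apply: natfun_ge0 => ?; exact: adj_weightW_ge0.
  + exact: coupling_connected.
- apply/measurable_EFinP; apply: measurable_funM; last exact: measurable_prod_expRN.
  apply: measurable_funM; last by apply: measurable_fun_sqrt; exact: measurable_det_laplacian.
  by apply: measurable_fun_expR; exact: measurable_bond_energy.
- move=> u; rewrite lee_fin !mulr_ge0 ?expR_ge0 ?sqrtr_ge0//.
  by apply: prodr_ge0 => i _; exact: expR_ge0.
Qed.

End Susy.

(** * Flows *)

Lemma mul_diag_trE (R : comNzRingType) p q (A B : 'M[R]_(p, q)) (d : 'rV[R]_q) i j :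
  (A *m diag_mx d *m B^T) i j = \sum_k A i k * d 0 k * B j k.
Proof. by rewrite mxE; apply: eq_bigr => k _; rewrite mul_mx_diag !mxE. Qed.

Section Flows.
Variables (R : realType) (G : rooted_graph) (T0 : {set dedge G}).
Hypothesis hT0 : directed_spanning_tree T0.
Local Notation V := (vertex G).
Local Notation r := (root_vertex G).
Local Notation n := #|nonroot G|.
Local Notation m := #|off_tree T0|.

Definition incidence (v : V) (a : dedge G) : R := (src a == v)%:R - (tgt a == v)%:R.

Lemma rev_dedgeK : involutive (@rev_dedge G).
Proof. by move=> a; apply: val_inj; rewrite /= [RHS]surjective_pairing. Qed.

(** Reversal exchanges source and target, so the incoming part of the divergence can be reindexed by
    the edges ending at [v]. *)
Lemma divergence_incidence (k : dedge G -> R) v :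
  \sum_(a | src a == v) (k a - k (rev_dedge a)) = \sum_a incidence v a * k a.
Proof.
rewrite sumrB [X in _ - X](reindex_inj (inv_inj rev_dedgeK)) /=.
under [X in _ - X]eq_bigr do rewrite rev_dedgeK.
rewrite big_mkcond [X in _ - X]big_mkcond -sumrB; apply: eq_bigr => a _.
rewrite /incidence -[src (rev_dedge a)]/(tgt a).
by case: (src a == v); case: (tgt a == v); rewrite /= ?subrr ?subr0 ?sub0r ?mul0r ?mul1r ?mulN1r.
Qed.

Lemma incidence_sum0 a : \sum_v incidence v a = 0.
Proof.
have one x : \sum_v (x == v)%:R = 1 :> R.
  by rewrite (bigD1 x)//= eqxx big1 ?addr0// => v vx; rewrite eq_sym (negbTE vx).
by rewrite sumrB !one subrr.
Qed.

Definition tree_parent : {ffun 'I_n -> V} := s2val (cid2 (spanning_tree_forest hT0.1)).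

Lemma rooting_tree_parent : rooting tree_parent.
Proof. exact: (s2valP (cid2 (spanning_tree_forest hT0.1))). Qed.

Lemma forest_tree_parent : forest_edges tree_parent = (@undirected G @: T0)%SET.
Proof. exact: (s2valP' (cid2 (spanning_tree_forest hT0.1))). Qed.

Local Notation f := tree_parent.

Lemma tree_dedge_ex (i : 'I_n) :
  exists a, (a \in T0) && (undirected a == [set nrv i; f i]%SET).
Proof.
have : [set nrv i; f i]%SET \in (@undirected G @: T0)%SET.
  by rewrite -forest_tree_parent; apply/imsetP; exists i.
by move=> /imsetP[a aT e]; exists a; rewrite aT e eqxx.
Qed.

Definition tree_dedge (i : 'I_n) : dedge G := xchoose (tree_dedge_ex i).

Lemma tree_dedge_in i : tree_dedge i \in T0.
Proof. by have /andP[] := xchooseP (tree_dedge_ex i). Qed.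

Lemma undirected_tree_dedge i : undirected (tree_dedge i) = [set nrv i; f i]%SET.
Proof. by have /andP[_ /eqP] := xchooseP (tree_dedge_ex i). Qed.

Lemma undirected_inj_tree a b : a \in T0 -> b \in T0 -> undirected a = undirected b -> a = b.
Proof.
move=> aT bT /set2_eq[[e1 e2]|[e1 e2]].
  by apply: val_inj; rewrite [LHS]surjective_pairing [RHS]surjective_pairing; congr pair.
have ab : a = rev_dedge b.
  by apply: val_inj; rewrite [LHS]surjective_pairing; congr pair.
by have := hT0.2 b bT; rewrite -ab aT.
Qed.

Lemma tree_dedge_inj : injective tree_dedge.
Proof.
move=> i j e; apply: (forest_edge_inj rooting_tree_parent).
by rewrite -!undirected_tree_dedge e.
Qed.

Lemma tree_dedgeP a : a \in T0 -> exists i, a = tree_dedge i.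
Proof.
move=> aT; have : undirected a \in (@undirected G @: T0)%SET by apply/imsetP; exists a.
rewrite -forest_tree_parent => /imsetP[i _ e]; exists i.
by apply: undirected_inj_tree => //; [exact: tree_dedge_in|rewrite undirected_tree_dedge].
Qed.

Definition off_dedge (j : 'I_m) : dedge G := val (enum_val j).

Lemma big_dedge_tree (T : Type) (idx : T) (op : Monoid.com_law idx) (F : dedge G -> T) :
  \big[op/idx]_a F a =
  op (\big[op/idx]_(i < n) F (tree_dedge i)) (\big[op/idx]_(j < m) F (off_dedge j)).
Proof.
rewrite (bigID (mem T0)) /=; congr (op _ _).
  rewrite (reindex_omap tree_dedge (fun a => [pick i | tree_dedge i == a])) => [|a aT].
    apply: eq_bigl => i; rewrite tree_dedge_in /=.
    by case: pickP => [j /eqP/tree_dedge_inj ->|/(_ i)]; rewrite eqxx.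
  have [i ai] := tree_dedgeP aT.
  by case: pickP => [j /eqP <-//|/(_ i)]; rewrite ai eqxx.
rewrite (reindex_omap (@sval _ (fun a => a \notin T0)) insub)/=; last first.
  by move=> p pE; rewrite insubT.
rewrite (eq_bigl xpredT); last by move=> a; rewrite (valP a) valK eqxx.
rewrite (reindex (@enum_val _ (off_tree T0)))//=.
by exists enum_rank => x _; rewrite ?enum_valK ?enum_rankK.
Qed.

Definition tree_incidence : 'M[R]_n := \matrix_(i, k) incidence (nrv i) (tree_dedge k).

(** Up to the sign of each column, which records whether the tree edge points towards the root, this
    is the transpose of [forest_mx]. Hence solving for the flow on the tree introduces no
    determinant factor. *)
Lemma det_tree_incidence_sq : \det tree_incidence ^+ 2 = 1.
Proof.
pose e : 'rV[R]_n := \row_k (if src (tree_dedge k) == nrv k then 1 else -1).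
have -> : tree_incidence = (forest_mx R f)^T *m diag_mx e.
  apply/matrixP => i k; rewrite mul_mx_diag !mxE /incidence.
  have rf := rooting_tree_parent.
  have fk : f k != nrv k by rewrite -climb_nrv; apply: climb_neq => //; exact: nrv_neq_root.
  rewrite -(inj_eq (@nrv_inj G)).
  have : undirected (tree_dedge k) = [set nrv k; f k]%SET by exact: undirected_tree_dedge.
  case/set2_eq => -[-> ->]; first by rewrite eqxx mulr1.
  by rewrite (negbTE fk) mulrN1 opprB.
rewrite det_mulmx det_tr (det_forest_mx _ rooting_tree_parent) mul1r det_diag -prodrXl.
by apply: big1 => k _; rewrite mxE; case: ifP => _; rewrite ?expr1n ?sqrrN ?expr1n.
Qed.

Lemma tree_incidence_unit : tree_incidence \in unitmx.
Proof.
rewrite unitmxE unitfE; apply/eqP => d0; have := det_tree_incidence_sq.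
by rewrite d0 expr0n /= => /eqP; rewrite eq_sym oner_eq0.
Qed.

Definition off_incidence : 'M[R]_(n, m) := \matrix_(i, j) incidence (nrv i) (off_dedge j).

(** Kirchhoff's law solved for the tree edges: it gives their flow as a linear function of the flow
    off the tree. *)
Definition tree_coef : 'M[R]_(n, m) := - (invmx tree_incidence *m off_incidence).

Lemma incidence_tree_coef : tree_incidence *m tree_coef = - off_incidence.
Proof. by rewrite mulmxN mulmxA mulmxV ?mul1mx// tree_incidence_unit. Qed.

(** The incidences of a directed edge sum to zero over all vertices, so the equation at the root is
    minus the sum of the others. *)
Lemma divergence_freeP (k : {ffun dedge G -> R}) : reflect
  (tree_incidence *m (\col_i k (tree_dedge i)) + off_incidence *m (\col_j k (off_dedge j)) = 0)
  (divergence_free k).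
Proof.
have E i : (tree_incidence *m (\col_i k (tree_dedge i)) +
    off_incidence *m (\col_j k (off_dedge j))) i 0 = \sum_a incidence (nrv i) a * k a.
  rewrite big_dedge_tree !mxE /=; congr (_ + _); by apply: eq_bigr => j _; rewrite !mxE.
apply: (iffP forallP) => [df|e v].
  apply/colP => i; rewrite E mxE -divergence_incidence.
  exact/eqP/df.
have nr v' : v' != r -> \sum_a incidence v' a * k a = 0.
  by move=> /nrvP[i ->]; rewrite -E e mxE.
rewrite divergence_incidence; have [->|/nr ->//] := eqVneq v r.
have : \sum_v' \sum_a incidence v' a * k a = 0.
  rewrite exchange_big big1// => a _; rewrite -mulr_suml incidence_sum0 mul0r.
  by [].
by rewrite (bigD1 r)//= [X in _ + X]big1 ?addr0// => /eqP.
Qed.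

Definition flow_vec (y : Rn R (off_tree T0)) : {ffun dedge G -> R} :=
  [ffun a => if insub a is Some b then y b
    else if [pick i | tree_dedge i == a] is Some i then
      (tree_coef *m (\col_j y (enum_val j))) i 0 else 0].

Lemma flow_vec_off y j : flow_vec y (off_dedge j) = y (enum_val j).
Proof. by rewrite ffunE /off_dedge valK. Qed.

Lemma flow_vec_tree y i : flow_vec y (tree_dedge i) = (tree_coef *m (\col_j y (enum_val j))) i 0.
Proof.
rewrite ffunE insubN ?tree_dedge_in//.
by case: pickP => [j /eqP/tree_dedge_inj ->|/(_ i)]; rewrite ?eqxx.
Qed.

Lemma flow_vec_divergence_free y : divergence_free (flow_vec y).
Proof.
apply/divergence_freeP.
have -> : \col_i flow_vec y (tree_dedge i) = tree_coef *m (\col_j y (enum_val j)).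
  by apply/colP => i; rewrite mxE flow_vec_tree.
have -> : \col_j flow_vec y (off_dedge j) = \col_j y (enum_val j).
  by apply/colP => j; rewrite !mxE flow_vec_off.
by rewrite mulmxA incidence_tree_coef mulNmx addNr.
Qed.

(** [flow_extend] is defined by choice; [flow_vec] provides a preimage, which makes the chosen flow
    a genuine one. *)
Lemma flow_extendK (y : Rn R (off_tree T0)) : flow_restr T0 (flow_extend y) = y.
Proof.
apply: (@getPex _ [set k : flow R G | flow_restr T0 k = y]).
exists (exist (fun k => is_true (divergence_free k)) _ (flow_vec_divergence_free y)).
apply/ffunP => b.
by rewrite ffunE /fun_of_flow /= -[b in LHS](enum_rankK b) flow_vec_off enum_rankK.
Qed.

Lemma flow_extend_off (y : Rn R (off_tree T0)) j : flow_extend y (off_dedge j) = y (enum_val j).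
Proof. by rewrite -[in RHS](flow_extendK y) ffunE. Qed.

(** Whichever preimage was chosen, its values on the tree are forced, because the tree incidence
    matrix is invertible. *)
Lemma flow_extend_tree (y : Rn R (off_tree T0)) i :
  flow_extend y (tree_dedge i) = \sum_(j < m) tree_coef i j * y (enum_val j).
Proof.
have /divergence_freeP := valP (flow_extend y).
have -> : \col_j (val (flow_extend y)) (off_dedge j) = \col_j y (enum_val j).
  by apply/colP => j; rewrite !mxE -flow_extend_off.
set c := \col_i _ => e.
have ce : c = tree_coef *m (\col_j y (enum_val j)).
  rewrite /tree_coef mulNmx -mulmxA -mulmxN.
  apply: (canRL (mulKmx tree_incidence_unit)).
  by apply/eqP; rewrite -addr_eq0; apply/eqP.
transitivity (c i 0); first by rewrite mxE.
by rewrite ce mxE; apply: eq_bigr => j _; rewrite [X in _ * X]mxE.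
Qed.

Lemma measurable_flow_extend : measurable_fun setT (@flow_extend R G T0).
Proof.
apply: measurable_flowP => a; have [/tree_dedgeP[i ->]|aT] := boolP (a \in T0).
  apply: (eq_measurable_fun (fun y : Rn R (off_tree T0) =>
      \sum_(j < m) tree_coef i j * y (enum_val j))).
    by move=> y _; rewrite flow_extend_tree.
  by apply: measurable_fun_bigsum => j; apply: measurable_funM => //; exact: measurable_Rn_coord.
have -> : a = off_dedge (enum_rank (Sub a aT : off_tree T0)).
  by rewrite /off_dedge enum_rankK SubK.
apply: (eq_measurable_fun (fun y : Rn R (off_tree T0) => y (Sub a aT : off_tree T0))).
  by move=> y _; rewrite flow_extend_off enum_rankK.
exact: measurable_Rn_coord.
Qed.

Lemma is_sfm_lebesgue_flow : is_sfm (@lebesgue_flow R G T0).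
Proof.
apply: (@is_sfm_pushforward _ _ _ _ _ _ _ (@flow_restr R G T0)).
- exact: is_sfm_lebesgue_Rn.
- exact: measurable_flow_extend.
- apply: measurable_RnP => b.
  apply: (eq_measurable_fun (fun k : flow R G => k (sval b))).
    by move=> k _; rewrite ffunE.
  exact: measurable_flow_coord.
- exact: flow_extendK.
Qed.

Lemma integral_lebesgue_flow (h : flow R G -> \bar R) :
  measurable_fun setT h -> (forall k, (0 <= h k)%E) ->
  (\int[@lebesgue_flow R G T0]_k h k =
   \int[@lebesgue_tuple R m]_t h (flow_extend (Rn_of_tuple t)))%E.
Proof.
move=> mh h0; rewrite -(integral_lebesgue_Rn (f := fun x => h (flow_extend x)))//; last first.
  by apply: measurableT_comp => //; exact: measurable_flow_extend.
apply: integral_pushforward_sfm => //; first exact: is_sfm_lebesgue_Rn.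
exact: measurable_flow_extend.
Qed.

(** * Gaussian integrals over the space of flows *)

Section FlowGaussian.
Variable w : V -> V -> R.
Hypothesis symw : forall i j, [set i; j]%SET \in edges G -> w i j = w j i.
Hypothesis w_gt0 : forall i j, [set i; j]%SET \in edges G -> 0 < w i j.

Local Notation wd a := (w (src a) (tgt a)).

Definition flow_energy (k : flow R G) : R := \sum_(a : dedge G) k a ^+ 2 / wd a.

Lemma wd_gt0 (a : dedge G) : 0 < wd a.
Proof. exact: w_gt0 (valP a). Qed.

Definition off_conduct : 'M[R]_m := diag_mx (\row_j wd (off_dedge j)).
Definition off_resist : 'M[R]_m := diag_mx (\row_j (wd (off_dedge j))^-1).
Definition tree_conduct : 'M[R]_n := diag_mx (\row_i wd (tree_dedge i)).
Definition tree_resist : 'M[R]_n := diag_mx (\row_i (wd (tree_dedge i))^-1).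

(** The matrix of the flow energy in off-tree coordinates: the resistances of the off-tree edges
    plus those of the tree edges pulled back along [tree_coef]. *)
Definition flow_mx : 'M[R]_m := off_resist + tree_coef^T *m tree_resist *m tree_coef.

Lemma flow_mxE i j : flow_mx i j = (i == j)%:R * (wd (off_dedge j))^-1 +
  \sum_k tree_coef k i * (wd (tree_dedge k))^-1 * tree_coef k j.
Proof.
rewrite mxE; congr (_ + _).
  rewrite mxE; case: eqVneq => [->|]; first by rewrite mul1r mxE mulr1n.
  by rewrite mul0r mulr0n.
rewrite mxE; apply: eq_bigr => k _; congr (_ * _).
by rewrite mul_mx_diag mxE [X in X * _]mxE [X in _ * X]mxE.
Qed.

Lemma flow_energy_tuple (t : m.-tuple R) :
  flow_energy (flow_extend (Rn_of_tuple t)) =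
  \sum_(i < m) \sum_(j < m) flow_mx i j * tfun t i * tfun t j.
Proof.
have tE (j : 'I_m) : (Rn_of_tuple t : Rn R (off_tree T0)) (enum_val j) = tfun t j.
  by rewrite ffunE enum_valK (tnth_nth 0).
rewrite /flow_energy big_dedge_tree /= addrC.
have -> : \sum_(i < m) \sum_(j < m) flow_mx i j * tfun t i * tfun t j =
  \sum_(i < m) \sum_(j < m) (i == j)%:R * (wd (off_dedge j))^-1 * tfun t i * tfun t j +
  \sum_(i < m) \sum_(j < m)
    (\sum_k tree_coef k i * (wd (tree_dedge k))^-1 * tree_coef k j) * tfun t i * tfun t j.
  rewrite -big_split; apply: eq_bigr => i _; rewrite -big_split; apply: eq_bigr => j _ /=.
  by rewrite flow_mxE !mulrDl.
congr (_ + _); apply/esym.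
  apply: eq_bigr => i _; rewrite (bigD1 i)//= big1 => [|j ji].
    by rewrite eqxx mul1r addr0 flow_extend_off tE -mulrA mulrC -expr2.
  by rewrite eq_sym (negbTE ji) !mul0r.
pose C := tree_coef; pose S i j k :=
  C k i * (wd (tree_dedge k))^-1 * C k j * tfun t i * tfun t j.
transitivity (\sum_(i < m) \sum_(j < m) \sum_(k < n) S i j k).
  by apply: eq_bigr => i _; apply: eq_bigr => j _; rewrite !mulr_suml.
transitivity (\sum_(k < n) \sum_(i < m) \sum_(j < m) S i j k).
  by rewrite [RHS]exchange_big /=; apply: eq_bigr => i _; exact: exchange_big.
apply: eq_bigr => k _; rewrite flow_extend_tree.
have -> : \sum_(j < m) tree_coef k j * (Rn_of_tuple t : Rn R (off_tree T0)) (enum_val j) =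
    \sum_(j < m) C k j * tfun t j by apply: eq_bigr => j _; rewrite tE.
rewrite expr2 !mulr_suml; apply: eq_bigr => i _.
by rewrite mulr_sumr mulr_suml; apply: eq_bigr => j _; rewrite /S; ring.
Qed.

Lemma flow_mx_sym i j : flow_mx i j = flow_mx j i.
Proof.
rewrite !flow_mxE; congr (_ + _).
  by have [->|] := eqVneq i j; rewrite ?mul0r.
by apply: eq_bigr => k _; ring.
Qed.

(** The energy of the off-tree edges is already positive, and the tree edges add a nonnegative
    amount. *)
Lemma flow_mx_pos (x : 'I_m -> R) : (exists i, x i != 0) ->
  0 < \sum_(i < m) \sum_(j < m) flow_mx i j * x i * x j.
Proof.
move=> [i xi]; pose t : m.-tuple R := [tuple x i | i < m].
have tx (k : 'I_m) : tfun t k = x k by rewrite /tfun -tnth_nth tnth_mktuple.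
under eq_bigr do under eq_bigr do rewrite -!tx.
rewrite -flow_energy_tuple /flow_energy big_dedge_tree /=.
have term0 (k : flow R G) a : 0 <= k a ^+ 2 / wd a.
  by rewrite divr_ge0 ?sqr_ge0// ltW// wd_gt0.
apply: ltr_wpDl; first by apply: sumr_ge0 => k _; exact: term0.
rewrite (bigD1 i)//=; apply: ltr_pwDl; last by apply: sumr_ge0 => k _; exact: term0.
rewrite flow_extend_off ffunE enum_valK (tnth_nth 0) -/(tfun t i) tx divr_gt0 ?wd_gt0//.
by rewrite lt_neqAle sqr_ge0 eq_sym sqrf_eq0 xi.
Qed.

(** The factor 2 arises because both directions of an edge occur, each with conductance [w]. *)
Lemma incidence_laplacian : tree_incidence *m tree_conduct *m tree_incidence^T +
  off_incidence *m off_conduct *m off_incidence^T =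
  reduced_laplacian (fun i j => 2 * w i j).
Proof.
apply/matrixP => i j; rewrite reduced_laplacianE.
transitivity (\sum_a incidence (nrv i) a * wd a * incidence (nrv j) a).
  rewrite big_dedge_tree mxE !mul_diag_trE /=.
  by congr (_ + _); apply: eq_bigr => k _; rewrite !mxE.
pose F x y := ((x == nrv i)%:R - (y == nrv i)%:R) * w x y * ((x == nrv j)%:R - (y == nrv j)%:R).
rewrite -[LHS]/(\sum_(a : dedge G) F (src a) (tgt a)) big_dedge_pair.
have E x y : adj_weight F x y =
    ((x == nrv i)%:R * adj_weight w x y * (x == nrv j)%:R -
     (x == nrv i)%:R * adj_weight w x y * (y == nrv j)%:R) +
    ((y == nrv i)%:R * adj_weight w y x * (y == nrv j)%:R -
     (y == nrv i)%:R * adj_weight w y x * (x == nrv j)%:R).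
  rewrite (adj_sym symw y x) /adj_weight; case: ifP => _; first by rewrite /F; ring.
  by rewrite !mulr0 !mul0r subrr addr0.
pose H x y := (x == nrv i)%:R * adj_weight w x y * (x == nrv j)%:R -
     (x == nrv i)%:R * adj_weight w x y * (y == nrv j)%:R.
have -> : \sum_x \sum_y adj_weight F x y = \sum_x \sum_y H x y + \sum_x \sum_y H x y.
  rewrite [X in _ = _ + X]exchange_big /= -big_split; apply: eq_bigr => x _.
  by rewrite -big_split; apply: eq_bigr => y _; rewrite E.
have adj2 x y : adj_weight (fun i j => 2 * w i j) x y = 2 * adj_weight w x y.
  by rewrite /adj_weight; case: ifP => //; rewrite mulr0.
under [in RHS]eq_bigr do rewrite adj2.
rewrite -mulr_sumr adj2.
have -> : \sum_x \sum_y H x y = (i == j)%:R * (\sum_v adj_weight w (nrv i) v) -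
    adj_weight w (nrv i) (nrv j).
  rewrite (bigD1 (nrv i))//= [X in _ + X]big1 ?addr0; last first.
    by move=> x xi; apply: big1 => y _; rewrite /H (negbTE xi) !mul0r subrr.
  rewrite /H eqxx (inj_eq (@nrv_inj G)).
  under eq_bigr do rewrite !mul1r mulrC.
  rewrite sumrB -mulr_sumr; congr (_ - _).
  rewrite (bigD1 (nrv j))//= eqxx mulr1 big1 ?addr0// => v vj.
  by rewrite (negbTE vj) mulr0.
ring.
Qed.

Lemma det_flow_mx :
  \det flow_mx * \prod_a wd a = \det (reduced_laplacian (fun i j => 2 * w i j)).
Proof.
have w0 (a : dedge G) : wd a != 0 by rewrite gt_eqF// wd_gt0.
have TT : tree_resist *m tree_conduct = 1%:M.
  rewrite mulmx_diag -diag_const_mx; congr diag_mx; apply/rowP => k.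
  by rewrite !mxE mulVf.
have OO : off_resist *m off_conduct = 1%:M.
  rewrite mulmx_diag -diag_const_mx; congr diag_mx; apply/rowP => k.
  by rewrite !mxE mulVf.
have dT : \det tree_conduct = \prod_(i < n) wd (tree_dedge i).
  by rewrite det_diag; apply: eq_bigr => i _; rewrite mxE.
have dO : \det off_conduct = \prod_(j < m) wd (off_dedge j).
  by rewrite det_diag; apply: eq_bigr => i _; rewrite mxE.
(* Both determinants are Schur complements of A. *)
pose C := tree_coef.
pose A : 'M[R]_(m + n) := block_mx off_resist (- C^T) C tree_conduct.
have A1 : \det A = \det flow_mx * \det tree_conduct.
  have := det_mulmx A (block_mx 1%:M 0 (- (tree_resist *m C)) 1%:M).
  rewrite det_lblock !det1 !mulr1 => <-.
  rewrite mulmx_block !mulmx1 !mulmx0 !add0r.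
  have -> : off_resist + - C^T *m - (tree_resist *m C) = flow_mx.
    by rewrite mulmxN mulNmx opprK mulmxA.
  rewrite mulmxN mulmxA (diag_mxC _ _ : tree_conduct *m tree_resist = _) TT mul1mx addrN.
  by rewrite det_ublock.
have A2 : \det A = \det off_resist * \det (tree_conduct + C *m off_conduct *m C^T).
  have := det_mulmx A (block_mx 1%:M (off_conduct *m C^T) 0 1%:M).
  rewrite det_ublock !det1 !mulr1 => <-.
  rewrite mulmx_block !mulmx1 !mulmx0 !addr0.
  rewrite (mulmxA off_resist) OO mul1mx addrN det_lblock.
  by rewrite mulmxA addrC.
have N2 : \det (tree_conduct + C *m off_conduct *m C^T) =
    \det (reduced_laplacian (fun i j => 2 * w i j)).
  (* As [tree_incidence *m C = - off_incidence], conjugating by [tree_incidence] turns the Schur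
     complement into the Laplacian, and this matrix has determinant plus or minus 1. *)
  rewrite -incidence_laplacian.
  have -> : tree_incidence *m tree_conduct *m tree_incidence^T +
      off_incidence *m off_conduct *m off_incidence^T =
    tree_incidence *m (tree_conduct + C *m off_conduct *m C^T) *m tree_incidence^T.
    rewrite mulmxDr mulmxDl; congr (_ + _).
    rewrite !mulmxA incidence_tree_coef -!mulmxA -trmx_mul incidence_tree_coef.
    by rewrite linearN /= !mulmxN !mulNmx opprK.
  by rewrite !det_mulmx det_tr mulrAC -expr2 det_tree_incidence_sq mul1r.
rewrite big_dedge_tree /= -dT -dO mulrA -A1 A2 N2 mulrAC -det_mulmx OO det1 mul1r.
by [].
Qed.

Theorem integral_flow_energy :
  (\int[@lebesgue_flow R G T0]_k (expR (- (2^-1 * flow_energy k)))%:E =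
   (Num.sqrt ((2 * pi) ^+ m * \prod_a wd a /
      \det (reduced_laplacian (fun i j => 2 * w i j))))%:E)%E.
Proof.
have [d0 dI] := integral_gaussian_mx flow_mx_sym flow_mx_pos.
rewrite integral_lebesgue_flow.
- under eq_integralT do rewrite flow_energy_tuple.
  rewrite dI; congr (_%:E); rewrite -det_flow_mx.
  have P0 : 0 < \prod_a wd a by apply: prodr_gt0 => a _; exact: wd_gt0.
  have pi2 : 0 <= 2 * pi :> R by rewrite mulr_ge0// pi_ge0.
  rewrite invfM mulrACA divff ?gt_eqF// mulr1.
  rewrite (sqrtrM (\det flow_mx)^-1 (exprn_ge0 m pi2)) (sqrtrV (ltW d0)); congr (_ / _).
  by elim: (#|off_tree T0|) => [|k IH]; rewrite ?expr0 ?sqrtr1// !exprS (sqrtrM _ pi2) IH.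
- apply/measurable_EFinP; apply: measurable_fun_expR; apply: measurable_fun_opp.
  apply: measurable_funM => //; apply: measurable_fun_bigsum => a.
  by apply: measurable_funM => //; apply: measurable_funX; exact: measurable_flow_coord.
- by move=> k; rewrite lee_fin expR_ge0.
Qed.

End FlowGaussian.
End Flows.

(** * The two measures *)

Section DensityProbability.
Context d (T : measurableType d) (R : realType).
Variables (m : {measure set T -> \bar R}) (f : T -> \bar R).
Hypotheses (mf : measurable_fun setT f) (f0 : forall x, (0 <= f x)%E).
Hypothesis f1 : (\int[m]_x f x = 1)%E.

Let p : set T -> \bar R := fun A => (\int[m]_(x in A) f x)%E.

Let p0 : p set0 = 0%E. Proof. by rewrite /p integral_set0. Qed.

Let p_ge0 A : (0 <= p A)%E. Proof. by apply: integral_ge0 => x _; exact: f0. Qed.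

Let p_additive : semi_sigma_additive p.
Proof.
move=> F mF tF mUF; rewrite /p ge0_integral_bigcup//=.
- by apply: is_cvg_ereal_nneg_natsum_cond => n _ _; exact: p_ge0.
- exact: measurable_funTS.
Qed.

#[local] HB.instance Definition _ := isMeasure.Build _ _ _ p p0 p_ge0 p_additive.

Let p_setT : p setT = 1%E. Proof. exact: f1. Qed.

#[local] HB.instance Definition _ := Measure_isProbability.Build _ _ _ p p_setT.

Lemma density_probability :
  exists P : probability T R, forall A, (\int[m]_(x in A) f x)%E = P A.
Proof. by exists p. Qed.

End DensityProbability.

Lemma integral_indic_sfm d (T : measurableType d) (R : realType) (m : set T -> \bar R)
    (A : set T) (f : T -> R) : is_sfm m ->
  (\int[m]_(x in A) (f x)%:E = \int[m]_x (\1_A x * f x)%:E)%E.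
Proof.
move=> [m' ->]; rewrite integral_mkcond; apply: eq_integral => x _.
by rewrite /patch indicE; case: (x \in A); rewrite ?mul1r ?mul0r.
Qed.

Lemma density_probability_sfm d (T : measurableType d) (R : realType) (m : set T -> \bar R)
    (f : T -> \bar R) : is_sfm m -> measurable_fun setT f -> (forall x, 0 <= f x)%E ->
  (\int[m]_x f x = 1)%E ->
  exists P : probability T R, forall A, (\int[m]_(x in A) f x)%E = P A.
Proof. by move=> [m' ->]; exact: density_probability. Qed.

(** On nonnegative reals, 0 included, the inverse is the real power with exponent -1, which is
    measurable on the whole line. *)
Lemma measurable_fun_inv d (T : measurableType d) (R : realType) (h : T -> R) :
  (forall x, 0 <= h x) -> measurable_fun setT h -> measurable_fun setT (fun x => (h x)^-1).
Proof.
move=> h0 mh; apply: (eq_measurable_fun (fun x => h x `^ (-1))).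
  by move=> x _; rewrite powR_inv1.
by apply: (measurableT_comp (f := fun x : R => x `^ (-1)) _ mh); exact: measurable_powR.
Qed.

Lemma integral_ge0_sfm d (T : measurableType d) (R : realType) (m : set T -> \bar R)
    (f : T -> \bar R) :
  is_sfm m -> (forall x, 0 <= f x)%E -> (0 <= \int[m]_x f x)%E.
Proof. by move=> [m' ->] f0; apply: integral_ge0 => x _. Qed.

Section ProductCounting.
Context d d' (T : measurableType d) (X : measurableType d') (R : realType).
Variable e : seq X.
Hypotheses (ue : uniq e) (me : forall x, x \in e).
Hypothesis mX : forall A : set X, measurable A.

Lemma measurable_sum_finite (f : T * X -> \bar R) :
  measurable_fun setT f -> measurable_fun setT (fun x => (\sum_(y <- e) f (x, y))%E).
Proof.
by move=> mf; apply: emeasurable_sum => y; apply: measurableT_comp.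
Qed.

Lemma integral_prod_counting (m : set T -> \bar R) (f : T * X -> \bar R) :
  is_sfm m -> measurable_fun setT f -> (forall z, 0 <= f z)%E ->
  (\int[m \x counting]_z f z = \int[m]_x \sum_(y <- e) f (x, y))%E.
Proof.
move=> sm mf f0.
rewrite (integral_prod_sfm1 sm (is_sfm_counting me mX R) mf f0).
by apply: eq_integralT => x; rewrite (integral_counting ue me mX).
Qed.

End ProductCounting.

(** * Iterated integrals over the two state spaces *)

Section Spaces.
Variables (R : realType) (G : rooted_graph).

Lemma uniq_enum_tree : uniq (enum {: tree G}). Proof. exact: enum_uniq. Qed.
Lemma mem_enum_tree (T : tree G) : T \in enum {: tree G}. Proof. by rewrite mem_enum. Qed.
Lemma measurable_tree (A : set (tree G)) : measurable A. Proof. by []. Qed.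

Lemma uniq_enum_vertex : uniq (enum {: vertex G} : seq (vertex_space G)).
Proof. exact: enum_uniq. Qed.
Lemma mem_enum_vertex (v : vertex_space G) : v \in (enum {: vertex G} : seq (vertex_space G)).
Proof. by rewrite (mem_enum {: vertex G} v). Qed.
Lemma measurable_vertex (A : set (vertex_space G)) : measurable A. Proof. by []. Qed.

Local Notation P := (lebesgue_pinned R G).
Local Notation cT := (counting : set (tree G) -> \bar R).
Local Notation cV := (counting : set (vertex_space G) -> \bar R).

Lemma is_sfm_tree : is_sfm cT.
Proof. exact: is_sfm_counting mem_enum_tree measurable_tree R. Qed.

Lemma is_sfm_vertex : is_sfm cV.
Proof. exact: is_sfm_counting mem_enum_vertex measurable_vertex R. Qed.

(** [u] is placed outermost because the Gaussian integral over [s] has a covariance depending on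
    [u]. *)
Lemma integral_susy_space (f : susy_space R G -> \bar R) :
  measurable_fun setT f -> (forall x, 0 <= f x)%E ->
  (\int[P \x P \x cT]_x f x =
   \int[P]_u \int[P]_s \sum_(T <- enum {: tree G}) f (s, u, T))%E.
Proof.
move=> mf f0; have sP := is_sfm_lebesgue_pinned R G.
have sPP := is_sfm_prod sP sP.
rewrite (integral_prod_counting uniq_enum_tree mem_enum_tree measurable_tree sPP mf f0).
apply: (integral_prod_sfm2 (f := fun z => (\sum_(T <- enum {: tree G}) f (z, T))%E)) => //.
- exact: measurable_sum_finite.
- by move=> x; apply: sume_ge0 => T _.
Qed.

Variables (T0 : {set dedge G}) (hT0 : directed_spanning_tree T0).
Local Notation F := (@lebesgue_flow R G T0).
Local Notation D := (lebesgue_diagonal R G).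

(** The diagonal measure identifies [v] with [u]. The flows are placed inside [s] and [u], so that
    the inner integral runs over the flow part of the fibre of the marginal map. *)
Lemma integral_big_space (f : big_space R G -> \bar R) :
  measurable_fun setT f -> (forall x, 0 <= f x)%E ->
  (\int[F \x F \x P \x D \x cV \x cV \x cT \x cT]_x f x =
   \int[P]_u \int[P]_s \int[F \x F]_k
     \sum_(i <- (enum {: vertex G} : seq (vertex_space G)))
     \sum_(i' <- (enum {: vertex G} : seq (vertex_space G)))
     \sum_(T <- enum {: tree G}) \sum_(T' <- enum {: tree G})
       f (k, s, (u, u), i, i', T, T'))%E.
Proof.
move=> mf f0.
have sP := is_sfm_lebesgue_pinned R G; have sD := is_sfm_lebesgue_diagonal R G.
have sF := is_sfm_lebesgue_flow R hT0.
have s2 := is_sfm_prod sF sF; have s3 := is_sfm_prod s2 sP; have s4 := is_sfm_prod s3 sD.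
have s5 := is_sfm_prod s4 is_sfm_vertex; have s6 := is_sfm_prod s5 is_sfm_vertex.
have s7 := is_sfm_prod s6 is_sfm_tree.
rewrite (integral_prod_counting uniq_enum_tree mem_enum_tree measurable_tree s7 mf f0).
pose f7 z := (\sum_(T' <- enum {: tree G}) f (z, T'))%E.
have m7 : measurable_fun setT f7 by exact: measurable_sum_finite.
have f70 z : (0 <= f7 z)%E by apply: sume_ge0 => T _.
rewrite (integral_prod_counting uniq_enum_tree mem_enum_tree measurable_tree s6 m7 f70).
pose f6 z := (\sum_(T <- enum {: tree G}) f7 (z, T))%E.
have m6 : measurable_fun setT f6 by exact: measurable_sum_finite.
have f60 z : (0 <= f6 z)%E by apply: sume_ge0 => T _.
rewrite (integral_prod_counting uniq_enum_vertex mem_enum_vertex measurable_vertex s5 m6 f60).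
pose f5 z := (\sum_(i' <- (enum {: vertex G} : seq (vertex_space G))) f6 (z, i'))%E.
have m5 : measurable_fun setT f5 by exact: measurable_sum_finite.
have f50 z : (0 <= f5 z)%E by apply: sume_ge0 => T _.
rewrite (integral_prod_counting uniq_enum_vertex mem_enum_vertex measurable_vertex s4 m5 f50).
pose f4 z := (\sum_(i <- (enum {: vertex G} : seq (vertex_space G))) f5 (z, i))%E.
have m4 : measurable_fun setT f4 by exact: measurable_sum_finite.
have f40 z : (0 <= f4 z)%E by apply: sume_ge0 => T _.
rewrite (integral_prod_sfm2 s3 sD m4 f40).
pose f3 y := (\int[F \x F \x P]_x f4 (x, y))%E.
have m3 : measurable_fun setT f3.
  have [M ME] := s3; rewrite /f3 ME.
  exact: (measurable_fun_fubini_tonelli_G f4).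
have f30 y : (0 <= f3 y)%E by apply: (integral_ge0_sfm s3) => x; exact: f40.
rewrite (integral_lebesgue_diagonal m3 f30); apply: eq_integralT => u.
have m4u : measurable_fun setT (fun z => f4 (z, (u, u))).
  by apply: (measurableT_comp m4); exact: measurable_fun_pair.
exact: (integral_prod_sfm2 s2 sP m4u (fun z => f40 _)).
Qed.

End Spaces.

Lemma sum_product4 (R : comPzRingType) (I J K L : finType) (c : R) (p : I -> R) (q : J -> R)
    (a : K -> R) (b f : L -> R) :
  \sum_i \sum_j \sum_k \sum_l f l * (c * a k * b l * (p i * q j)) =
  c * (\sum_k a k) * (\sum_l f l * b l) * ((\sum_i p i) * (\sum_j q j)).
Proof.
set A := \sum_k a k; set B := \sum_l f l * b l.
have inner y : \sum_k \sum_l f l * (c * a k * b l * y) = c * A * B * y.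
  transitivity (\sum_k a k * (c * y * B)); last by rewrite -mulr_suml -/A; ring.
  apply: eq_bigr => k _; rewrite !mulr_sumr; apply: eq_bigr => l _; ring.
rewrite big_distrlr /= mulr_sumr; apply: eq_bigr => i _.
by rewrite mulr_sumr; apply: eq_bigr => j _; exact: inner.
Qed.

(** * Summing and integrating out the additional variables *)

Section Marginal.
Variables (R : realType) (G : rooted_graph) (W : vertex G -> vertex G -> R).
Hypothesis hW : forall i j, [set i; j]%SET \in edges G -> W i j = W j i /\ 0 < W i j.
Variables (T0 : {set dedge G}) (hT0 : directed_spanning_tree T0).
Local Notation V := (vertex G).
Local Notation r := (root_vertex G).
Local Notation n := #|nonroot G|.
Local Notation m := #|off_tree T0|.
Local Notation Omega := (pinned R G).
Local Notation P := (lebesgue_pinned R G).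
Local Notation F := (@lebesgue_flow R G T0).
Local Notation D := (lebesgue_diagonal R G).
Local Notation cT := (counting : set (tree G) -> \bar R).
Local Notation cV := (counting : set (vertex_space G) -> \bar R).

Lemma omega_sym (u : Omega) i j : [set i; j]%SET \in edges G ->
  omega' W u i j = omega' W u j i.
Proof. by move=> /hW[ij _]; rewrite /omega' ij addrC. Qed.

Lemma omega_gt0 (u : Omega) i j : [set i; j]%SET \in edges G -> 0 < omega' W u i j.
Proof. by move=> /hW[_ w0]; rewrite mulr_gt0 ?expR_gt0// divr_gt0. Qed.

Lemma conductance_omega (u : Omega) : conductance W u = (fun i j => 2 * omega' W u i j).
Proof. by apply/funext => i; apply/funext => j; rewrite /conductance /omega'; field. Qed.

Lemma at_edge_omega_gt0 (u : Omega) e : e \in edges G -> 0 < at_edge (omega' W u) e.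
Proof.
move=> eE; have /eqP/cards2P[x [y [_ exy]]] := edge_card2 eE.
by rewrite exy in eE *; rewrite (at_edgeE (omega_sym u eE)) omega_gt0.
Qed.

Lemma tree_edges (T : tree G) e : e \in sval T -> e \in edges G.
Proof. by have /asboolP[/fintype.subsetP sub _ _] := valP T; exact: sub. Qed.

Lemma prod_tree_conductance (u : Omega) (T : tree G) :
  \prod_(e in sval T) at_edge (conductance W u) e =
  2 ^+ n * \prod_(e in sval T) at_edge (omega' W u) e.
Proof.
rewrite conductance_omega; under eq_bigr do rewrite at_edgeZ.
rewrite big_split /=; congr (_ * _).
(* A spanning tree has one edge per non-root vertex, hence [n] factors of 2. *)
have /asboolP/spanning_tree_forest[f rf <-] := valP T.
by rewrite (big_forest_edges rf) prodr_const card_ord.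
Qed.

Lemma det_conductance (u : Omega) : \det (reduced_laplacian (conductance W u)) =
  \sum_(T : tree G) \prod_(e in sval T) at_edge (conductance W u) e.
Proof. by apply: matrix_tree; exact: (@conductance_sym R G W hW). Qed.

(** [m] is the dimension of the flow space and thus fixes the power of 2 pi in each flow
    integral. *)
Lemma card_off_tree : (m + n = 2 * #|edges G|)%N.
Proof.
have : (\sum_(a : dedge G) 1 = \sum_(i < n) 1 + \sum_(j < m) 1)%N.
  exact: (big_dedge_tree hT0).
by rewrite !sum1_card !card_ord card_dedge addnC.
Qed.

Definition omega_energy (u : Omega) (k : flow R G) : R := flow_energy (omega' W u) k.

Lemma vertex_weights_sum1 (u : Omega) :
  \sum_(i : V) (expR (2 * u i) / \sum_j expR (2 * u j)) = 1.
Proof.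
rewrite -mulr_suml divff// gt_eqF//.
rewrite (bigD1 r)//= ltr_pwDl ?expR_gt0//.
by apply: sumr_ge0 => i _; exact: expR_ge0.
Qed.

(** [phi] stands for the indicator of a test set at given (s, u). The constant 4^(|V|-1) supplies
    each of the two trees with the factor 2^(|V|-1) that turns omega' into conductances; the sum
    over [T] is then the Laplacian determinant and the vertex weights sum to 1. *)
Lemma big_density_sum (phi : tree G -> R) (k k' : flow R G) (s u : Omega) :
  \sum_(i : V) \sum_(i' : V) \sum_(T : tree G) \sum_(T' : tree G)
    phi T' * big_density W k k' s u u i i' T T' =
  (\sum_(T' : tree G) phi T' * \prod_(e in sval T') at_edge (conductance W u) e) *
  ((2 * pi) ^- (2 * #|edges G|) * susy_weight W s u *
   \det (reduced_laplacian (conductance W u)) *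
   \prod_(e in edges G) ((at_edge (omega' W u) e) ^+ 2)^-1 *
   \prod_(i | i != r) expR (- u i)) *
  (expR (- (2^-1 * omega_energy u k)) * expR (- (2^-1 * omega_energy u k'))).
Proof.
rewrite det_conductance.
under [X in _ = X * _ * _]eq_bigr do rewrite prod_tree_conductance mulrCA.
under [X in _ = _ * (_ * _ * X * _ * _) * _]eq_bigr do rewrite prod_tree_conductance.
rewrite -!mulr_sumr.
pose a (T : tree G) := \prod_(e in sval T) at_edge (omega' W u) e.
pose q i := expR (2 * u i) / \sum_j expR (2 * u j).
pose c := 4 ^+ #|V|.-1 / (2 * pi) ^+ (2 * #|edges G|) * susy_weight W s u *
  \prod_(e in edges G) ((at_edge (omega' W u) e) ^+ 2)^-1 *
  (expR (- (2^-1 * omega_energy u k)) * expR (- (2^-1 * omega_energy u k'))) *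
  \prod_(i | i != r) expR (- u i).
have E i i' T T' : big_density W k k' s u u i i' T T' = c * a T * a T' * (q i * q i').
  rewrite /big_density.
  have -> : expR (- \sum_(a0 : dedge G)
      (k a0 ^+ 2 + k' a0 ^+ 2) / (2 * omega' W u (src a0) (tgt a0))) =
      expR (- (2^-1 * omega_energy u k)) * expR (- (2^-1 * omega_energy u k')).
    rewrite -expRD -opprD -mulrDr -big_split mulr_sumr; congr (expR (- _)).
    by apply: eq_bigr => d _ /=; rewrite invfM; ring.
  have -> : expR (2 * u i + 2 * u i') / ((\sum_j expR (2 * u j)) * (\sum_j expR (2 * u j))) =
      q i * q i' by rewrite expRD invfM /q; ring.
  by rewrite /c /a; ring.
transitivity (\sum_(i : V) \sum_(i' : V) \sum_(T : tree G) \sum_(T' : tree G)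
    phi T' * (c * a T * a T' * (q i * q i'))).
  apply: eq_bigr => i _; apply: eq_bigr => i' _; apply: eq_bigr => T _.
  by apply: eq_bigr => T' _; rewrite E.
rewrite sum_product4 (vertex_weights_sum1 u) !mulr1 /c -card_nonroot.
rewrite (_ : 4 ^+ n = 2 ^+ n * 2 ^+ n); last by rewrite -exprMn -natrM.
by rewrite /a; ring.
Qed.

Lemma susy_densityE (s u : Omega) (T' : tree G) : susy_density W s u T' =
  susy_weight W s u * \prod_(e in sval T') at_edge (conductance W u) e *
  \prod_(i | i != r) expR (- u i) * (2 * pi) ^- n.
Proof.
rewrite /susy_density -!mulrA; congr (_ * (_ * _)).
by rewrite big_split /= !big_nonroot prodr_const card_ord exprVn.
Qed.

(** Two flow integrals square the root in [g], which cancels the determinant. The product of omega'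
    over directed edges is the product of its squares over edges, cancelling the weights of the
    density, and 2|E| = m + n leaves exactly n powers of 2 pi. *)
Lemma flow_const (u : Omega) :
  let D := \det (reduced_laplacian (conductance W u)) in
  let g := Num.sqrt ((2 * pi) ^+ m * \prod_a omega' W u (src a) (tgt a) / D) in
  (2 * pi) ^- (2 * #|edges G|) * D *
   \prod_(e in edges G) ((at_edge (omega' W u) e) ^+ 2)^-1 * (g * g) = (2 * pi) ^- n :> R.
Proof.
move=> D g; have D0 : 0 < D by have [] := integral_dirichlet hW u.
have p0 : 0 < 2 * pi :> R by rewrite mulr_gt0// pi_gt0.
have aE : \prod_a omega' W u (src a) (tgt a) =
    \prod_(e in edges G) (at_edge (omega' W u) e) ^+ 2.
  exact: (big_dedge _ (@omega_sym u)).
have P0 : 0 < \prod_(e in edges G) (at_edge (omega' W u) e) ^+ 2.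
  by apply: prodr_gt0 => e eE; rewrite exprn_gt0// at_edge_omega_gt0.
rewrite -expr2 /g aE sqr_sqrtr; last first.
  by rewrite divr_ge0 ?(ltW D0)// mulr_ge0 ?(ltW P0)// exprn_ge0// ltW.
rewrite prodfV -card_off_tree exprD.
have alg (x y d q : R) : x != 0 -> y != 0 -> d != 0 -> q != 0 ->
    (x * y)^-1 * d * q^-1 * (x * q / d) = y^-1.
  by move=> x0 y0 d0 q0; field; rewrite x0 y0 d0 q0.
by apply: alg; rewrite ?expf_neq0 ?gt_eqF.
Qed.

Lemma measurable_flow_energy w : measurable_fun setT (fun k : flow R G => flow_energy w k).
Proof.
apply: measurable_fun_bigsum => a; apply: measurable_funM => //.
by apply: measurable_funX; exact: measurable_flow_coord.
Qed.

Lemma integral_big_fibre (phi : tree G -> R) (s u : Omega) : (forall T, 0 <= phi T) ->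
  (\int[F \x F]_k
     \sum_(i <- (enum {: V} : seq (vertex_space G)))
     \sum_(i' <- (enum {: V} : seq (vertex_space G)))
     \sum_(T <- enum {: tree G}) \sum_(T' <- enum {: tree G})
       (phi T' * big_density W k.1 k.2 s u u i i' T T')%:E =
   \sum_(T' <- enum {: tree G}) (phi T' * susy_density W s u T')%:E)%E.
Proof.
move=> phi0.
have sF := is_sfm_lebesgue_flow R hT0.
pose D := \det (reduced_laplacian (conductance W u)).
pose g := Num.sqrt ((2 * pi) ^+ m * \prod_a omega' W u (src a) (tgt a) / D).
pose C := (\sum_(T' : tree G) phi T' * \prod_(e in sval T') at_edge (conductance W u) e) *
  ((2 * pi) ^- (2 * #|edges G|) * susy_weight W s u * D *
   \prod_(e in edges G) ((at_edge (omega' W u) e) ^+ 2)^-1 *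
   \prod_(i | i != r) expR (- u i)).
pose h (k : flow R G) := expR (- (2^-1 * omega_energy u k)).
have mh : measurable_fun setT h.
  apply: measurable_fun_expR; apply: measurable_fun_opp; apply: measurable_funM => //.
  exact: measurable_flow_energy.
have h0 k : 0 <= h k by exact: expR_ge0.
have hI : (\int[F]_k (h k)%:E = g%:E)%E.
  rewrite /h /g /D conductance_omega.
  exact: (integral_flow_energy hT0 (@omega_sym u) (@omega_gt0 u)).
have mhE : measurable_fun setT (fun k => (h k)%:E) by apply/measurable_EFinP.
have hE0 k : (0 <= (h k)%:E)%E by rewrite lee_fin.
have D0 : 0 < D by have [] := integral_dirichlet hW u.
have C0 : 0 <= C.
  have pc (T' : tree G) : 0 <= \prod_(e in sval T') at_edge (conductance W u) e.
    rewrite prod_tree_conductance mulr_ge0 ?exprn_ge0//.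
    by apply: prodr_ge0 => e /tree_edges eE; rewrite ltW// at_edge_omega_gt0.
  apply: mulr_ge0; first by apply: sumr_ge0 => T' _; rewrite mulr_ge0.
  rewrite !mulr_ge0 ?expR_ge0 ?(ltW D0) ?invr_ge0 ?exprn_ge0 ?mulr_ge0 ?pi_ge0//.
    by apply: prodr_ge0 => e _; rewrite invr_ge0 sqr_ge0.
  by apply: prodr_ge0 => i _; exact: expR_ge0.
transitivity (\int[F \x F]_k (C%:E * (h k.1 * h k.2)%:E))%E.
  apply: eq_integralT => k.
  under eq_bigr do under eq_bigr do under eq_bigr do rewrite sumEFin.
  under eq_bigr do under eq_bigr do rewrite sumEFin.
  under eq_bigr do rewrite sumEFin.
  rewrite sumEFin -EFinM; congr (_%:E).
  rewrite -(big_density_sum phi k.1 k.2 s u) big_enum /=; apply: eq_bigr => i _.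
  rewrite big_enum /=; apply: eq_bigr => i' _.
  rewrite big_enum /=; apply: eq_bigr => T _.
  by rewrite big_enum.
have mhh : measurable_fun setT (fun k : flow R G * flow R G => (h k.1 * h k.2)%:E).
  by apply/measurable_EFinP; apply: measurable_funM; exact: measurableT_comp.
have hh0 (k : flow R G * flow R G) : (0 <= (h k.1 * h k.2)%:E)%E by rewrite lee_fin mulr_ge0.
rewrite (integralZl_sfm (is_sfm_prod sF sF) mhh hh0 C0).
rewrite (integral_prod_sfm1 sF sF mhh hh0) /=.
have -> : (\int[F]_k \int[F]_k' (h k * h k')%:E = (g * g)%:E)%E.
  transitivity (\int[F]_k (g%:E * (h k)%:E))%E.
    apply: eq_integralT => k; rewrite muleC -hI -(integralZl_sfm sF mhE hE0 (h0 k)).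
    by apply: eq_integralT => k'; rewrite EFinM.
  by rewrite (integralZl_sfm sF mhE hE0 (sqrtr_ge0 _)) hI.
rewrite sumEFin -EFinM; congr (_%:E).
rewrite /C mulr_suml mulr_suml big_enum /=; apply: eq_bigr => T' _.
rewrite susy_densityE -(flow_const u) -/D -/g.
have alg (p c x w d q e g2 : R) : p * c * (x * w * d * q * e) * g2 =
  p * (w * c * e * (x * d * q * g2)) by ring.
exact: alg.
Qed.

Definition susy_fun (x : susy_space R G) : R := let: (s, u, T') := x in susy_density W s u T'.

Definition big_fun (x : big_space R G) : R :=
  let: (k, k', s, (v, u), i1, i1', T, T') := x in big_density W k k' s v u i1 i1' T T'.

Section MeasurableDensities.
Context d (T : measurableType d).
Implicit Types u s : T -> Omega.

Lemma measurable_pinned_at u i : measurable_fun setT u -> measurable_fun setT (fun x => u x i).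
Proof. by move=> mu; exact: (measurableT_comp (measurable_pinned_coord i)). Qed.

Lemma measurable_expR_at u c i : measurable_fun setT u ->
  measurable_fun setT (fun x => expR (c * u x i)).
Proof.
move=> mu; apply: measurable_fun_expR; apply: measurable_funM => //.
exact: measurable_pinned_at.
Qed.

Lemma measurable_susy_weight s u : measurable_fun setT s -> measurable_fun setT u ->
  measurable_fun setT (fun x => susy_weight W (s x) (u x)).
Proof.
move=> ms mu; apply: (eq_measurable_fun
  (fun x => expR (bond_energy W (u x)) * expR (- (2^-1 * dirichlet W (u x) (s x))))).
  by move=> x _; rewrite susy_weightE.
apply: measurable_funM; apply: measurable_fun_expR; first exact: measurable_bond_energy.
by apply: measurable_fun_opp; apply: measurable_funM => //; exact: measurable_dirichlet.
Qed.

Lemma measurable_susy_density s u (T' : tree G) :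
  measurable_fun setT s -> measurable_fun setT u ->
  measurable_fun setT (fun x => susy_density W (s x) (u x) T').
Proof.
move=> ms mu; apply: measurable_funM; first apply: measurable_funM.
- exact: measurable_susy_weight.
- apply: measurable_fun_bigprod => e; apply: measurable_at_edge => i j.
  exact: measurable_conductance.
- apply: measurable_fun_bigprod => i; apply: measurable_funM => //.
  by apply: measurable_fun_expR; apply: measurable_fun_opp; exact: measurable_pinned_at.
Qed.

Lemma measurable_omega u i j : measurable_fun setT u ->
  measurable_fun setT (fun x => omega' W (u x) i j).
Proof.
move=> mu; apply: measurable_funM => //; apply: measurable_fun_expR.
by apply: measurable_funD; exact: measurable_pinned_at.
Qed.

Lemma measurable_big_density (k k' : T -> flow R G) s v u i i' (T1 T' : tree G) :
  measurable_fun setT k -> measurable_fun setT k' ->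
  measurable_fun setT s -> measurable_fun setT v -> measurable_fun setT u ->
  measurable_fun setT (fun x => big_density W (k x) (k' x) (s x) (v x) (u x) i i' T1 T').
Proof.
move=> mk mk' ms mv mu.
have mo e : measurable_fun setT (fun x => at_edge (omega' W (u x)) e).
  by apply: measurable_at_edge => a b; exact: measurable_omega.
have msum (w : T -> Omega) : measurable_fun setT w ->
    measurable_fun setT (fun x => \sum_j expR (2 * w x j)).
  by move=> mw; apply: measurable_fun_bigsum => j; exact: measurable_expR_at.
have sum0 (w : Omega) : 0 <= \sum_j expR (2 * w j).
  by apply: sumr_ge0 => j _; exact: expR_ge0.
repeat apply: measurable_funM => //.
- exact: measurable_susy_weight.
- exact: measurable_fun_bigprod.
- exact: measurable_fun_bigprod.
- apply: measurable_fun_bigprod => e; apply: measurable_fun_inv => [x|]; first exact: sqr_ge0.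
  exact: measurable_funX.
- apply: measurable_fun_expR; apply: measurable_fun_opp; apply: measurable_fun_bigsum => a.
  have mc (l : T -> flow R G) : measurable_fun setT l -> measurable_fun setT (fun x => l x a).
    by move=> ml; exact: (measurableT_comp (measurable_flow_coord a)).
  apply: measurable_funM.
    by apply: measurable_funD; apply: measurable_funX; exact: mc.
  apply: measurable_fun_inv => [x|].
    by rewrite mulr_ge0// ltW// omega_gt0//; exact: svalP a.
  by apply: measurable_funM => //; exact: measurable_omega.
- apply: measurable_fun_expR; apply: measurable_funD; apply: measurable_funM => //;
  exact: measurable_pinned_at.
- apply: measurable_fun_inv => [x|]; first by rewrite mulr_ge0.
  by apply: measurable_funM; exact: msum.
- apply: measurable_fun_bigprod => j; apply: measurable_fun_expR.
  by apply: measurable_fun_opp; exact: measurable_pinned_at.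
Qed.

End MeasurableDensities.

Lemma measurable_susy_fun : measurable_fun setT susy_fun.
Proof.
apply: (measurable_fun_finite (@mem_enum_tree G) (@measurable_tree G)) => T'.
apply: (eq_measurable_fun (fun t : Omega * Omega => susy_density W t.1 t.2 T')).
  by move=> [s u].
exact: measurable_susy_density.
Qed.

Lemma measurable_big_fun : measurable_fun setT big_fun.
Proof.
apply: (measurable_fun_finite (@mem_enum_tree G) (@measurable_tree G)) => T'.
apply: (measurable_fun_finite (@mem_enum_tree G) (@measurable_tree G)) => T1.
apply: (measurable_fun_finite (@mem_enum_vertex G) (@measurable_vertex G)) => i'.
apply: (measurable_fun_finite (@mem_enum_vertex G) (@measurable_vertex G)) => i.
apply: (eq_measurable_fun (fun t : flow R G * flow R G * Omega * (Omega * Omega) =>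
  big_density W t.1.1.1 t.1.1.2 t.1.2 t.2.1 t.2.2 i i' T1 T')).
  by move=> [[[k k'] s] [v u]].
have m1 : measurable_fun setT
  (fun t : flow R G * flow R G * Omega * (Omega * Omega) => t.1.1).
  exact: (measurableT_comp measurable_fst measurable_fst).
apply: measurable_big_density.
- exact: (measurableT_comp measurable_fst m1).
- exact: (measurableT_comp measurable_snd m1).
- exact: (measurableT_comp measurable_snd measurable_fst).
- exact: (measurableT_comp measurable_fst measurable_snd).
- exact: (measurableT_comp measurable_snd measurable_snd).
Qed.

Lemma measurable_marginal_suT : measurable_fun setT (@marginal_suT R G).
Proof.
apply: (eq_measurable_fun (fun x : big_space R G =>
  (x.1.1.1.1.1.2, x.1.1.1.1.2.2, x.2))).
  by move=> [[[[[[[k k'] s] [v u]] i] i'] T1] T'].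
have m2 : measurable_fun setT (fun x : big_space R G => x.1.1).
  exact: (measurableT_comp measurable_fst measurable_fst).
have m3 : measurable_fun setT (fun x : big_space R G => x.1.1.1).
  exact: (measurableT_comp measurable_fst m2).
have m4 : measurable_fun setT (fun x : big_space R G => x.1.1.1.1).
  exact: (measurableT_comp measurable_fst m3).
apply: measurable_fun_pair; last exact: measurable_snd.
apply: measurable_fun_pair.
  exact: (measurableT_comp measurable_snd (measurableT_comp measurable_fst m4)).
exact: (measurableT_comp measurable_snd (measurableT_comp measurable_snd m4)).
Qed.

Lemma susy_fun_ge0 x : 0 <= susy_fun x.
Proof.
case: x => [[s u] T']; rewrite /susy_fun susy_densityE.
rewrite !mulr_ge0 ?expR_ge0 ?invr_ge0 ?exprn_ge0 ?mulr_ge0 ?pi_ge0//.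
  rewrite prod_tree_conductance mulr_ge0 ?exprn_ge0//.
  by apply: prodr_ge0 => e /tree_edges eE; rewrite ltW// at_edge_omega_gt0.
by apply: prodr_ge0 => i _; exact: expR_ge0.
Qed.

Lemma big_fun_ge0 x : 0 <= big_fun x.
Proof.
case: x => [[[[[[[k k'] s] [v u]] i] i'] T1] T']; rewrite /big_fun /big_density.
have tree_ge0 (T : tree G) : 0 <= \prod_(e in sval T) at_edge (omega' W u) e.
  by apply: prodr_ge0 => e /tree_edges eE; rewrite ltW// at_edge_omega_gt0.
have sum0 (w : Omega) : 0 <= \sum_j expR (2 * w j).
  by apply: sumr_ge0 => j _; exact: expR_ge0.
rewrite !mulr_ge0 ?expR_ge0 ?invr_ge0 ?mulr_ge0 ?exprn_ge0 ?mulr_ge0 ?pi_ge0//.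
  by apply: prodr_ge0 => e _; rewrite invr_ge0 sqr_ge0.
by apply: prodr_ge0 => j _; exact: expR_ge0.
Qed.

Lemma mu_susyE (A : set (susy_space R G)) : measurable A ->
  (mu_susy W A = \int[P]_u \int[P]_s \sum_(T' <- enum {: tree G})
     (\1_A (s, u, T') * susy_density W s u T')%:E)%E.
Proof.
move=> mA; have sP := is_sfm_lebesgue_pinned R G.
have E : mu_susy W A = (\int[P \x P \x cT]_(x in A) (susy_fun x)%:E)%E.
  by congr (integral _ _ _); apply/funext => -[[]].
rewrite E (integral_indic_sfm _ _ (is_sfm_prod (is_sfm_prod sP sP) (is_sfm_tree R G))).
rewrite (@integral_susy_space R G (fun x => (\1_A x * susy_fun x)%:E)) //.
  apply/measurable_EFinP; apply: measurable_funM; last exact: measurable_susy_fun.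
  exact: measurable_indic.
by move=> x; rewrite lee_fin mulr_ge0// susy_fun_ge0.
Qed.

Lemma is_sfm_big : is_sfm (F \x F \x P \x D \x cV \x cV \x cT \x cT)%E.
Proof.
have sP := is_sfm_lebesgue_pinned R G; have sD := is_sfm_lebesgue_diagonal R G.
have sF := is_sfm_lebesgue_flow R hT0.
have sT := is_sfm_tree R G; have sV := is_sfm_vertex R G.
by do 7 (apply: is_sfm_prod => //).
Qed.

Lemma mu_big_density (A : set (big_space R G)) :
  mu_big W T0 A = (\int[F \x F \x P \x D \x cV \x cV \x cT \x cT]_(x in A) (big_fun x)%:E)%E.
Proof. by congr (integral _ _ _); apply/funext => -[[[[[[[? ?] ?] []] ?] ?] ?] ?]. Qed.

Lemma mu_big_marginal (A : set (susy_space R G)) : measurable A ->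
  pushforward (mu_big W T0) (@marginal_suT R G) A = mu_susy W A.
Proof.
move=> mA; rewrite mu_susyE// /pushforward mu_big_density (integral_indic_sfm _ _ is_sfm_big).
rewrite (@integral_big_space R G T0 hT0
  (fun x => (\1_(@marginal_suT R G @^-1` A) x * big_fun x)%:E)).
- apply: eq_integralT => u; apply: eq_integralT => s.
  (* The indicator of the preimage depends only on (s, u, T'), so at fixed (s, u) it is a weight on
     [T']. *)
  rewrite -(integral_big_fibre (phi := fun T' => \1_A (s, u, T')))//.
  by apply: eq_integralT => -[k k'].
- apply/measurable_EFinP; apply: measurable_funM; last exact: measurable_big_fun.
  apply: measurable_indic; rewrite -[X in measurable X]setTI.
  exact: measurable_marginal_suT.
- by move=> x; rewrite lee_fin mulr_ge0// big_fun_ge0.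
Qed.

(** The tree sum gives det D and the Gaussian in [s] its inverse square root, which leaves sqrt(det
    D). The s-integral and the u-integral each use half of the powers of 2 pi in the density. *)
Lemma mu_susy_setT : mu_susy W setT = 1%E.
Proof.
rewrite mu_susyE//; have sP := is_sfm_lebesgue_pinned R G.
have p0 : 0 < 2 * pi :> R by rewrite mulr_gt0// pi_gt0.
pose L u := \det (reduced_laplacian (conductance W u)).
pose h u := expR (bond_energy W u) * Num.sqrt (L u) * \prod_(i | i != r) expR (- fun_of_pinned u i).
have mh : measurable_fun setT (fun u => (h u)%:E).
  apply/measurable_EFinP; apply: measurable_funM; last exact: measurable_prod_expRN.
  apply: measurable_funM; last by apply: measurable_fun_sqrt; exact: measurable_det_laplacian.
  by apply: measurable_fun_expR; exact: measurable_bond_energy.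
have h0 u : (0 <= (h u)%:E)%E.
  rewrite lee_fin !mulr_ge0 ?expR_ge0 ?sqrtr_ge0//.
  by apply: prodr_ge0 => i _; exact: expR_ge0.
pose q := Num.sqrt (2 * pi) : R.
pose c := q ^+ n / (2 * pi) ^+ n.
have c0 : 0 <= c by rewrite divr_ge0 ?exprn_ge0 ?sqrtr_ge0 ?ltW.
transitivity (\int[P]_u (c%:E * (h u)%:E))%E; last first.
  rewrite (integralZl_sfm sP mh h0 c0) (integral_susy_u hW) -EFinM; congr (_%:E).
  rewrite /c mulrAC -exprMn -expr2 sqr_sqrtr ?(ltW p0)// divff// expf_neq0// gt_eqF//.
apply: eq_integralT => u.
have [L0 LI] := integral_dirichlet hW u; rewrite -/(L u) in L0 LI.
pose g s := expR (- (2^-1 * dirichlet W u s)).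
have mg : measurable_fun setT (fun s => (g s)%:E).
  apply/measurable_EFinP; apply: measurable_fun_expR; apply: measurable_fun_opp.
  by apply: measurable_funM => //; exact: measurable_dirichlet.
have g0 s : (0 <= (g s)%:E)%E by rewrite lee_fin expR_ge0.
pose b := expR (bond_energy W u) * L u *
  \prod_(i | i != r) expR (- fun_of_pinned u i) * (2 * pi) ^- n.
have b0 : 0 <= b.
  rewrite !mulr_ge0 ?expR_ge0 ?(ltW L0) ?invr_ge0 ?exprn_ge0 ?(ltW p0)//.
  by apply: prodr_ge0 => i _; exact: expR_ge0.
transitivity (\int[P]_s (b%:E * (g s)%:E))%E.
  apply: eq_integralT => s; rewrite sumEFin -EFinM; congr (_%:E); rewrite big_enum /=.
  rewrite /b /L det_conductance mulr_sumr !mulr_suml; apply: eq_bigr => T' _.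
  rewrite indicE in_setT mul1r susy_densityE susy_weightE -/(g s).
  have alg (e d p N K : R) : e * d * p * N * K = e * p * N * K * d by ring.
  exact: alg.
rewrite (integralZl_sfm sP mg g0 b0) LI -!EFinM; congr (_%:E).
rewrite -/q /b /c /h -{1}[L u]sqr_sqrtr ?(ltW L0)//.
have S0 : Num.sqrt (L u) != 0 by rewrite gt_eqF// sqrtr_gt0.
have alg (e S p x y : R) : S != 0 -> e * S ^+ 2 * p * x * (y / S) = y * x * (e * S * p).
  by move=> ?; field.
exact: alg.
Qed.

Lemma mu_big_probability : exists Q : probability (big_space R G) R,
  forall A, mu_big W T0 A = Q A.
Proof.
have mf : measurable_fun setT (fun x => (big_fun x)%:E).
  by apply/measurable_EFinP; exact: measurable_big_fun.
have f0 x : (0 <= (big_fun x)%:E)%E by rewrite lee_fin big_fun_ge0.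
have f1 : (\int[F \x F \x P \x D \x cV \x cV \x cT \x cT]_x (big_fun x)%:E = 1)%E.
  (* The marginal map pulls the whole space back to the whole space, so the two measures have the
     same mass. *)
  rewrite -mu_big_density -mu_susy_setT.
  by rewrite -(mu_big_marginal measurableT) /pushforward preimage_setT.
have [|Q QE] := density_probability_sfm is_sfm_big _ f0 f1; first exact mf.
by exists Q => A; exact (etrans (mu_big_density A) (QE A)).
Qed.

End Marginal.

Theorem theorem1p3 (R : realType) (G : rooted_graph)
    (W : vertex G -> vertex G -> R) (T0 : {set dedge G}) :
  (forall i j, [set i; j]%SET \in edges G -> W i j = W j i /\ 0 < W i j) ->
  directed_spanning_tree T0 ->
  (forall A : set (susy_space R G), measurable A ->
     pushforward (mu_big W T0) (@marginal_suT R G) A = mu_susy W A) /\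
  (exists P : probability (big_space R G) R,
     forall A : set (big_space R G), measurable A -> mu_big W T0 A = P A).
Proof.
move=> hW hT0; split; first exact: mu_big_marginal.
by have [Q QE] := mu_big_probability hW hT0; exists Q => A _.
Qed.
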